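(* Let $C,D\subset\mathbb{R}^p$, let $f:\mathbb{R}^n\times\mathbb{R}^p\times\mathbb{R}_{\geq0}\times\mathbb{R}_{\geq0}\to\mathbb{R}^n$, $w:\mathbb{R}^p\to\mathbb{R}^p$, $g:\mathbb{R}^n\times\mathbb{R}^p\times\mathbb{R}^m\to\mathbb{R}^n$, $h:\mathbb{R}^p\times\mathbb{R}^m\to\mathbb{R}^p$, and let $\{\mathbf{v}_\ell\}_{\ell\ge1}$ be i.i.d. random variables $\mathbf v_\ell:\Omega\to\mathbb{R}^m$ on a probability space $(\Omega,\mathcal F,\mathbb P)$ with common law $\mu$; put $\mathcal V:=\{\mathbf v_{\ell}(\omega):\omega\in\Omega,\ \ell\geq 1\}$. For $\varepsilon>0$ consider the stochastic hybrid dynamical system (SHDS) $\mathcal H_\varepsilon$ with state $(x,r,\tau)\in\mathbb{R}^n\times\mathbb{R}^p\times\mathbb{R}_{\geq0}$: $$(x,r,\tau)\in\mathbb{R}^n\times C\times\mathbb{R}_{\ge0}:\quad \dot x=f(x,r,\tau,\varepsilon),\quad \dot r=w(r),\quad \dot\tau=\tfrac1\varepsilon,$$ $$(x,r,\tau)\in\mathbb{R}^n\times D\times\mathbb{R}_{\ge0}:\quad x^+=g(x,r,v^+),\quad r^+=h(r,v^+),\quad \tau^+=\tau,\qquad v\sim\mu .$$ Suppose the following three assumptions hold. **(A1)** There exists $\varepsilon^*>0$ such that: 1. $f$ is $\mathcal C^1$; $w,g,h$ are continuous; $C$ and $D$ are compact. 2. $f(0,r,\tau,\varepsilon)=0$ for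 all $(r,\tau,\varepsilon)\in(C\cup D)\times\mathbb{R}_{\ge0}\times[0,\varepsilon^* )$. 3. $g(0,r,v)=0$ for all $r\in C\cup D$, $v\in\mathcal V$. 4. There is $L_x\ge0$ with $|f(x_1,r,\tau,\varepsilon)-f(x_2,r,\tau,\varepsilon)|\le L_x|x_1-x_2|$ for all $r\in C\cup D$, $x_1,x_2\in\mathbb{R}^n$, $\tau\ge0$, $\varepsilon\in[0,\varepsilon^* )$. 5. There is $L_{\varepsilon^*}\ge0$ with $|f(x,r,\tau,\varepsilon_1)-f(x,r,\tau,\varepsilon_2)|\le L_{\varepsilon^*}|x||\varepsilon_1-\varepsilon_2|$ for all $r\in C\cup D$, $x\in\mathbb{R}^n$, $\tau\ge0$, $\varepsilon_1,\varepsilon_2\in(0,\varepsilon^* )$. 6. There is $L_g>0$ with $|g(x_1,r,v)-g(x_2,r,v)|\le L_g|x_1-x_2|$ for all $r\in C\cup D$, $x_1,x_2\in\mathbb{R}^n$, $v\in\mathcal V$. 7. $(g(x,r,v),h(r,v))\in\mathbb{R}^n\times(C\cup D)$ for all $(x,r,v)\in\mathbb{R}^n\times D\times\mathcal V$, and there is $H>0$ with $|h(r,v)|\le H$ for all $(r,v)\in D\times\mathcal V$. **(A2)** There exist a $\mathcal C^1$ function $f_{\rm ave}:\mathbb{R}^n\times\mathbb{R}^p\to\mathbb{R}^n$ and a continuous, bounded, non-increasing function $\gamma:\mathbb{R}_{\ge0}\to\mathbb{R}_{\ge0}$ with $\lim_{s\to\infty}\gamma(s)=0$ such that, for all $x\in\mathbb{R}^n$,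 $r\in C\cup D$, $\tau\geq 0$, $T>0$, with $d(x,r,s):=f(x,r,s,0)-f_{\rm ave}(x,r)$, $$\Big|\frac1T\int_\tau^{\tau+T} d(x,r,s)\,ds\Big|\le\gamma(T)|x|,\qquad \Big|\frac1T\int_\tau^{\tau+T}\frac{\partial d(x,r,s)}{\partial(x,r)}\,ds\Big|\le\gamma(T),$$ and there is $L_{\rm ave}\ge0$ with $|f_{\rm ave}(x_1,r)-f_{\rm ave}(x_2,r)|\le L_{\rm ave}|x_1-x_2|$ for all $x_1,x_2\in\mathbb{R}^n$, $r\in C\cup D$. **(A3)** Let $\mathcal A:=\{0\}\times(C\cup D)\subset\mathbb{R}^n\times\mathbb{R}^p$. There exist a smooth function $V:\mathbb{R}^n\times(C\cup D)\to\mathbb{R}_{\ge0}$ and constants $c_1,\dots,c_5>0$ such that, writing $z=(\hat x,\hat r)$, $F_{\rm ave}(z):=(f_{\rm ave}(\hat x,\hat r),w(\hat r))$ and $G_{\rm ave}(z,v):=(g(\hat x,\hat r,v),h(\hat r,v))$, $$c_1|z|_{\mathcal A}^2\le V(z)\le c_2|z|_{\mathcal A}^2,\quad |\nabla V(z)|\le c_3|z|_{\mathcal A}\qquad\forall z\in\mathbb{R}^n\times(C\cup D),$$ $$\langle\nabla V(z),F_{\rm ave}(z)\rangle\le -c_4V(z)\qquad\forall z\in\mathbb{R}^n\times C,$$ $$\int_{\mathbb{R}^m}V(G_{\rm ave}(z,v))\,\mu(dv)\le c_5V(z)\qquad\forall z\in\mathbb{R}^n\times D,$$ and $\lambda:=\frac{c_2}{c_1}c_5<\frac12$.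 Then there exist $\varepsilon^\star>0$ and a class $\mathcal K$ function $\varphi$ such that for all $\varepsilon\in(0,\varepsilon^\star)$: 1. The set $(\mathcal A+\varphi(\varepsilon)\mathbb{B}^\circ)\times\mathbb{R}_{\ge0}$ is uniformly globally recurrent (UGR) for $\mathcal H_\varepsilon$. 2. If, additionally, $\frac{\partial f(x,r,\tau,\varepsilon)}{\partial r}\,w(r)=0$ for all $(x,r,\tau,\varepsilon)\in\mathbb{R}^n\times C\times\mathbb{R}_{\ge0}\times[0,\varepsilon^*]$, then the set $\mathcal A\times\mathbb{R}_{\ge0}$ is uniformly globally exponentially stable in the mean (UGES-M) for $\mathcal H_\varepsilon$.
   Context: **Notation.** $|\cdot|$ is the Euclidean norm (induced norm for matrices); $|z|_{\mathcal A}:=\inf_{y\in\mathcal A}|z-y|$. $\rho\mathbb{B}^\circ$ is the open Euclidean ball of radius $\rho$ centered at the origin (of appropriate dimension), and $\rho\mathbb{B}$ is the closed one. A function $\alpha:\mathbb{R}_{\ge0}\to\mathbb{R}_{\ge0}$ is of class $\mathcal K$ if it is continuous, strictly increasing and $\alpha(0)=0$. $(u,v)$ denotes the stacked vector. **SHDS and random solutions.** A general SHDS has the form: $\dot y=F(y)$ for $y\in\tilde C$; $y^+=G(y,v^+)$ for $y\in\tilde D$, $v\sim\mu$, with state $y\in\mathbb{R}^N$, flow set $\tilde C$, flow map $F$, jump set $\tilde D$, jump map $G$. Here $v^+$ is a placeholder for the i.i.d. sequence $\{\mathbf v_\ell\}_{\ell\ge1}$. Let $\mathcal F_\ell$ be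 the $\sigma$-field generated by $(\mathbf v_1,\dots,\mathbf v_\ell)$ ($\mathcal F_0$ trivial). Hybrid time domains (subsets of $\mathbb{R}_{\ge0}\times\mathbb{Z}_{\ge0}$) and hybrid arcs are the standard ones for hybrid dynamical systems. A *stochastic hybrid arc* is a map $\mathbf y:\omega\mapsto\mathbf y_\omega$ from $\Omega$ to hybrid arcs such that $\omega\mapsto\mathrm{graph}(\mathbf y_\omega):=\{(t,j,s):(t,j)\in\mathrm{dom}(\mathbf y_\omega),\ s=\mathbf y_\omega(t,j)\}$ is an $\mathcal F$-measurable set-valued map with closed values. (A set-valued map $M$ is $\mathcal F$-measurable if $\{\omega:M(\omega)\cap O\neq\varnothing\}\in\mathcal F$ for every open $O$.) It is *adapted* if $\omega\mapsto\mathrm{graph}(\mathbf y_\omega)\cap(\mathbb{R}_{\ge0}\times\{0,\dots,\ell\}\times\mathbb{R}^N)$ is $\mathcal F_\ell$-measurable for each $\ell\in\mathbb{Z}_{\ge0}$. A *random solution* from $y_0$ is an adapted stochastic hybrid arc such that for each $\omega\in\Omega$: 1. $\mathbf y_\omega(0,0)=y_0$; 2. if $(t_1,j),(t_2,j)\in\mathrm{dom}(\mathbf y_\omega)$ with $t_1<t_2$, then for almost all $t\in[t_1,t_2]$, $\mathbf y_\omega(t,j)\in\tilde C$ and $\dot{\mathbf y}_\omega(t,j)=F(\mathbf y_\omega(t,j))$; 3. if $(t,j),(t,j+1)\in\mathrm{dom}(\mathbf y_\omega)$, then $\mathbf y_\omega(t,j)\in\tilde D$ and $\mathbf y_\omega(t,j+1)=G(\mathbf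 y_\omega(t,j),\mathbf v_{j+1}(\omega))$. A random solution is *maximal* if its sample paths cannot be extended, i.e. there is no random solution from the same initial condition whose sample paths extend those of $\mathbf y$ for every $\omega$ and do so strictly with positive probability. **Uniform global recurrence (UGR).** For $\theta\ge0$ let $\Gamma_{<\theta}:=\{(s,t)\in\mathbb{R}^2:s+t<\theta\}$ and $\Gamma_{\le\theta}:=\{(s,t)\in\mathbb{R}^2:s+t\le\theta\}$. A set $\mathcal O\subset\mathbb{R}^N$, open relative to the union of the flow and jump sets (sets are understood intersected with that union), is UGR for an SHDS if the continuous-time dynamics (flow map restricted to the flow set) have no finite escape times, and for each $\rho>0$ and $R>0$ there exists $\theta\ge0$ such that every maximal random solution $\mathbf y$ starting in $R\mathbb{B}$ satisfies $$\mathbb P\Big(\big(\mathrm{graph}(\mathbf y_\omega)\subset\Gamma_{<\theta}\times\mathbb{R}^N\big)\ \lor\ \big(\mathrm{graph}(\mathbf y_\omega)\cap(\Gamma_{\le\theta}\times\mathcal O)\neq\varnothing\big)\Big)\ge1-\rho.$$ **UGES-M.** A closed set $\mathcal S\subset\mathbb{R}^N$ is UGES-M for an SHDS if there exist $k_1,k_2>0$ such that every random solution $\mathbf y$ starting in the union of the flow and jump sets satisfies $$\mathbb E\big[|\mathbf y_\omega(\mathbf T,\mathbf J)|_{\mathcal S}\,e^{k_2(\mathbf T+\mathbf J)}\big]\le k_1|\mathbf y_\omega(0,0)|_{\mathcal S}$$ for all hybrid stopping times $(\mathbf T,\mathbf J)$ of $\mathbf y$. A hybrid stopping time of $\mathbf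 y$ is a pair of random variables $(\mathbf T,\mathbf J):\Omega\to\mathbb{R}_{\ge0}\times\mathbb{Z}_{\ge0}$ with $(\mathbf T(\omega),\mathbf J(\omega))\in\mathrm{dom}(\mathbf y_\omega)$ and $\{\omega:\mathbf J(\omega)=j,\ \mathbf T(\omega)\in B\}\in\mathcal F_j$ for every $j\in\mathbb{Z}_{\ge0}$ and Borel $B\subset\mathbb{R}_{\ge0}$. In the theorem, $k_1,k_2$ may depend on $\varepsilon$. **Conventions.** For $\mathcal H_\varepsilon$, the flow set is $\mathbb{R}^n\times C\times\mathbb{R}_{\ge0}$ and the jump set is $\mathbb{R}^n\times D\times\mathbb{R}_{\ge0}$, with $N=n+p+1$. Smoothness of $V$ on $\mathbb{R}^n\times(C\cup D)$ is understood as smoothness on an open neighborhood of that set. *)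

(* Defs.v *)
From HB Require Import structures.
From mathcomp Require Import all_boot all_order all_algebra.
From mathcomp Require Import finmap.
From mathcomp Require Import all_classical all_reals all_analysis.

Set Implicit Arguments.
Unset Strict Implicit.
Unset Printing Implicit Defensive.
Import Order.TTheory GRing.Theory Num.Theory.
Import numFieldNormedType.Exports.
Local Open Scope classical_set_scope.
Local Open Scope ring_scope.

(* R^k is the type 'rV[R]_k of row vectors, whose
   topology is the usual one; its library norm is the sup norm, hence the
   explicit Euclidean norm below.  The stacked vector (u, v) is row_mx u v. *)

Section Euclidean.
Context {R : realType}.

Definition dotv k (u v : 'rV[R]_k) : R := \sum_i u 0 i * v 0 i.

Definition enorm k (u : 'rV[R]_k) : R := Num.sqrt (\sum_i u 0 i ^+ 2).

(* Matrices act on row vectors from the right, as Jacobians 'J do in the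
   library; transposing does not change the induced norm. *)
Definition opnorm k l (M : 'M[R]_(k, l)) : R :=
  sup [set enorm (u *m M) | u in [set u : 'rV[R]_k | enorm u <= 1]].

Definition dist k (S : set 'rV[R]_k) (z : 'rV[R]_k) : R :=
  inf [set enorm (z - y) | y in S].

Definition oball k (rho : R) : set 'rV[R]_k := [set u | enorm u < rho].

Definition cball k (rho : R) : set 'rV[R]_k := [set u | enorm u <= rho].

Definition set_sum k (S T : set 'rV[R]_k) : set 'rV[R]_k :=
  [set a + b | a in S & b in T].

(* S x T as a set of stacked vectors *)
Definition stack k l (S : set 'rV[R]_k) (T : set 'rV[R]_l) :
    set 'rV[R]_(k + l) :=
  [set z | S (lsubmx z) /\ T (rsubmx z)].

Definition nonneg1 : set 'rV[R]_1 := [set s | 0 <= s 0 0].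

Definition gradient k (V : 'rV[R]_k -> R) (z : 'rV[R]_k) : 'rV[R]_k :=
  \row_i 'D_(delta_mx 0 i) V z.

Definition mxint k l (a b : R) (M : R -> 'M[R]_(k, l)) : 'M[R]_(k, l) :=
  \matrix_(i, j) \int[lebesgue_measure]_(s in `[a, b]) (M s i j).

Definition class_K (phi : R -> R) : Prop :=
  [/\ {within [set s : R | 0 <= s], continuous phi},
      forall s t : R, 0 <= s -> s < t -> phi s < phi t
    & phi 0 = 0].

(* C^k through iterated directional derivatives; U is meant to be open. *)
Fixpoint Ck_open {V W : normedModType R} (k : nat) (U : set V) (f : V -> W)
    : Prop :=
  match k with
  | 0%N => forall x, U x -> {for x, continuous f}
  | k'.+1 => (forall x, U x -> differentiable f x) /\
             (forall v : V, Ck_open k' U (fun x => 'D_v f x))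
  end.

(* C^1 on a set S that need not be open: C^1 extendability to a
   neighbourhood.  Values of f off S are irrelevant. *)
Definition C1_on {V W : normedModType R} (S : set V) (f : V -> W) : Prop :=
  exists (U : set V) (f' : V -> W),
    [/\ open U, S `<=` U, Ck_open 1 U f' & forall x, S x -> f x = f' x].

Definition smooth_near {V W : normedModType R} (S : set V) (f : V -> W)
    : Prop :=
  exists U : set V, [/\ open U, S `<=` U & forall k, Ck_open k U f].

(* Any finite family of non-overlapping intervals can be listed from left to
   right, as [u 0, v 0], [u 1, v 1], ... *)
Definition abs_continuous k (a b : R) (y : R -> 'rV[R]_k) : Prop :=
  forall e : R, 0 < e -> exists2 d : R, 0 < d &
    forall (K : nat) (u v : nat -> R),
      (forall i, (i < K)%N -> [/\ a <= u i, u i <= v i & v i <= b]) ->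
      (forall i, (i.+1 < K)%N -> v i <= u i.+1) ->
      \sum_(i < K) (v i - u i) < d ->
      \sum_(i < K) enorm (y (v i) - y (u i)) < e.

Definition loc_abs_continuous k (I : set R) (y : R -> 'rV[R]_k) : Prop :=
  forall a b : R, a <= b -> `[a, b] `<=` I -> abs_continuous a b y.

End Euclidean.

Section HybridArcs.
Context {R : realType}.

Definition compact_hybrid_time_domain (E : set (R * nat)) : Prop :=
  exists (K : nat) (t : nat -> R),
    [/\ t 0%N = 0, forall j, (j < K)%N -> t j <= t j.+1
      & E = [set q | (q.2 < K)%N /\ t q.2 <= q.1 <= t q.2.+1]].

Definition hybrid_time_domain (E : set (R * nat)) : Prop :=
  (forall q, E q -> 0 <= q.1) /\
  (forall T J, E (T, J) ->
     compact_hybrid_time_domain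
       (E `&` [set q | 0 <= q.1 <= T /\ (q.2 <= J)%N])).

(* The values of arc_val outside arc_dom are irrelevant: arcs are compared
   through their graphs only. *)
Record hybrid_arc (N : nat) := HybridArc {
  arc_dom : set (R * nat);
  arc_val :> R -> nat -> 'rV[R]_N;
  arc_domP : hybrid_time_domain arc_dom;
  arc_lac : forall j, loc_abs_continuous [set t | arc_dom (t, j)]
                                         (fun t => arc_val t j)
}.

Definition graph N (y : hybrid_arc N) : set (R * R * 'rV[R]_N) :=
  [set q | exists j : nat,
     [/\ arc_dom y (q.1.1, j), q.1.2 = j%:R & q.2 = y q.1.1 j]].

End HybridArcs.

Notation borelType T := (g_sigma_algebraType (@open T)).

Section Randomness.
Context {R : realType} {d : measure_display} {Omega : measurableType d}.
Variable (P : probability Omega R).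

Definition borel {T : ptopologicalType} : set (set T) :=
  (@measurable _ (borelType T)).

(* The sequence is indexed from 0: v l stands for the (l+1)-st random input. *)
Definition iid m (mu : probability (borelType 'rV[R]_m) R)
    (v : nat -> Omega -> 'rV[R]_m) : Prop :=
  [/\ forall l (B : set 'rV[R]_m), borel B -> measurable (v l @^-1` B),
      forall l (B : set 'rV[R]_m), borel B -> P (v l @^-1` B) = mu B
    & forall (L : {fset nat}) (B : nat -> set 'rV[R]_m),
        (forall l, borel (B l)) ->
        P (\bigcap_(l in [set` L]) (v l @^-1` B l)) =
        (\prod_(l <- L) P (v l @^-1` B l))%E].

(* generated by the first l inputs *)
Definition filtration m (v : nat -> Omega -> 'rV[R]_m) (l : nat) :
    set (set Omega) :=
  <<s [set A | exists2 i, (i < l)%N &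
               exists2 B, borel B & A = v i @^-1` B] >>.

Definition values m (v : nat -> Omega -> 'rV[R]_m) : set 'rV[R]_m :=
  [set u | exists l w, u = v l w].

Definition set_measurable {T : topologicalType} (F : set (set Omega))
    (M : Omega -> set T) : Prop :=
  forall O : set T, open O -> F [set w | M w `&` O !=set0].

Definition stochastic_hybrid_arc N (y : Omega -> @hybrid_arc R N) : Prop :=
  (forall w, closed (graph (y w))) /\
  set_measurable measurable (fun w => graph (y w)).

Definition adapted m (v : nat -> Omega -> 'rV[R]_m) N
    (y : Omega -> @hybrid_arc R N) : Prop :=
  forall l : nat, set_measurable (filtration v l) (fun w => graph (y w) `&`
    [set q | 0 <= q.1.1 /\ exists2 j, (j <= l)%N & q.1.2 = j%:R]).

End Randomness.

Record SHDS (R : realType) (N m : nat) := MkSHDS {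
  flow_set : set 'rV[R]_N;
  flow_map : 'rV[R]_N -> 'rV[R]_N;
  jump_set : set 'rV[R]_N;
  jump_map : 'rV[R]_N -> 'rV[R]_m -> 'rV[R]_N
}.

Section Solutions.
Context {R : realType} {d : measure_display} {Omega : measurableType d}.
Variables (P : probability Omega R) (N m : nat).
Variables (v : nat -> Omega -> 'rV[R]_m) (H : SHDS R N m).

Let domH : set 'rV[R]_N := flow_set H `|` jump_set H.

Definition flows_ae (I : set R) (y : R -> 'rV[R]_N) : Prop :=
  {ae lebesgue_measure, forall t, I t ->
     flow_set H (y t) /\ is_derive t (1 : R) y (flow_map H (y t))}.

Definition random_solution (y0 : 'rV[R]_N)
    (y : Omega -> @hybrid_arc R N) : Prop :=
  [/\ stochastic_hybrid_arc y, adapted v y &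
   forall w,
   [/\ arc_dom (y w) (0, 0%N) /\ y w 0 0%N = y0,
       forall j (t1 t2 : R), arc_dom (y w) (t1, j) -> arc_dom (y w) (t2, j) ->
         t1 < t2 -> flows_ae `[t1, t2] (fun t => y w t j)
     & forall (t : R) j, arc_dom (y w) (t, j) -> arc_dom (y w) (t, j.+1) ->
         jump_set H (y w t j) /\
         y w t j.+1 = jump_map H (y w t j) (v j w)]].

Definition maximal_random_solution (y0 : 'rV[R]_N)
    (y : Omega -> @hybrid_arc R N) : Prop :=
  random_solution y0 y /\
  ~ exists y', [/\ random_solution y0 y',
                   forall w, graph (y w) `<=` graph (y' w)
                 & (0 < P [set w | graph (y w) <> graph (y' w)])%E].

Definition no_finite_escape_time : Prop :=
  ~ exists (T : R) (y : R -> 'rV[R]_N),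
      [/\ 0 < T, loc_abs_continuous `[0, T[ y, flows_ae `[0, T[ y
        & enorm (y t) @[t --> T^'-] --> +oo%R].

Definition Gamma_lt (theta : R) : set (R * R) := [set q | q.1 + q.2 < theta].

Definition Gamma_le (theta : R) : set (R * R) := [set q | q.1 + q.2 <= theta].

Definition relatively_open (X O : set 'rV[R]_N) : Prop :=
  exists2 U, open U & O `&` X = U `&` X.

Definition UGR (O : set 'rV[R]_N) : Prop :=
  [/\ relatively_open domH O, no_finite_escape_time &
   forall rho r : R, 0 < rho -> 0 < r -> exists2 theta : R, 0 <= theta &
     forall y0 y, cball r y0 -> maximal_random_solution y0 y ->
       ((1 - rho)%:E <=
        P [set w | graph (y w) `<=` Gamma_lt theta `*` setT \/
           graph (y w) `&` (Gamma_le theta `*` (O `&` domH)) !=set0])%E].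

Definition hybrid_stopping_time (y : Omega -> @hybrid_arc R N) (T : Omega -> R) (J : Omega -> nat) : Prop :=
  [/\ measurable_fun setT T, measurable_fun setT J,
      forall w, arc_dom (y w) (T w, J w)
    & forall (j : nat) (B : set R), measurable B -> B `<=` [set t | 0 <= t] ->
        filtration v j [set w | J w = j /\ B (T w)]].

Definition UGES_M (S : set 'rV[R]_N) : Prop :=
  closed S /\
  exists k1 k2 : R, [/\ 0 < k1, 0 < k2 &
    forall y0 y, domH y0 -> random_solution y0 y ->
    forall (T : Omega -> R) (J : Omega -> nat), hybrid_stopping_time y T J ->
      ('E_P[fun w => (dist S (y w (T w) (J w)) *
                      expR (k2 * (T w + (J w)%:R)))%R]
        <= (k1 * dist S y0)%:E)%E].

End Solutions.

Section System.
Context {R : realType} {n p m : nat}.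
Variables (C D : set 'rV[R]_p).
Variables (f : 'rV[R]_n -> 'rV[R]_p -> R -> R -> 'rV[R]_n).
Variables (w : 'rV[R]_p -> 'rV[R]_p).
Variables (g : 'rV[R]_n -> 'rV[R]_p -> 'rV[R]_m -> 'rV[R]_n).
Variables (h : 'rV[R]_p -> 'rV[R]_m -> 'rV[R]_p).
Variable Vals : set 'rV[R]_m. (* the set of values taken by the inputs *)

Let xpart (y : 'rV[R]_(n + p + 1)) : 'rV[R]_n := lsubmx (lsubmx y).
Let rpart (y : 'rV[R]_(n + p + 1)) : 'rV[R]_p := rsubmx (lsubmx y).
Let taupart (y : 'rV[R]_(n + p + 1)) : R := rsubmx y 0 0.

Definition two_time_scale_SHDS (eps : R) : SHDS R (n + p + 1) m := {|
  flow_set := stack (stack setT C) nonneg1;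
  flow_map := fun y =>
    row_mx (row_mx (f (xpart y) (rpart y) (taupart y) eps) (w (rpart y)))
           (const_mx eps^-1);
  jump_set := stack (stack setT D) nonneg1;
  jump_map := fun y v =>
    row_mx (row_mx (g (xpart y) (rpart y) v) (h (rpart y) v))
           (const_mx (taupart y))
|}.

Definition regularity (eps_s : R) : Prop :=
  [/\ C1_on [set q : 'rV[R]_n * 'rV[R]_p * R * R | 0 <= q.1.2 /\ 0 <= q.2]
            (fun q => f q.1.1.1 q.1.1.2 q.1.2 q.2),
      [/\ continuous w,
          continuous (fun q : 'rV[R]_n * 'rV[R]_p * 'rV[R]_m =>
                        g q.1.1 q.1.2 q.2)
        & continuous (fun q : 'rV[R]_p * 'rV[R]_m => h q.1 q.2)]
    & compact C /\ compact D] /\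
  [/\
      forall r (tau eps : R), (C `|` D) r -> 0 <= tau -> 0 <= eps < eps_s ->
        f 0 r tau eps = 0,
      forall r v, (C `|` D) r -> Vals v -> g 0 r v = 0
    & exists2 Lx : R, 0 <= Lx & forall r x1 x2 (tau eps : R),
        (C `|` D) r -> 0 <= tau -> 0 <= eps < eps_s ->
        enorm (f x1 r tau eps - f x2 r tau eps) <= Lx * enorm (x1 - x2)] /\
  [/\ exists2 Le : R, 0 <= Le & forall r x (tau eps1 eps2 : R),
        (C `|` D) r -> 0 <= tau -> 0 < eps1 < eps_s -> 0 < eps2 < eps_s ->
        enorm (f x r tau eps1 - f x r tau eps2)
          <= Le * enorm x * `|eps1 - eps2|,
      exists2 Lg : R, 0 < Lg & forall r x1 x2 v, (C `|` D) r -> Vals v ->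
        enorm (g x1 r v - g x2 r v) <= Lg * enorm (x1 - x2),
      forall x r v, D r -> Vals v ->
        stack setT (C `|` D) (row_mx (g x r v) (h r v))
    & exists2 Hb : R, 0 < Hb & forall r v, D r -> Vals v ->
        enorm (h r v) <= Hb].

Variable fave : 'rV[R]_n -> 'rV[R]_p -> 'rV[R]_n.

Definition deviation (z : 'rV[R]_(n + p)) (s : R) : 'rV[R]_n :=
  f (lsubmx z) (rsubmx z) s 0 - fave (lsubmx z) (rsubmx z).

Definition averaging : Prop :=
  [/\ Ck_open 1 setT (fun q : 'rV[R]_n * 'rV[R]_p => fave q.1 q.2),
      exists gamma : R -> R,
      [/\ {within [set s : R | 0 <= s], continuous gamma},
          forall s : R, 0 <= s -> 0 <= gamma s,
          exists M : R, forall s : R, 0 <= s -> gamma s <= M,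
          forall s t : R, 0 <= s -> s <= t -> gamma t <= gamma s
        & gamma s @[s --> +oo%R] --> (0 : R)] /\
        forall x r (tau T : R), (C `|` D) r -> 0 <= tau -> 0 < T ->
          enorm (T^-1 *: mxint tau (tau + T) (deviation (row_mx x r)))
            <= gamma T * enorm x /\
          opnorm (T^-1 *: mxint tau (tau + T)
                    (fun s => 'J (fun z => deviation z s) (row_mx x r)))
            <= gamma T
    & exists2 Lave : R, 0 <= Lave & forall x1 x2 r, (C `|` D) r ->
        enorm (fave x1 r - fave x2 r) <= Lave * enorm (x1 - x2)].

Definition attractor : set 'rV[R]_(n + p) := stack [set 0] (C `|` D).

Definition Fave (z : 'rV[R]_(n + p)) : 'rV[R]_(n + p) :=
  row_mx (fave (lsubmx z) (rsubmx z)) (w (rsubmx z)).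

Definition Gave (z : 'rV[R]_(n + p)) (v : 'rV[R]_m) : 'rV[R]_(n + p) :=
  row_mx (g (lsubmx z) (rsubmx z) v) (h (rsubmx z) v).

(* V is a total function here, but only its values near R^n x (C u D) matter:
   Gave z v lies in that set for mu-almost every v. *)
Definition lyapunov (mu : probability (borelType 'rV[R]_m) R) : Prop :=
  exists (V : 'rV[R]_(n + p) -> R) (c1 c2 c3 c4 c5 : R),
  [/\ smooth_near (stack setT (C `|` D)) V,
      [/\ 0 < c1, 0 < c2, 0 < c3, 0 < c4 & 0 < c5],
      forall z, stack setT (C `|` D) z ->
        [/\ 0 <= V z, c1 * dist attractor z ^+ 2 <= V z,
            V z <= c2 * dist attractor z ^+ 2
          & enorm (gradient V z) <= c3 * dist attractor z],
      forall z, stack setT C z -> dotv (gradient V z) (Fave z) <= - c4 * V z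
    & (forall z, stack setT D z ->
        (\int[mu]_v (V (Gave z v))%:E <= (c5 * V z)%:E)%E) /\
      c2 / c1 * c5 < 2^-1].

Definition frozen_r_flow (eps_s : R) : Prop :=
  forall x r (tau eps : R), C r -> 0 <= tau -> 0 <= eps <= eps_s ->
    w r *m 'J (fun r' => f x r' tau eps) r = 0.

End System.

(* Main.v *)
(** Averaging.  Let d be the deviation f - fave at eps = 0 and fix a window length L for
    which gamma L is small.  Put xh = x + eps * int_0^L (1 - q / L) d(x, r, tau + q) dq.
    Since tau' = 1 / eps, an integration by parts in q gives
      xh' = fave(xh, r) + (small) |x| + O(eps) |w(r)|.
    The last term comes from the r-derivative of d along w: it vanishes if that derivative
    does, and it is absorbed as long as |x| >= phi(eps) = K1 eps.  So V decays along (xh, r),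
    and along (x, r) up to the factor 121/100 that comparing x and xh costs.  An absolutely
    continuous solution of the flow is C^1, because the right-hand side is continuous.

    Jumps.  As |g|^2 is at most V/c1 after the jump, E|g| <= sqrt(c5 V / c1).  Together with
    the preceding flow, a jump contracts E|x| by a factor below 121/100 sqrt(lambda) < 1.

    Random solutions.  Weight the norm after each jump by expR (k (t + j)), and by an extra
    constant M until the arc branches (one jump of an arc may anticipate its input, and is
    estimated by the Lipschitz constant of g).  The expectations of these weighted norms
    decrease geometrically, so their sum B is integrable, with integral at most a constant
    times |x(0,0)|; and |x(t,j)| expR (k (t + j)) <= B for all (t,j) simultaneously.  Mean
    stability follows at every random time, and recurrence by Markov's inequality. *)

Require Import Defs.
From HB Require Import structures.
From mathcomp Require Import all_boot all_order all_algebra.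
From mathcomp Require Import finmap.
From mathcomp Require Import all_classical all_reals all_analysis.
From mathcomp Require Import measurable_realfun.
From mathcomp Require Import ring lra.

Set Implicit Arguments.
Unset Strict Implicit.
Unset Printing Implicit Defensive.
Import Order.TTheory GRing.Theory Num.Theory.
Import numFieldNormedType.Exports.
Local Open Scope classical_set_scope.
Local Open Scope ring_scope.

(** Adaptedness ties slice [j] of an arc to the first [j] inputs, but whether the arc jumps out of
    that slice may still depend on the input that drives the jump, so an actual jump is not an event
    of the past. [Q j.+1] therefore takes the jump out of the last point of slice [j] whenever that
    point lies in the jump set, whether or not the path takes it: this condition is decided by the
    past, independence applies, and every real jump from there is dominated. Only a jump taken
    before its slice ends escapes this device; the weight [M] is there for it.

    A target set and a horizon [th], possibly [+oo], are parameters of a single majorant: recurrence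
    uses a tube and a finite horizon, mean stability the empty set and [+oo].

    The bound 1/2 on lambda leaves room for fixed numbers. The flow costs 121/100 on [V], hence
    11/10 on its root; [expR k] costs another 11/10; and 11/10 * 11/10 * 71/100 < 86/100, where
    71/100 exceeds the root of 1/2. The gap to 1 absorbs [delta] = 7/100 and leaves the ratio [rho]
    = 93/100. *)

Section EuclideanFacts.
Context {R : realType}.

Lemma dotvC k (u v : 'rV[R]_k) : dotv u v = dotv v u.
Proof. by apply: eq_bigr => i _; rewrite mulrC. Qed.

Lemma dotvDl k (u u' v : 'rV[R]_k) : dotv (u + u') v = dotv u v + dotv u' v.
Proof. by rewrite /dotv -big_split; apply: eq_bigr => i _; rewrite mxE mulrDl. Qed.

Lemma dotvDr k (u v v' : 'rV[R]_k) : dotv u (v + v') = dotv u v + dotv u v'.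
Proof. by rewrite dotvC dotvDl !(dotvC u). Qed.

Lemma dotvZl k (a : R) (u v : 'rV[R]_k) : dotv (a *: u) v = a * dotv u v.
Proof. by rewrite /dotv mulr_sumr; apply: eq_bigr => i _; rewrite mxE mulrA. Qed.

Lemma dotvZr k (a : R) (u v : 'rV[R]_k) : dotv u (a *: v) = a * dotv u v.
Proof. by rewrite dotvC dotvZl dotvC. Qed.

Lemma dotv0r k (u : 'rV[R]_k) : dotv u 0 = 0.
Proof. by rewrite /dotv big1 // => i _; rewrite mxE mulr0. Qed.

Lemma dotv_ge0 k (u : 'rV[R]_k) : 0 <= dotv u u.
Proof. by apply: sumr_ge0 => i _; rewrite -expr2 sqr_ge0. Qed.

Lemma sqr_enorm k (u : 'rV[R]_k) : enorm u ^+ 2 = dotv u u.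
Proof.
rewrite /enorm sqr_sqrtr; last by apply: sumr_ge0 => i _; exact: sqr_ge0.
by apply: eq_bigr => i _; rewrite expr2.
Qed.

Lemma enorm_ge0 k (u : 'rV[R]_k) : 0 <= enorm u.
Proof. exact: sqrtr_ge0. Qed.

Lemma enormZ k (a : R) (u : 'rV[R]_k) : enorm (a *: u) = `|a| * enorm u.
Proof.
apply/eqP; rewrite -(eqrXn2 (ltn0Sn 1)) ?mulr_ge0 ?enorm_ge0 //.
by rewrite exprMn !sqr_enorm dotvZl dotvZr mulrA real_normK ?num_real ?expr2.
Qed.

Lemma enorm0 k : enorm (0 : 'rV[R]_k) = 0.
Proof. by rewrite -(scale0r (0 : 'rV[R]_k)) enormZ normr0 mul0r. Qed.

Lemma enormN k (u : 'rV[R]_k) : enorm (- u) = enorm u.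
Proof. by rewrite -scaleN1r enormZ normrN1 mul1r. Qed.

Lemma enormB k (u v : 'rV[R]_k) : enorm (u - v) = enorm (v - u).
Proof. by rewrite -enormN opprB. Qed.

Lemma enorm_eq0 k (u : 'rV[R]_k) : enorm u = 0 -> u = 0.
Proof.
move=> u0; apply/rowP => i; rewrite mxE; apply/eqP.
have : dotv u u == 0 by rewrite -sqr_enorm u0 expr0n.
rewrite psumr_eq0; last by move=> j _; rewrite -expr2 sqr_ge0.
by move=> /allP/(_ i); rewrite mem_index_enum -expr2 sqrf_eq0; exact.
Qed.

(** Cauchy-Schwarz, by expanding the nonnegative square of [enorm u *: v - enorm v *: u] and
    dividing by the product of the norms; hence the separate cases of a zero norm. *)
Lemma dotv_le k (u v : 'rV[R]_k) : dotv u v <= enorm u * enorm v.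
Proof.
have [u0|u0] := eqVneq (enorm u) 0.
  by rewrite u0 mul0r (enorm_eq0 u0) dotvC dotv0r.
have := dotv_ge0 (enorm u *: v - enorm v *: u).
rewrite -scaleNr !dotvDl !dotvDr !dotvZl !dotvZr -!sqr_enorm (dotvC v u).
have up : 0 < enorm u by rewrite lt0r u0 enorm_ge0.
have [v0|v0] := eqVneq (enorm v) 0.
  by rewrite v0 mulr0 (enorm_eq0 v0) dotv0r.
have vp : 0 < enorm v by rewrite lt0r v0 enorm_ge0.
move=> h; rewrite -subr_ge0 -(pmulr_rge0 _ (mulr_gt0 up vp)).
by rewrite -(pmulr_rge0 _ (ltr0n R 2)); apply: le_trans h _; lra.
Qed.

Lemma normr_dotv_le k (u v : 'rV[R]_k) : `|dotv u v| <= enorm u * enorm v.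
Proof.
rewrite ler_norml dotv_le andbT lerNl -mulN1r -dotvZl.
by rewrite (le_trans (dotv_le _ _)) // enormZ normrN1 mul1r.
Qed.

Lemma enormD k (u v : 'rV[R]_k) : enorm (u + v) <= enorm u + enorm v.
Proof.
rewrite -(@ler_pXn2r _ 2%N) ?nnegrE ?addr_ge0 ?enorm_ge0 //.
rewrite sqr_enorm dotvDl !dotvDr -!sqr_enorm (dotvC v).
by have := dotv_le u v; lra.
Qed.

Lemma enorm_triB k (u v : 'rV[R]_k) : enorm u <= enorm v + enorm (u - v).
Proof. by rewrite -{1}(subrK v u) addrC enormD. Qed.

Lemma normr_coord_le k (u : 'rV[R]_k) i : `|u 0 i| <= enorm u.
Proof.
rewrite -(@ler_pXn2r _ 2%N) ?nnegrE ?enorm_ge0 // real_normK ?num_real //.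
rewrite sqr_enorm /dotv (bigD1 i) //= -expr2 lerDl.
by apply: sumr_ge0 => j _; rewrite -expr2 sqr_ge0.
Qed.

Lemma enorm_coord_le k (u : 'rV[R]_k) (B : R) :
  (forall i, `|u 0 i| <= B) -> enorm u <= k%:R * B.
Proof.
case: k u => [u _|k u uB].
  by rewrite (_ : u = 0) ?enorm0 ?mul0r //; apply/rowP => -[].
have B0 : 0 <= B := le_trans (normr_ge0 _) (uB 0).
rewrite -(@ler_pXn2r _ 2%N) ?nnegrE ?mulr_ge0 ?enorm_ge0 //.
rewrite sqr_enorm /dotv (@le_trans _ _ (\sum_(i < k.+1) B ^+ 2)) //.
  apply: ler_sum => i _; rewrite -expr2 -(real_normK (num_real _)).
  by rewrite lerXn2r ?nnegrE.
rewrite sumr_const card_ord exprMn -[leLHS]mulr_natl ler_wpM2r ?sqr_ge0 //.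
by rewrite -natrX ler_nat expnS leq_pmulr // expn_gt0.
Qed.

Lemma norm_le_enorm k (u : 'rV[R]_k) : `|u| <= enorm u.
Proof.
rewrite [leLHS]/Num.norm /= mx_normrE; apply/bigmax_leP; split; first exact: enorm_ge0.
by move=> [i j] _ /=; rewrite ord1; exact: normr_coord_le.
Qed.

Lemma coord_le_norm k l (M : 'M[R]_(k, l)) i j : `|M i j| <= `|M|.
Proof.
rewrite [leRHS]/Num.norm /= mx_normrE.
by apply: (le_bigmax _ (fun ij : 'I_k * 'I_l => `|M ij.1 ij.2|) (i, j)).
Qed.

Lemma enorm_le_norm k (u : 'rV[R]_k) : enorm u <= k%:R * `|u|.
Proof. by apply: enorm_coord_le => i; exact: coord_le_norm. Qed.

Lemma continuous_enorm k : continuous (@enorm R k).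
Proof.
move=> u; apply/(@cvgrPdist_le R R _ (nbhs u)) => e e0 /=.
near=> t.
have : `|enorm u - enorm t| <= enorm (u - t).
  rewrite ler_norml; apply/andP; split.
    by have := enorm_triB t u; rewrite enormB; lra.
  by have := enorm_triB u t; lra.
move=> /le_trans; apply; apply: (le_trans (enorm_le_norm _)).
rewrite (@le_trans _ _ (k.+1%:R * `|u - t|)) // ?ler_wpM2r ?ler_nat //.
rewrite mulrC -ler_pdivlMr ?ltr0n //.
near: t; have ek : 0 < e / k.+1%:R by rewrite divr_gt0 ?ltr0n.
by apply: filterS (nbhsx_ballx u _ ek) => t; rewrite -ball_normE /= => /ltW.
Unshelve. all: by end_near. Qed.

Lemma dotv_row_mx k l (a c : 'rV[R]_k) (b d : 'rV[R]_l) :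
  dotv (row_mx a b) (row_mx c d) = dotv a c + dotv b d.
Proof.
rewrite /dotv big_split_ord /=; congr (_ + _); apply: eq_bigr => i _.
  by rewrite !row_mxEl.
by rewrite !row_mxEr.
Qed.

Lemma sqr_enorm_row_mx k l (a : 'rV[R]_k) (b : 'rV[R]_l) :
  enorm (row_mx a b) ^+ 2 = enorm a ^+ 2 + enorm b ^+ 2.
Proof. by rewrite !sqr_enorm dotv_row_mx. Qed.

Lemma enorm_row_mxl k l (a : 'rV[R]_k) (b : 'rV[R]_l) :
  enorm a <= enorm (row_mx a b).
Proof.
rewrite -(@ler_pXn2r _ 2%N) ?nnegrE ?enorm_ge0 // sqr_enorm_row_mx lerDl.
exact: sqr_ge0.
Qed.

Lemma enorm_row_mx_le k l (a : 'rV[R]_k) (b : 'rV[R]_l) :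
  enorm (row_mx a b) <= enorm a + enorm b.
Proof.
rewrite -(@ler_pXn2r _ 2%N) ?nnegrE ?addr_ge0 ?enorm_ge0 // sqr_enorm_row_mx.
have := mulr_ge0 (enorm_ge0 a) (enorm_ge0 b); lra.
Qed.

Lemma enorm_row_mx0 k l (a : 'rV[R]_k) : enorm (row_mx a (0 : 'rV[R]_l)) = enorm a.
Proof.
apply/eqP; rewrite -(eqrXn2 (ltn0Sn 1)) ?enorm_ge0 //.
by rewrite sqr_enorm_row_mx enorm0 expr0n addr0.
Qed.

Lemma enorm_mulmx_le k l (u : 'rV[R]_k) (M : 'M[R]_(k, l)) (B : R) :
  (forall i j, `|M i j| <= B) -> enorm (u *m M) <= l%:R * (k%:R * B) * enorm u.
Proof.
move=> MB; rewrite -mulrA; apply: enorm_coord_le => j; rewrite mxE.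
apply: le_trans (ler_norm_sum _ _ _) _.
apply: (@le_trans _ _ (\sum_(i < k) B * enorm u)).
  by apply: ler_sum => i _; rewrite normrM mulrC ler_pM // normr_coord_le.
by rewrite sumr_const card_ord -[leLHS]mulr_natl mulrA.
Qed.

Lemma enorm_delta k (i : 'I_k) : enorm (delta_mx 0 i : 'rV[R]_k) = 1.
Proof.
apply/eqP; rewrite -(eqrXn2 (ltn0Sn 1)) ?enorm_ge0 // sqr_enorm expr1n.
rewrite /dotv (bigD1 i) //= !mxE !eqxx /= mulr1 big1 ?addr0 // => j ji.
by rewrite !mxE (negbTE ji) /= mulr0.
Qed.

Lemma coord_le_opnorm k l (M : 'M[R]_(k, l)) i j : `|M i j| <= opnorm M.
Proof.
apply: (@le_trans _ _ (enorm (delta_mx 0 i *m M))).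
  by rewrite -rowE (le_trans _ (normr_coord_le _ j)) // mxE.
(* The supremum dominates its members only if the set is bounded; the bound comes from the largest
   entry of [M]. *)
apply: ub_le_sup; last by exists (delta_mx 0 i) => //=; rewrite enorm_delta.
exists (l%:R * (k%:R * `|M|)) => _ [u /= u1 <-].
apply: le_trans (enorm_mulmx_le _ (fun i j => coord_le_norm M i j)) _.
by rewrite ler_piMr // !mulr_ge0.
Qed.

(** The infimum is attained at [row_mx 0 r], since the second component can be matched exactly. *)
Lemma dist_row_mx0 n p (K : set 'rV[R]_p) (x : 'rV[R]_n) (r : 'rV[R]_p) :
  K r -> dist (stack [set 0] K) (row_mx x r) = enorm x.
Proof.
move=> Kr; apply/eqP; rewrite eq_le; apply/andP; split.
  apply: ge_inf; first by exists 0 => _ [y _ <-]; exact: enorm_ge0.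
  exists (row_mx 0 r); first by rewrite /stack /= row_mxKl row_mxKr.
  by rewrite opp_row_mx add_row_mx subr0 subrr enorm_row_mx0.
apply: lb_le_inf.
  exists (enorm (row_mx x r - row_mx 0 r)); exists (row_mx 0 r) => //.
  by rewrite /stack /= row_mxKl row_mxKr.
move=> _ [y [/= y0 _] <-].
rewrite -(hsubmxK y) y0 opp_row_mx add_row_mx subr0.
exact: enorm_row_mxl.
Qed.

Lemma dist_stack_nonneg k (S : set 'rV[R]_k) (z : 'rV[R]_k) (s : 'rV[R]_1) :
  nonneg1 s -> dist (stack S nonneg1) (row_mx z s) = dist S z.
Proof.
move=> s0; have [[z0 Sz0]|] := pselect (S !=set0); last first.
  move=> /set0P/negP/negPn/eqP ->.
  by rewrite /dist (_ : stack _ _ = set0) ?image_set0 // -subset0 => ? [].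
apply/eqP; rewrite eq_le; apply/andP; split.
  apply: lb_le_inf; first by exists (enorm (z - z0)), z0.
  move=> _ [y Sy <-]; apply: ge_inf.
    by exists 0 => _ [? _ <-]; exact: enorm_ge0.
  exists (row_mx y s); first by rewrite /stack /= row_mxKl row_mxKr.
  by rewrite opp_row_mx add_row_mx subrr enorm_row_mx0.
apply: lb_le_inf.
  exists (enorm (row_mx z s - row_mx z0 s)), (row_mx z0 s) => //.
  by rewrite /stack /= row_mxKl row_mxKr.
move=> _ [y [/= Sy _] <-].
apply: (@le_trans _ _ (enorm (z - lsubmx y))).
  apply: ge_inf; first by exists 0 => _ [? _ <-]; exact: enorm_ge0.
  by exists (lsubmx y).
by rewrite -{2}(hsubmxK y) opp_row_mx add_row_mx enorm_row_mxl.
Qed.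

End EuclideanFacts.

(** * Absolutely continuous paths and the regularity of solutions of differential equations *)

Section AbsoluteContinuity.
Context {R : realType}.
Notation mu := lebesgue_measure.

Lemma is_derive_local k (z : R -> 'rV[R]_k) (s e : R) : 0 < e ->
  is_derive s (1 : R) z 0 ->
  exists2 d, 0 < d & forall t, `|t - s| < d -> enorm (z t - z s) <= e * `|t - s|.
Proof.
move=> e0 [zs z's].
(* The factor pays for passing from the sup norm to the Euclidean norm; [k.+1] instead of [k] covers
   dimension 0. *)
have ek : 0 < e / k.+1%:R by rewrite divr_gt0 ?ltr0n.
have : h^-1 *: (z (h *: 1 + s) - z s) @[h --> 0^'] --> (0 : 'rV[R]_k).
  by rewrite -z's; exact: zs.
move=> /cvgrPdist_le /(_ _ ek) [d /= d0 dz]; exists d => // t ts.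
have [->|nts] := eqVneq t s; first by rewrite !subrr enorm0 normr0 mulr0.
have := dz (t - s); rewrite /ball_ /= sub0r normrN subr_eq0 => /(_ ts nts).
rewrite sub0r normrN normrZ [(t - s) *: _]mulr1 subrK normfV.
rewrite mulrC ler_pdivrMr ?normr_gt0 ?subr_eq0 // => zts.
apply: (le_trans (enorm_le_norm _)).
rewrite (@le_trans _ _ (k.+1%:R * `|z t - z s|)) // ?ler_wpM2r ?ler_nat //.
by rewrite -ler_pdivlMl ?ltr0n // mulrA [_ * e]mulrC.
Qed.

(* The bad steps of the partition lie in the open set U and their total length is
   at most its measure; the other steps contribute at most e times their length. *)
Definition step_chain k (z : R -> 'rV[R]_k) (a e : R) (U : set R) (t : R) :=
  exists (K : nat) (u v : nat -> R),
  [/\ forall i, (i < K)%N -> [/\ a <= u i, u i <= v i & v i <= t],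
      forall i, (i.+1 < K)%N -> v i <= u i.+1,
      ((\sum_(i < K) (v i - u i))%:E <= mu (U `&` `[a, t]))%E
    & enorm (z t - z a) <= e * (t - a) + \sum_(i < K) enorm (z (v i) - z (u i))].

Lemma step_chain_good k (z : R -> 'rV[R]_k) (a e : R) (U : set R) (t t' : R) : t <= t' -> open U ->
  enorm (z t' - z t) <= e * (t' - t) -> step_chain z a e U t -> step_chain z a e U t'.
Proof.
move=> tt' oU ztt' [K [u [v [uv vu sl zt]]]]; exists K, u, v; split => //.
- by move=> i /uv[? ? ?]; split => //; exact: le_trans tt'.
- apply: (le_trans sl); apply: le_measure; rewrite ?inE.
  + by apply: measurableI; [exact: measurable_realfun.open_measurable|].
  + by apply: measurableI; [exact: measurable_realfun.open_measurable|].
  + by apply: setIS => x /=; rewrite !in_itv /= => /andP[-> /le_trans]; exact.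
- rewrite (_ : z t' - z a = (z t' - z t) + (z t - z a)); last by rewrite addrA subrK.
  apply: (le_trans (enormD _ _)); apply: (le_trans (lerD ztt' zt)); lra.
Qed.

Lemma step_chain_bad k (z : R -> 'rV[R]_k) (a e : R) (U : set R) (t t' : R) :
  0 <= e -> a <= t -> t <= t' -> open U ->
  `[t, t'] `<=` U -> step_chain z a e U t -> step_chain z a e U t'.
Proof.
move=> e0 at_ tt' oU ttU [K [u [v [uv vu sl zt]]]].
pose u' i := if (i < K)%N then u i else t.
pose v' i := if (i < K)%N then v i else t'.
have sumE (F : R -> R -> R) :
    \sum_(i < K.+1) F (u' i) (v' i) = \sum_(i < K) F (u i) (v i) + F t t'.
  rewrite big_ord_recr /= /u' /v' ltnn; congr (_ + _).
  by apply: eq_bigr => i _; rewrite ltn_ord.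
exists K.+1, u', v'; split.
- move=> i; rewrite ltnS /u' /v' leq_eqVlt => /predU1P[->|iK].
    by rewrite ltnn; split => //.
  by rewrite iK; have [? ? ?] := uv i iK; split => //; exact: le_trans tt'.
- move=> i; rewrite ltnS leq_eqVlt /u' /v' => /predU1P[iK|iK].
    by rewrite -iK ltnn ltnS leqnn; have [|] := uv i; rewrite -?iK.
  by rewrite iK (ltnW iK); exact: vu.
- rewrite (sumE (fun x y => y - x)) EFinD.
  (* The new step is counted through the half-open interval, which is disjoint from [[a, t]], so
     that the measures add up. *)
  apply: (@le_trans _ _ (mu (U `&` `[a, t]) + mu `]t, t'])%E).
    apply: leeD => //; rewrite lebesgue_measure_itv /= lte_fin.
    by case: ltP => h; rewrite -?EFinB lee_fin // subr_le0.
  rewrite -measureU //.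
  + apply: le_measure; rewrite ?inE.
    * apply: measurableU => //.
      by apply: measurableI; [exact: measurable_realfun.open_measurable|].
    * by apply: measurableI; [exact: measurable_realfun.open_measurable|].
    * move=> x [[Ux /=]|/=]; rewrite !in_itv /= => /andP[ax xt].
        by split=> //; rewrite ax (le_trans xt).
      split; first by apply: ttU; rewrite /= in_itv /= (ltW ax).
      by rewrite xt andbT (le_trans at_) // ltW.
  + by apply: measurableI; [exact: measurable_realfun.open_measurable|].
  + rewrite -subset0 => x [[_ /=]]; rewrite !in_itv /= => /andP[_ xt] /andP[].
    by rewrite ltNge xt.
- rewrite (sumE (fun x y => enorm (z y - z x))).
  rewrite (_ : z t' - z a = (z t' - z t) + (z t - z a)); last by rewrite addrA subrK.
  apply: (le_trans (enormD _ _)); rewrite [leRHS]addrA [leRHS]addrC lerD2l.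
  by apply: (le_trans zt); rewrite lerD2r ler_wpM2l // lerB.
Qed.

(** Continuous induction. Around each point [s] a chain can be carried from a little before [s] to a
    little after it; applied at the supremum of the times reached, this shows that the supremum is
    [b] and is reached. *)
Lemma step_chain_end k (z : R -> 'rV[R]_k) (a b e : R) (U : set R) : a <= b -> 0 < e -> open U ->
  (forall t, a <= t <= b -> U t \/ is_derive t (1 : R) z 0) -> step_chain z a e U b.
Proof.
move=> ab e0 oU Uz.
have loc s : a <= s <= b -> exists2 d, 0 < d & forall t0 t1, a <= t0 ->
    s - d < t0 -> t0 <= s -> s <= t1 -> t1 < s + d -> step_chain z a e U t0 -> step_chain z a e U t1.
  move=> sab; have [Us|zs] := Uz _ sab.
    have /nbhs_ballP[d /= d0 dU] : nbhs s U by exact: open_nbhs_nbhs.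
    exists d => // t0 t1 at0 dt0 t0s st1 t1d; apply: step_chain_bad => //.
    - exact: ltW.
    - exact: le_trans st1.
    - move=> x /=; rewrite in_itv /= => /andP[t0x xt1]; apply: dU.
      rewrite -ball_normE /= ltr_norml; apply/andP; split; lra.
  have [d d0 dz] := is_derive_local e0 zs.
  exists d => // t0 t1 at0 dt0 t0s st1 t1d St0.
  (* The derivative bound is centred at [s], so the step from [t0] to [t1] is cut there. *)
  apply: (@step_chain_good _ _ _ _ _ s) => //; last apply: (@step_chain_good _ _ _ _ _ t0) => //.
    have := dz t1; rewrite ger0_norm ?subr_ge0 //; apply; lra.
  have := dz t0; rewrite enormB distrC ger0_norm ?subr_ge0 //; apply; lra.
pose S := [set t | a <= t <= b /\ step_chain z a e U t].
have Sa : S a.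
  split; first by rewrite lexx.
  exists 0%N, (fun=> 0), (fun=> 0); split => //; rewrite !big_ord0 ?measure_ge0 //.
  by rewrite !subrr enorm0 mulr0 addr0.
have supS : has_sup S by split; [exists a|exists b => t [/andP[]]].
have sab : a <= sup S <= b.
  apply/andP; split; first by apply: ub_le_sup => //; exact: supS.2.
  by apply: ge_sup; [exists a|move=> t [/andP[]]].
have [d d0 dS] := loc _ sab.
have [t0 [/andP[at0 t0b] St0] dt0] := sup_adherent d0 supS.
have t0s : t0 <= sup S by apply: ub_le_sup; [exact: supS.2|split=> //; apply/andP].
have St1 := dS t0 _ at0 dt0 t0s _ _ St0.
have [sb|sb] := leP b (sup S).
  by have <- : sup S = b; [apply/le_anti; rewrite sb; case/andP: sab => _ ->|apply: St1 => //; lra].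
pose t1 := Num.min b (sup S + d / 2).
have st1 : sup S < t1 by rewrite lt_min sb /= ltrDl divr_gt0.
have : S t1.
  split; last by apply: St1; [exact: ltW|rewrite /t1 gt_min; apply/orP; right; lra].
  rewrite /t1 ge_min lexx /= andbT le_min ab /=; lra.
by move=> /(ub_le_sup supS.2); rewrite leNgt st1.
Qed.

(** The exceptional null set is covered by an open [U] of measure below the [d] that absolute
    continuity gives for [e / 2]. In a chain from [a] to [b] the steps inside [U] then contribute
    less than [e / 2], and the others at most a small slope times their length. *)
Lemma ac_derive0_cst k (z : R -> 'rV[R]_k) (a b : R) : a <= b -> abs_continuous a b z ->
  {ae mu, forall t, `[a, b]%classic t -> is_derive t (1 : R) z 0} -> z b = z a.
Proof.
move=> ab acz [N [mN N0 Nz]].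
apply/eqP; rewrite -subr_eq0; apply/eqP; apply: enorm_eq0; apply/eqP.
rewrite eq_le enorm_ge0 andbT; apply/ler_addgt0Pr => e e0; rewrite add0r.
have e20 : 0 < e / 2 by rewrite divr_gt0.
have [d d0 dz] := acz _ e20.
have [|U [oU NU]] := lebesgue_regularity_outer mN _ d0; first by rewrite [ltLHS]N0.
have mU : measurable U by exact: measurable_realfun.open_measurable.
move=> UN; have muU : (mu U < d%:E)%E.
  apply: le_lt_trans (UN); rewrite -[leRHS]add0e -N0 -measureU //.
  - apply: le_measure; rewrite ?inE //.
    + by apply: measurableU => //; exact: measurableD.
    + by move=> x Ux; have [Nx|Nx] := pselect (N x); [left|right].
  - exact: measurableD.
  - by rewrite -subset0 => x [Nx []].
(* The slope is chosen so that it yields at most [e / 2] over the whole interval; the summand 1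
   covers the case [a = b]. *)
have [||t tab|K [u [v [uv vu sl zba]]]] := @step_chain_end _ z a b (e / 2 / (b - a + 1)) U ab.
- by rewrite divr_gt0 //; lra.
- exact: oU.
- have [zt|zt] := pselect (is_derive t (1 : R) z 0); first by right.
  left; apply: NU; apply: Nz => /= h; apply: zt; apply: h.
  by rewrite in_itv.
have dK : \sum_(i < K) (v i - u i) < d.
  rewrite -lte_fin; apply: (le_lt_trans sl); apply: le_lt_trans muU.
  by apply: le_measure; rewrite ?inE //; exact: measurableI.
apply: (le_trans zba); rewrite [leRHS](splitr e) lerD //; last first.
  by rewrite ltW //; exact: dz.
rewrite mulrAC ler_pdivrMr; last lra.
by rewrite ler_wpM2l ?ltW //; lra.
Qed.

Lemma abs_continuous_within k (y : R -> 'rV[R]_k) (a b : R) :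
  abs_continuous a b y -> {within `[a, b], continuous y}.
Proof.
move=> acy; apply/subspace_continuousP => t /= tab.
apply/cvgrPdist_le => e e0; have [d d0 dy] := acy _ e0.
have {}dy s u : s \in `[a, b] -> u \in `[a, b] -> s <= u -> u - s < d ->
    enorm (y u - y s) < e.
  rewrite !in_itv /= => /andP[? ?] /andP[? ?] su usd.
  have := dy 1%N (fun=> s) (fun=> u); rewrite !big_ord1; apply => //.
have near_t : \forall s \near t, `|t - s| < d.
  by apply: filterS (nbhsx_ballx t _ d0) => s; rewrite -ball_normE.
rewrite near_withinE; apply: filterS near_t => s tsd sab.
apply: (le_trans (norm_le_enorm _)); move: tsd; rewrite ltr_norml => /andP[? ?].
have [ts|st] := leP t s.
  by rewrite enormB ltW // dy //; lra.
by rewrite ltW // dy // ?(ltW st) //; lra.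
Qed.

Lemma abs_continuousS k (y : R -> 'rV[R]_k) (a b a' b' : R) : a <= a' -> b' <= b ->
  abs_continuous a b y -> abs_continuous a' b' y.
Proof.
move=> aa' bb' acy e /acy[d d0 dy]; exists d => // K u v uv; apply: dy => i /uv[? ? ?].
by split => //; [exact: le_trans aa' _|exact: le_trans bb'].
Qed.

Lemma abs_continuousB_lip k (y F : R -> 'rV[R]_k) (a b M : R) :
  (forall s t, a <= s -> s <= t -> t <= b -> enorm (F t - F s) <= M * (t - s)) ->
  abs_continuous a b y -> abs_continuous a b (y - F).
Proof.
move=> lipF acy e e0; have e20 : 0 < e / 2 by rewrite divr_gt0.
have [d d0 dy] := acy _ e20.
have M0 : 0 < `|M| + 1 by rewrite ltr_wpDl.
exists (Num.min d (e / 2 / (`|M| + 1))); first by rewrite lt_min d0 divr_gt0.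
move=> K u v uv vu; rewrite lt_min => /andP[uvd uve].
rewrite [ltRHS]splitr.
apply: le_lt_trans (ltrD (dy _ _ _ uv vu uvd) (_ : \sum_(i < K) (`|M| + 1) * (v i - u i) < _)).
  rewrite -big_split /=; apply: ler_sum => i _; have [? ? ?] := uv _ (ltn_ord i).
  rewrite (_ : _ - _ = (y (v i) - y (u i)) + (F (u i) - F (v i))); last first.
    by rewrite !fctE opprB addrACA [in RHS]addrACA [- F _ + _]addrC.
  apply: (le_trans (enormD _ _)); rewrite lerD2l enormB.
  apply: (le_trans (lipF _ _ _ _ _)) => //.
  by rewrite ler_wpM2r ?subr_ge0 // (le_trans (ler_norm _)) // lerDl.
by rewrite -mulr_sumr mulrC -ltr_pdivlMr.
Qed.

(** The retraction of the line onto [[a, b]]. Composing with it turns a function continuous within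
    the interval into a continuous one, so that no one-sided regularity has to be carried along. *)
Definition clamp (a b t : R) := Num.max a (Num.min b t).

Lemma clamp_itv a b t : a <= b -> clamp a b t \in `[a, b].
Proof. by move=> ab; rewrite in_itv /= /clamp le_max lexx /= ge_max ab ge_min lexx. Qed.

Lemma clamp_id a b t : t \in `[a, b] -> clamp a b t = t.
Proof. by rewrite in_itv /= => /andP[? ?]; rewrite /clamp min_r // max_r. Qed.

Lemma continuous_clamp a b : continuous (clamp a b).
Proof.
move=> t; apply: continuous_max; first exact: cst_continuous.
by apply: continuous_min; [exact: cst_continuous|exact: cvg_id].
Qed.

Lemma continuous_comp_clamp (T : topologicalType) (f : R -> T) a b : a <= b ->
  {within `[a, b], continuous f} -> continuous (f \o clamp a b).
Proof.
move=> ab /subspace_continuousP cf t; apply: cvg_comp (cf _ (clamp_itv t ab)).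
move=> A; rewrite /= /within /= => nA.
have H : \forall s \near t, `[a, b]%classic (clamp a b s) -> A (clamp a b s).
  exact: (@continuous_clamp a b t _ nA).
by apply: (@filterS _ (nbhs t) _ _ _ _ H) => s; apply; exact: (clamp_itv s ab).
Qed.

Lemma continuous_integrable (f : R -> R) (a b : R) : {within `[a, b], continuous f} ->
  mu.-integrable `[a, b] (EFin \o f).
Proof. by move=> cf; apply: continuous_compact_integrable => //; exact: segment_compact. Qed.

Lemma is_derive_derive1 (F : R -> R) (t l : R) : derivable F t 1 -> F^`()%classic t = l ->
  is_derive t (1 : R) F l.
Proof. by move=> dF <-; apply: DeriveDef => //; rewrite derive1E. Qed.

(** The integral from [a] is differentiated strictly to the right of [a] only; the base point is
    therefore taken one unit below the interval of interest. *)
Lemma primitive_exists (f : R -> R) (a : R) : continuous f ->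
  exists F : R -> R, forall t, a < t -> is_derive t (1 : R) F (f t).
Proof.
move=> cf; exists (fun t => \int[mu]_(s in `[a, t]) f s) => t at_.
have [] := @continuous_FTC1_closed R f a t (t + 1) _ _ at_ (cf t).
- by rewrite ltrDl.
- by apply: continuous_integrable; exact: continuous_subspaceT.
- exact: is_derive_derive1.
Qed.

Lemma is_derive_coord k (y : R -> 'rV[R]_k) t (dy : 'rV[R]_k) :
  is_derive t (1 : R) y dy <-> forall i, is_derive t (1 : R) (fun s => y s 0 i) (dy 0 i).
Proof.
split=> [[yt y't] i|yi].
  have yit : derivable (fun s => y s 0 i) t 1 by exact: (derivable_mxP _ _ _).1.
  by apply: DeriveDef => //; rewrite -y't derive_mx // mxE.
have yt : derivable y t 1.
  by apply/derivable_mxP => i j; rewrite ord1; apply: ex_derive.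
apply: DeriveDef => //; rewrite derive_mx //; apply/rowP => i; rewrite mxE.
exact: derive_val.
Qed.

(** Otherwise the null set of exceptions would contain a nondegenerate interval, whose measure is
    positive. *)
Lemma ac_ae_dense (a b : R) (Q : R -> Prop) : a < b ->
  {ae mu, forall t, `[a, b]%classic t -> Q t} ->
  forall t, `[a, b]%classic t -> forall e, 0 < e -> exists s, [/\ `[a, b]%classic s, `|s - t| < e & Q s].
Proof.
move=> ab [N [mN N0 NQ]] t; rewrite /= in_itv /= => /andP[at_ tb] e e0.
apply: contrapT => nQ.
pose a' := Num.max a (t - e / 2); pose b' := Num.min b (t + e / 2).
have ab' : a' < b' by rewrite /a' /b' gt_max !lt_min ab /=; apply/andP; split; [lra|apply/andP; split; lra].
have : (mu `[a', b'] <= mu N)%E.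
  apply: le_measure; rewrite ?inE // => s; rewrite /= in_itv /= => /andP[].
  rewrite ge_max le_min => /andP[as_ tes] /andP[sb ste].
  apply: NQ => /= h; apply: nQ; exists s; split; first by rewrite /= in_itv /= as_ sb.
    by rewrite ltr_norml; apply/andP; split; lra.
  by apply: h; rewrite in_itv /= as_ sb.
by rewrite N0 lebesgue_measure_itv /= lte_fin ab' -EFinB lee_fin subr_le0 leNgt ab'.
Qed.

Lemma ae_closed_itv (a b : R) k (y : R -> 'rV[R]_k) (S : set 'rV[R]_k) : a < b ->
  closed S -> {within `[a, b], continuous y} ->
  {ae mu, forall t, `[a, b]%classic t -> S (y t)} -> forall t, `[a, b]%classic t -> S (y t).
Proof.
move=> ab cS /subspace_continuousP cy aeS t tab.
apply: cS => A /(cy t tab); rewrite /= /within /= => /nbhs_ballP[e /= e0 eA].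
have [s [sab ste Ss]] := ac_ae_dense ab aeS tab e0.
by exists (y s); split => //; apply: eA => //; rewrite -ball_normE /= distrC.
Qed.

(** Subtracting a primitive [Phi] of the continuous right-hand side leaves an absolutely continuous
    path whose derivative vanishes almost everywhere, hence a constant. So [y] is [Phi] plus a
    constant and is differentiable at every interior time. *)
Lemma ac_ode_C1 k (y phi : R -> 'rV[R]_k) (a b : R) : a <= b -> abs_continuous a b y ->
  {within `[a, b], continuous phi} ->
  {ae mu, forall t, `[a, b]%classic t -> is_derive t (1 : R) y (phi t)} ->
  forall t, t \in `]a, b[ -> is_derive t (1 : R) y (phi t).
Proof.
move=> ab acy cphi y'.
pose f t := phi (clamp a b t).
have cf : continuous f by exact: continuous_comp_clamp.
have cfi i : continuous (fun t => f t 0 i).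
  move=> t; apply: (@continuous_comp _ _ _ f (fun M : 'rV_k => M 0 i)); first exact: cf.
  exact: coord_continuous.
have /choice[F F'] i := primitive_exists (a - 1) (cfi i).
pose Phi t := \row_i F i t.
have Phi' t : a <= t -> is_derive t (1 : R) Phi (f t).
  move=> at_; apply/is_derive_coord => i.
  rewrite (_ : (fun s => Phi s 0 i) = F i); last by apply/funext => s; rewrite mxE.
  by apply: F'; lra.
have [M fM] : exists M, forall t, `|f t| <= M.
  have : compact (f @` `[a, b]).
    by apply: continuous_compact; [exact: continuous_subspaceT|exact: segment_compact].
  move=> /compact_bounded[M [_ MK]]; exists (M + 1) => t; apply: MK; first by rewrite ltrDl.
  exists (clamp a b t); first exact: (clamp_itv t ab).
  by rewrite /f (clamp_id (clamp_itv t ab)).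
have lip s t : a <= s -> s <= t -> t <= b -> enorm (Phi t - Phi s) <= k%:R * M * (t - s).
  move=> as_ st tb; rewrite -mulrA; apply: enorm_coord_le => i; rewrite !mxE.
  have Fd x : a <= x -> is_derive x (1 : R) (F i) (f x 0 i) by move=> ?; apply: F'; lra.
  have [||c cst ->] := @MVT_segment R (F i) (fun t => f t 0 i) s t st.
  - by move=> x /itvP xst; apply: Fd; rewrite (le_trans as_) // xst.
  - apply: derivable_within_continuous => x /itvP xst.
    by have := Fd x; rewrite (le_trans as_) ?xst // => /(_ isT) [].
  - rewrite normrM (@ger0_norm _ (t - s)) ?subr_ge0 // ler_wpM2r ?subr_ge0 //.
    exact: le_trans (coord_le_norm _ _ _) (fM _).
have acz := abs_continuousB_lip lip acy.
have z' : {ae mu, forall t, `[a, b]%classic t -> is_derive t (1 : R) (y - Phi) 0}.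
  move: y'; apply: filterS; first exact: (ae_filter_ringOfSetsType mu).
  move=> t y't tab; have := tab; rewrite /= in_itv /= => /andP[at_ tb].
  have -> : 0 = phi t - f t :> 'rV[R]_k.
    by rewrite /f clamp_id ?in_itv ?subrr //= at_ tb.
  by apply: is_deriveB; [exact: y't|exact: Phi'].
clearbody Phi; have zc t : t \in `[a, b] -> y t = Phi t + (y a - Phi a).
  rewrite in_itv /= => /andP[at_ tb].
  suff H : (y - Phi) t = (y - Phi) a.
    have {}H : y t - Phi t = y a - Phi a by move: H; rewrite !fctE.
    by rewrite -H addrCA subrr addr0.
  apply: ac_derive0_cst => //; first exact: abs_continuousS acz.
  move: z'; apply: filterS; first exact: (ae_filter_ringOfSetsType mu).
  move=> s zs; rewrite /= in_itv /= => /andP[as_ st].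
  by apply: zs; rewrite /= in_itv /= as_ (le_trans st).
move=> t tab; have /itvP tab' := tab.
have -> : phi t = f t + 0 by rewrite addr0 /f clamp_id // in_itv /= !tab'.
have Phit : is_derive t (1 : R) (Phi + cst (y a - Phi a)) (f t + 0).
  by apply: is_deriveD; apply: Phi'; rewrite tab'.
apply: near_eq_is_derive Phit.
have : \forall s \near t, s \in `]a, b[ by exact: near_in_itvoo.
apply: filterS => s /itvP sab.
have {}zc : y s = Phi s + (y a - Phi a) by apply: zc; rewrite in_itv /= !sab.
by rewrite zc !fctE.
Qed.

End AbsoluteContinuity.

(** * Order of the slices of a hybrid time domain *)

Section HybridTimeDomains.
Context {R : realType}.
Variable E : set (R * nat).
Hypothesis hE : hybrid_time_domain E.

Let window T J : E (T, J) -> exists (K : nat) (t : nat -> R),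
  (forall i j, (i <= j)%N -> (j <= K)%N -> t i <= t j) /\
  forall s j, s <= T -> (j <= J)%N -> E (s, j) <-> (j < K)%N /\ t j <= s <= t j.+1.
Proof.
move=> ETJ; have [K [t [t0 tinc EK]]] := hE.2 _ _ ETJ; exists K, t; split.
  move=> i j ij; elim: j ij => [|j IHj]; first by rewrite leqn0 => /eqP ->.
  rewrite leq_eqVlt => /predU1P[-> //|ij] jK.
  by apply: (le_trans (IHj ij (ltnW jK))); exact: tinc.
move=> s j sT jJ; split=> [Esj|sj].
  have : (E `&` [set q | 0 <= q.1 <= T /\ (q.2 <= J)%N]) (s, j).
    by split => //=; rewrite sT (hE.1 _ Esj).
  by rewrite EK.
by have : [set q | (q.2 < K)%N /\ t q.2 <= q.1 <= t q.2.+1] (s, j) by []; rewrite -EK => -[].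
Qed.

(** In the truncation at [(T, J)] the slices are consecutive intervals, so what slice [l] contains
    up to time [T] precedes slice [J]. Times of slice [l] beyond [T] are not controlled: that slice
    may flow on past the jump. *)
Lemma htd_le (T s t : R) (J l : nat) :
  E (T, J) -> E (t, l) -> (l < J)%N -> t <= T -> E (s, J) -> t <= s.
Proof.
move=> ETJ Etl lJ tT EsJ; have [sT|Ts] := leP s T; last exact: le_trans (ltW Ts).
have [K [tt [inc win]]] := window ETJ.
have [_ /andP[_ t1]] := (win _ _ tT (ltnW lJ)).1 Etl.
have [JK /andP[s1 _]] := (win _ _ sT (leqnn J)).1 EsJ.
by apply: (le_trans t1); apply: le_trans s1; apply: inc => //; exact: ltnW.
Qed.

Lemma htd_convex (t1 t2 s : R) (J : nat) :
  E (t1, J) -> E (t2, J) -> t1 <= s -> s <= t2 -> E (s, J).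
Proof.
move=> E1 E2 t1s st2; have [K [tt [inc win]]] := window E2.
apply/(win _ _ st2 (leqnn J)).
have [JK /andP[? _]] := (win _ _ (le_trans t1s st2) (leqnn J)).1 E1.
have [_ /andP[_ ?]] := (win _ _ (lexx _) (leqnn J)).1 E2.
by split => //; apply/andP; split; [exact: le_trans t1s|exact: le_trans st2 _].
Qed.

(** The witness is the switching time [tt J.+1] of the truncation at [(T, J.+1)]: the jump time, and
    the left end of the new slice. *)
Lemma htd_pred (T : R) (J : nat) : E (T, J.+1) ->
  exists s, [/\ s <= T, E (s, J), E (s, J.+1) & forall t, E (t, J.+1) -> s <= t].
Proof.
move=> ET; have [K [tt [inc win]]] := window ET.
have [JK /andP[t1 t2]] := (win _ _ (lexx _) (leqnn _)).1 ET.
have E1 : E (tt J.+1, J).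
  by apply/(win _ _ t1 (leqnSn _)); split; [exact: ltnW|rewrite lexx andbT inc // ltnW].
exists (tt J.+1); split => //.
- by apply/(win _ _ t1 (leqnn _)); split => //; rewrite lexx inc.
- by move=> t Et; exact: (htd_le ET E1).
Qed.

End HybridTimeDomains.

(** * Measurability of hitting events and of the end point of a slice *)

Section HittingTimes.
Context {R : realType} {d : measure_display} {Omega : measurableType d}.

Lemma open_setX (X Y : topologicalType) (A : set X) (B : set Y) :
  open A -> open B -> open (A `*` B).
Proof.
rewrite !openE => oA oB [a b] [/= /oA Aa /oB Bb].
by exists (A, B).
Qed.

Definition enlarge (X : pseudoMetricType R) (K : set X) (n : nat) : set X :=
  \bigcup_(x in K) (ball x (n.+1%:R^-1))°.

Lemma open_enlarge (X : pseudoMetricType R) (K : set X) n : open (enlarge K n).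
Proof. by apply: bigcup_open => x _; exact: open_interior. Qed.

Lemma sub_enlarge (X : pseudoMetricType R) (K : set X) n : K `<=` enlarge K n.
Proof.
move=> x Kx; exists x => //; apply: nbhsx_ballx.
by rewrite invr_gt0 ltr0n.
Qed.

Lemma compact_closed_separated (X : pseudoMetricType R) (K F : set X) :
  compact K -> closed F -> K `&` F = set0 ->
  exists n : nat, forall x y, K x -> F y -> ~ ball x (n.+1%:R^-1) y.
Proof.
move=> /compact_near_coveringP cK cF KF0.
have [|n _ nP] := cK nat \oo (fun n x => forall y, F y -> ~ ball x (n.+1%:R^-1) y) _.
  move=> x Kx; have /nbhs_ballP[e /= e0 eF] : nbhs x (~` F).
    apply: open_nbhs_nbhs; split; first exact: closed_openC.
    by move=> Fx; have : (K `&` F) x by []; rewrite KF0.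
  have e20 : 0 < e / 2 by rewrite divr_gt0.
  near=> x' n => /=.
  have ne : n.+1%:R^-1 < e / 2.
    by near: n; have := near_infty_natSinv_lt (PosNum e20); apply: filterS.
  move=> y Fy xy; apply: (eF y) => //.
  apply: (@ball_split _ _ x'); first by near: x'; exact: nbhsx_ballx.
  by apply: le_ball xy; exact: ltW.
by exists n => x y Kx; apply: nP => /=.
Unshelve. all: by end_near. Qed.

(** Measurability is given for open sets only. A closed value meets a compact [K] as soon as it
    meets all open enlargements of [K], because disjoint compact and closed sets have a positive
    distance; so the event is a countable intersection. *)
Lemma hit_compact (X : pseudoMetricType R) (M : Omega -> set X) :
  (forall w, closed (M w)) -> set_measurable measurable M ->
  forall K, compact K -> measurable [set w | M w `&` K !=set0].
Proof.
move=> cM mM K cK.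
rewrite (_ : mkset _ = \bigcap_n [set w | M w `&` enlarge K n !=set0]).
  by apply: bigcapT_measurable => n; apply: mM; exact: open_enlarge.
apply/seteqP; split=> w /=.
  by move=> [x [Mx Kx]] n _; exists x; split => //; exact: sub_enlarge.
move=> hit; apply: contrapT => /set0P/negP/negPn/eqP KM0.
have [|n nP] := compact_closed_separated cK (cM w); first by rewrite setIC.
have [y [My [x Kx /interior_subset xy]]] := hit n Logic.I.
exact: nP xy.
Qed.

Lemma hit_bigcup (X : pseudoMetricType R) (M : Omega -> set X) (A : set X) (K : nat -> set X) :
  (forall w, closed (M w)) -> set_measurable measurable M ->
  (forall n, compact (K n)) -> A = \bigcup_n K n ->
  measurable [set w | M w `&` A !=set0].
Proof.
move=> cM mM cK ->.
rewrite (_ : mkset _ = \bigcup_n [set w | M w `&` K n !=set0]).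
  by apply: bigcupT_measurable => n; exact: hit_compact.
apply/seteqP; split=> w /=; first by move=> [x [Mx [n _ Kx]]]; exists n => //; exists x.
by move=> [n _ [x [Mx Kx]]]; exists x; split => //; exists n.
Qed.

Definition rV_ball (N n : nat) : set 'rV[R]_N := [set v | `|v| <= n%:R].
Arguments rV_ball N n : clear implicits.

Lemma rV_ball_compact N n : compact (rV_ball N n).
Proof.
apply: bounded_closed_compact.
  by exists n%:R; split => // M nM v /= /le_trans; apply; exact: ltW.
rewrite (_ : rV_ball N n = (fun v => `|v|) @^-1` [set x : R | x <= n%:R]) //.
apply: closed_comp; last exact: closed_le.
by move=> v _; exact: norm_continuous.
Qed.

Lemma rV_ball_cover N : \bigcup_n rV_ball N n = setT.
Proof.
apply/seteqP; split => // v _; exists (Num.truncn `|v|).+1 => //=.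
by apply/ltW; exact: truncnS_gt.
Qed.

Variables (N : nat) (S : Omega -> set (R * 'rV[R]_N)).
Hypothesis cS : forall w, closed (S w).
Hypothesis mS : set_measurable measurable S.
Hypothesis S_fun : forall w t y y', S w (t, y) -> S w (t, y') -> y = y'.

Definition is_end w e y := S w (e, y) /\ forall q, S w q -> q.1 <= e.

Lemma is_end_inj w e y e' y' : is_end w e y -> is_end w e' y' -> e = e' /\ y = y'.
Proof.
move=> [Se le] [Se' le']; have ee : e = e'.
  by apply/le_anti; rewrite (le' _ Se) (le _ Se').
by split => //; apply: (S_fun Se); rewrite ee.
Qed.

(** The last time is located between rationals: for every [n] some [q] is such that the slice meets
    the open enlargement of [K] after time [q], and has no point later than [q + n.+1%:R^-1]. Both
    conditions concern open sets. *)
Lemma end_in_compact (K : set 'rV[R]_N) : compact K ->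
  measurable [set w | exists e y, is_end w e y /\ K y].
Proof.
move=> cK.
rewrite (_ : mkset _ = \bigcap_n \bigcup_(q in [set: rat])
  ([set w | S w `&` ([set t | ratr q < t] `*` enlarge K n) !=set0] `\`
   [set w | S w `&` ([set t | ratr q + n.+1%:R^-1 < t] `*` setT) !=set0])).
  apply: bigcapT_measurable => n; apply: bigcupT_measurable_rat => q.
  by apply: measurableD; apply: mS; apply: open_setX; [exact: open_gt|exact: open_enlarge
    |exact: open_gt|exact: openT].
apply/seteqP; split=> w /=.
  move=> [e [y [[Sey le] Ky]]] n _.
  have n0 : 0 < n.+1%:R^-1 :> R by rewrite invr_gt0 ltr0n.
  have [|q qe] := @rat_in_itvoo R (e - n.+1%:R^-1) e; first by rewrite gtrBl.
  move: qe; rewrite in_itv /= => /andP[q1 q2].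
  exists q => //; split.
    by exists (e, y); split => //; split => //=; exact: sub_enlarge.
  move=> [[t z] [/le /= te [/= qt _]]].
  by move: (lt_le_trans qt te); rewrite ltNge -lerBlDr (ltW q1).
move=> H.
have /choice[q Hq] : forall n, exists q, (([set w | S w `&` ([set t | ratr q < t] `*` enlarge K n) !=set0] `\`
   [set w | S w `&` ([set t | ratr q + n.+1%:R^-1 < t] `*` setT) !=set0]) w).
  by move=> n; have [q _ Hq] := H n Logic.I; exists q.
pose times := [set t | exists y, S w (t, y)].
have timesub n t : times t -> t <= ratr (q n) + n.+1%:R^-1.
  move=> [y Sty]; rewrite leNgt; apply/negP => h.
  by have [_ nh] := Hq n; apply: nh; exists (t, y).
have supT : has_sup times.
  split; last by exists (ratr (q 0%N) + 1%:R^-1) => t; exact: timesub.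
  by have [[[t y] [Sty _]] _] := Hq 0%N; exists t, y.
pose e := sup times.
have le : forall p, S w p -> p.1 <= e.
  by move=> [t y] Sty; apply: ub_le_sup; [exact: supT.2|exists y].
suff [y Ky Sey] : exists2 y, K y & S w (e, y) by exists e, y.
apply: contrapT => nK.
(* The slice has points arbitrarily close to the compact set of pairs [(e, y)] with [y] in [K];
   being closed, it must meet that set. *)
have cK' : compact ([set e] `*` K) by apply: compact_setX => //; exact: compact_set1.
have [|n nP] := compact_closed_separated cK' (@cS w).
  rewrite -subset0 => -[t y] /= [[te Ky] Sty]; apply: nK.
  by exists y => //; rewrite -te.
have [[[t y] [Sty [/= qt [k Kk /interior_subset ky]]]] _] := Hq n.
apply: (nP (e, k) (t, y)) => //; split => //=.
rewrite -ball_normE /= ger0_norm ?subr_ge0; last exact: (le _ Sty).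
have : e <= ratr (q n) + n.+1%:R^-1.
  by apply: ge_sup; [exact: supT.1|exact: timesub].
by move=> h; rewrite ltrBlDr (le_lt_trans h) // addrC ltrD2l.
Qed.

Lemma end_in_closed (C : set 'rV[R]_N) : closed C ->
  measurable [set w | exists e y, is_end w e y /\ C y].
Proof.
move=> cC.
rewrite (_ : mkset _ = \bigcup_n [set w | exists e y, is_end w e y /\ (C `&` rV_ball N n) y]).
  apply: bigcupT_measurable => n; apply: end_in_compact.
  by rewrite setIC; apply: compact_closedI => //; exact: rV_ball_compact.
apply/seteqP; split=> w /=.
  move=> [e [y [ey Cy]]]; have : [set: 'rV[R]_N] y by [].
  by rewrite -rV_ball_cover => -[n _ ny]; exists n => //; exists e, y.
by move=> [n _ [e [y [ey [Cy _]]]]]; exists e, y.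
Qed.

(** The value is 0 for a slice without a last point; the measurability proof has to account for this
    default. *)
Definition end_val w : 'rV[R]_N := xget 0 [set y | exists e, is_end w e y].

Lemma end_valP w e y : is_end w e y -> end_val w = y.
Proof.
move=> ey; have : exists e', is_end w e' (end_val w).
  by apply: (@xgetPex _ 0 [set y | exists e, is_end w e y]); exists y, e.
by move=> [e' /(is_end_inj ey)[_ ->]].
Qed.

Lemma measurable_end_val i : measurable_fun setT (fun w => end_val w 0 i).
Proof.
apply: (measurability _ (RGenCInfty.measurableE R)) => _ [_ [a ->] <-].
rewrite setTI.
have mE (C : set 'rV[R]_N) : closed C -> measurable [set w | exists e y, is_end w e y /\ C y].
  exact: end_in_closed.
rewrite (_ : _ @^-1` _ = [set w | exists e y, is_end w e y /\ a <= y 0 i] `|`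
   (* Outcomes without a last point take the default value 0, so they belong to the preimage exactly
      when [a <= 0]. *)
   (~` [set w | exists e y, is_end w e y /\ setT y] `&` [set w | a <= 0])).
  apply: measurableU.
    apply: (mE [set y | a <= y 0 i]).
    change (closed ((fun y : 'rV[R]_N => y 0 i) @^-1` [set x | a <= x])).
    by apply: closed_comp; [move=> y _; exact: coord_continuous|exact: closed_ge].
  apply: measurableI; first by apply: measurableC; apply: mE; exact: closedT.
  by have [a0|a0] := boolP (a <= 0); rewrite ?set_true ?set_false //; exact: measurable0.
apply/seteqP; split=> w /=; rewrite in_itv /= andbT.
  have [[e [y ey]]|nE] := pselect (exists e y, is_end w e y).
    by rewrite (end_valP ey) => ay; left; exists e, y.
  rewrite /end_val; case: xgetP => [y _ [e ey]|_]; first by exfalso; apply: nE; exists e, y.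
  by rewrite mxE => a0; right; split => // -[e [y [ey _]]]; apply: nE; exists e, y.
move=> [[e [y [ey ay]]]|[nE a0]]; first by rewrite (end_valP ey).
rewrite /end_val; case: xgetP => [y _ [e ey]|_]; last by rewrite mxE.
by exfalso; apply: nE; exists e, y.
Qed.

End HittingTimes.

(** * Measurability of vectors through their coordinates *)

Section MeasurableCoordinates.
Context {R : realType} {d : measure_display} {T : measurableType d}.

Lemma open_rV_bigcup k (O : set 'rV[R]_k) : open O ->
  O = \bigcup_(qn in [set qn : 'rV[rat]_k * nat |
     ball (map_mx ratr qn.1 : 'rV[R]_k) (qn.2.+1%:R^-1) `<=` O])
     ball (map_mx ratr qn.1 : 'rV[R]_k) (qn.2.+1%:R^-1).
Proof.
move=> oO; apply/seteqP; split=> [x Ox|x [qn /= sO xq]]; last exact: sO.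
have /nbhs_ballP[e /= e0 eO] : nbhs x O by exact: open_nbhs_nbhs.
have [n ne] : exists n : nat, n.+1%:R^-1 <= e / 2.
  have [n _ nP] := near_infty_natSinv_lt (PosNum (divr_gt0 e0 (@ltr0n R 2))).
  by exists n; apply/ltW; apply: (nP n) => /=.
have n0 : 0 < n.+1%:R^-1 :> R by rewrite invr_gt0 ltr0n.
have /choice[q qx] : forall i, exists q : rat, `|x 0 i - ratr q| < n.+1%:R^-1.
  move=> i; have [|q] := @rat_in_itvoo R (x 0 i - n.+1%:R^-1) (x 0 i); first by rewrite gtrBl.
  rewrite in_itv /= => /andP[q1 q2]; exists q.
  by rewrite gtr0_norm ?subr_gt0 // ltrBlDr addrC -ltrBlDr.
have xq : ball x (n.+1%:R^-1) (map_mx ratr (\row_i q i)).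
  by split => // i j; rewrite ord1 !mxE; exact: qx.
exists (\row_i q i, n); last exact: ball_sym.
by move=> y /= qy; apply: eO; apply: ball_split (le_ball ne xq) (le_ball ne qy).
Qed.

Lemma measurable_preimage_open k (Z : T -> 'rV[R]_k) (O : set 'rV[R]_k) :
  (forall i, measurable_fun setT (fun w => Z w 0 i)) -> open O -> measurable (Z @^-1` O).
Proof.
move=> mZ /open_rV_bigcup ->; rewrite preimage_bigcup.
rewrite bigcup_mkcond; apply: countable_bigcupT_measurable => [|qn]; first exact: countableP.
case: ifPn => // _.
have n0 : 0 < qn.2.+1%:R^-1 :> R by rewrite invr_gt0 ltr0n.
rewrite (_ : _ @^-1` _ = \bigcap_(i in [set: 'I_k])
    ((fun w => Z w 0 i) @^-1` ball (ratr (qn.1 0 i) : R) qn.2.+1%:R^-1)).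
  apply: fin_bigcap_measurable => // i _; rewrite -[X in measurable X]setTI.
  by apply: mZ => //; exact: measurable_ball.
apply/seteqP; split=> w /=.
  by move=> [_ h] i _ /=; have := h 0 i; rewrite mxE.
by move=> h; split => // i j; rewrite ord1 mxE; exact: h.
Qed.

(** Intended for the product of the past with the input space: measurability is checked coordinate
    by coordinate there, and the product sigma-algebra need not be compared with the Borel
    sigma-algebra of the stacked space. *)
Lemma measurable_continuous_rV k (Z : T -> 'rV[R]_k) (phi : 'rV[R]_k -> R) :
  (forall i, measurable_fun setT (fun w => Z w 0 i)) -> continuous phi ->
  measurable_fun setT (phi \o Z).
Proof.
move=> mZ cphi; apply: (measurability _ (RGenOpens.measurableE R)) => _ [_ [a [b ->]] <-].
rewrite setTI comp_preimage; apply: measurable_preimage_open => //.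
by apply: open_comp => // x _; exact: cphi.
Qed.

End MeasurableCoordinates.

(** * Independence of an input from the preceding ones *)

Section PastFutureIndependence.
Context {R : realType} {d : measure_display} {Omega : measurableType d}.
Variables (P : probability Omega R) (m : nat).
Variables (mu : probability (borelType 'rV[R]_m) R) (v : nat -> Omega -> 'rV[R]_m).
Hypothesis v_iid : iid P mu v.

Definition past_events (j : nat) : set (set Omega) :=
  [set A | exists2 i, (i < j)%N & exists2 B, borel B & A = v i @^-1` B].

(** The sample space with the sigma-algebra of the first [j] inputs as its own measurable structure,
    so that being decided by the past is plain measurability on this type. *)
Definition past (j : nat) := g_sigma_algebraType (past_events j).

Lemma past_measurable j (A : set Omega) : filtration v j A -> measurable A.
Proof.
apply: smallest_sub; first exact: sigma_algebra_measurable.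
by move=> _ [i _ [B mB ->]]; case: v_iid => mv _ _; exact: mv.
Qed.

Let cylinders (j : nat) : set (set Omega) :=
  [set A | exists2 B : nat -> set 'rV[R]_m, (forall l, borel (B l)) &
     A = \bigcap_(l in [set l | (l < j)%N]) (v l @^-1` B l)].

Let prob_cylinder (j : nat) (B : nat -> set 'rV[R]_m) : (forall l, borel (B l)) ->
  P (\bigcap_(l in [set l | (l < j)%N]) (v l @^-1` B l)) =
  (\prod_(l <- iota 0 j) P (v l @^-1` B l))%E.
Proof.
move=> mB; case: v_iid => _ _ /(_ [fset l in iota 0 j]%fset B mB) prodE.
rewrite (perm_big (enum_fset [fset l in iota 0 j]%fset)) /=; last first.
  apply: uniq_perm; rewrite ?iota_uniq ?fset_uniq // => l.
  by rewrite in_fset mem_iota.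
rewrite -prodE; congr (P _).
by apply/seteqP; split=> w h l /= lj; apply: h; move: lj; rewrite /= in_fset mem_iota.
Qed.

(** As functions of [A] both sides are finite measures. They agree on the cylinders over the first
    [j] inputs, which are stable under intersection and generate the filtration, so they agree on
    all of it. *)
Lemma past_indep j (A : set Omega) (B : set 'rV[R]_m) : filtration v j A -> borel B ->
  P (A `&` v j @^-1` B) = (P A * mu B)%E.
Proof.
move=> fA mB; have [mv muE _] := v_iid.
have mC : measurable (v j @^-1` B) by exact: mv.
pose r := NngNum (fine_ge0 (measure_ge0 mu B)).
have rE : (r%:num%:E = mu B)%E.
  by rewrite /= fineK // fin_num_measure.
suff : mrestr P mC A = mscale r P A by rewrite /mrestr /mscale rE muleC => ->.
have cylM : cylinders j `<=` measurable.
  by move=> _ [D mD ->]; apply: bigcap_measurableType => l _; exact: mv.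
apply: (@g_sigma_algebra_measure_unique _ _ _ (cylinders j) cylM (fun=> setT)).
- move=> _; exists (fun=> setT); first by move=> l; exact: measurableT.
  by apply/seteqP; split.
- by rewrite bigcup_const //; exists 0%N.
- move=> _ _ [D mD ->] [D' mD' ->]; exists (fun l => D l `&` D' l).
    by move=> l; apply: (@measurableI _ (borelType 'rV[R]_m)); [exact: mD|exact: mD'].
  by rewrite -bigcapI.
- move=> A' [D mD A'E]; change (P (A' `&` v j @^-1` B) = r%:num%:E * P A')%E.
  rewrite rE {}A'E.
  (* Adding [B] as factor number [j] makes the intersection a cylinder over [j.+1] inputs, to which
     the product rule of [iid] applies. *)
  pose D' l := if l == j then B else D l.
  have mD' l : borel (D' l) by rewrite /D'; case: eqP.
  have DD' : \bigcap_(l in [set l | (l < j)%N]) (v l @^-1` D l) =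
             \bigcap_(l in [set l | (l < j)%N]) (v l @^-1` D' l).
    by apply: eq_bigcapr => l /= lj; rewrite /D' ltn_eqF.
  rewrite (_ : _ `&` _ = \bigcap_(l in [set l | (l < j.+1)%N]) (v l @^-1` D' l)).
    rewrite DD' !prob_cylinder // -[j.+1]addn1 iotaD big_cat big_seq1 /= add0n muleC.
    by congr (_ * _)%E; rewrite /D' eqxx muE.
  rewrite DD'; apply/seteqP; split=> w /=.
    move=> [h hB] l /=; rewrite ltnS leq_eqVlt => /predU1P[->|]; last exact: h.
    by rewrite /D' eqxx.
  move=> h; split; first by move=> l /= lj; apply: h; rewrite /= ltnS ltnW.
  by have := h j (ltnSn j); rewrite /D' /= eqxx.
- move=> _; change (P (setT `&` v j @^-1` B) < +oo)%E.
  by rewrite setTI (le_lt_trans (probability_le1 P _)) ?ltry.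
- apply: (smallest_sub _ _ fA); first exact: smallest_sigma_algebra.
  move=> _ [i ij [D mD ->]]; apply: sub_sigma_algebra.
  exists (fun l => if l == i then D else setT).
    by move=> l; case: eqP => // _; exact: measurableT.
  apply/seteqP; split=> w /=; first by move=> Dw l /= lj; case: eqP => [->|].
  by move=> /(_ i ij) /=; rewrite eqxx.
Qed.

(** By independence the joint law of the past and of input [j] is the product of [P] restricted to
    the past with [mu]; Tonelli then lets the fresh input be integrated first, the past being
    frozen. *)
Lemma past_integral j (h : past j * borelType 'rV[R]_m -> \bar R) :
  measurable_fun setT h -> (forall z, 0 <= h z)%E ->
  (\int[P]_w h (w, v j w) = \int[P]_w \int[mu]_u h (w, u))%E.
Proof.
move=> mh h0; have [mv muE _] := v_iid.
have mid : measurable_fun setT (fun w : Omega => w : past j).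
  by move=> _ A mA; rewrite setTI; exact: past_measurable mA.
have mvj : measurable_fun setT (v j : Omega -> borelType 'rV[R]_m).
  by move=> _ A mA; rewrite setTI; exact: mv.
have mjoint : measurable_fun setT (fun w : Omega => (w : past j, v j w : borelType 'rV[R]_m)).
  exact: measurable_fun_pair.
pose X : {mfun Omega >-> past j} := HB.pack (fun w : Omega => w : past j)
  (isMeasurableFun.Build _ _ _ _ _ mid).
pose Z : {mfun Omega >-> (past j * borelType 'rV[R]_m)%type} := HB.pack
  (fun w : Omega => (w : past j, v j w : borelType 'rV[R]_m))
  (isMeasurableFun.Build _ _ _ _ _ mjoint).
transitivity (\int[distribution P Z]_z h z)%E.
  by rewrite ge0_integral_distribution.
transitivity (\int[(distribution P X \x mu)%E]_z h z)%E.
  apply: eq_measure_integral => A mA _.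
  apply/esym; apply: product_measure_unique => // C D mC mD.
  by rewrite /distribution /pushforward /=; exact: past_indep.
rewrite fubini_tonelli1 // ge0_integral_distribution //.
- exact: measurable_fun_fubini_tonelli_F.
- by move=> w; exact: integral_ge0.
Qed.

End PastFutureIndependence.

(** * Helpers on continuity and integrals *)

Section ContinuityHelpers.
Variables T U V : topologicalType.

Lemma continuous_pairf (f : T -> U) (g : T -> V) :
  continuous f -> continuous g -> continuous (fun x => (f x, g x)).
Proof. by move=> cf cg x; exact: cvg_pair (cf x) (cg x). Qed.

Lemma continuous_fstf (f : T -> U * V) : continuous f -> continuous (fun x => (f x).1).
Proof. by move=> cf x; apply: (cvg_comp _ _ (cf x)); exact: cvg_fst. Qed.

Lemma continuous_sndf (f : T -> U * V) : continuous f -> continuous (fun x => (f x).2).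
Proof. by move=> cf x; apply: (cvg_comp _ _ (cf x)); exact: cvg_snd. Qed.

Lemma continuous_idf : continuous (fun x : T => x).
Proof. by move=> x; exact: cvg_id. Qed.

Lemma continuous_compf (f : T -> U) (g : U -> V) :
  continuous f -> continuous g -> continuous (fun x => g (f x)).
Proof. by move=> cf cg x; apply: (cvg_comp _ _ (cf x)); exact: cg. Qed.

Lemma open_preimage (f : T -> U) (D : set U) : continuous f -> open D -> open (f @^-1` D).
Proof. by move=> cf oD; apply: open_comp => // x _; exact: cf. Qed.

Lemma closed_preimage (f : T -> U) (D : set U) : continuous f -> closed D -> closed (f @^-1` D).
Proof. by move=> cf cD; apply: closed_comp => // x _; exact: cf. Qed.

End ContinuityHelpers.

Section ContinuityArith.
Context {R : realType}.
Variable T : topologicalType.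

Lemma continuous_cstf (U : topologicalType) (c : U) : continuous (fun _ : T => c).
Proof. by move=> x; exact: cvg_cst. Qed.

Lemma continuous_addf (V : normedModType R) (f g : T -> V) :
  continuous f -> continuous g -> continuous (fun x => f x + g x).
Proof. by move=> cf cg x; apply: cvgD; [exact: cf|exact: cg]. Qed.

Lemma continuous_subf (V : normedModType R) (f g : T -> V) :
  continuous f -> continuous g -> continuous (fun x => f x - g x).
Proof. by move=> cf cg x; apply: cvgB; [exact: cf|exact: cg]. Qed.

Lemma continuous_mulf (f g : T -> R) :
  continuous f -> continuous g -> continuous (fun x => f x * g x).
Proof. by move=> cf cg x; apply: cvgM; [exact: cf|exact: cg]. Qed.

End ContinuityArith.

Section IntegralHelpers.
Context {R : realType}.

Lemma measurable_borel_continuous k (f : 'rV[R]_k -> R) : continuous f ->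
  measurable_fun setT (f : borelType 'rV[R]_k -> R).
Proof.
move=> cf; apply: (measurability _ (RGenOpens.measurableE R)) => _ [_ [r [s ->]] <-].
rewrite setTI; apply: sub_sigma_algebra; apply: open_preimage => //.
Qed.

(** The integral of a nonnegative function is a supremum over the simple functions below it, and
    this supremum is monotone for arbitrary functions. It serves for integrands whose measurability
    is unknown, such as the state at a random time. *)
Lemma ge0_integral_mono d (T : measurableType d) (mu : {measure set T -> \bar R})
    (f g : T -> \bar R) : (forall x, 0 <= f x)%E -> (forall x, f x <= g x)%E ->
  (\int[mu]_x f x <= \int[mu]_x g x)%E.
Proof.
move=> f0 fg; rewrite !ge0_integralTE //; last by move=> x; exact: le_trans (fg x).
apply: ub_ereal_sup => _ [h hf <-]; apply: ereal_sup_ubound.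
by exists h => // x; exact: le_trans (fg x).
Qed.

End IntegralHelpers.

(** * Decay in the mean along a random solution of an abstract system *)

Section RandomSolutionDecay.
Context {R : realType} {d : measure_display} {Omega : measurableType d}.
Variables (P : probability Omega R) (m : nat).
Variables (mu : probability (borelType 'rV[R]_m) R) (v : nat -> Omega -> 'rV[R]_m).
Hypothesis v_iid : iid P mu v.
Variables (N : nat) (H : SHDS R N m) (y0 : 'rV[R]_N) (y : Omega -> @hybrid_arc R N).
Hypothesis y_sol : random_solution v H y0 y.

Let y_closed w : closed (graph (y w)). Proof. by case: y_sol => -[cy _] _ _; exact: cy. Qed.
Let y_adapted : adapted v y. Proof. by case: y_sol. Qed.
Let y_init w : arc_dom (y w) (0, 0%N) /\ y w 0 0%N = y0.
Proof. by case: y_sol => _ _ /(_ w)[]. Qed.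
Let y_jump w (t : R) j : arc_dom (y w) (t, j) -> arc_dom (y w) (t, j.+1) ->
  jump_set H (y w t j) /\ y w t j.+1 = jump_map H (y w t j) (v j w).
Proof. by case: y_sol => _ _ /(_ w)[_ _]; exact. Qed.
Let dom w := arc_dom (y w).
Let y_dom w : hybrid_time_domain (dom w). Proof. exact: arc_domP. Qed.

(** Graphs store the jump counter as a real number; an open strip of half-width 1/2 around [j]
    isolates slice [j], so that hits of open sets by one slice are hits of open sets by the
    graph. *)
Lemma natr_close (a b : nat) : `|a%:R - b%:R| < 2^-1 :> R -> a = b.
Proof.
have far (i l : nat) : (i < l)%N -> 2^-1 < l%:R - i%:R :> R.
  by rewrite -(ler_nat R) -natr1; lra.
rewrite ltr_norml => /andP[ab ba].
by case: (ltngtP a b) => // /far h; exfalso; lra.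
Qed.

Definition slice (j : nat) (w : Omega) : set (R * 'rV[R]_N) :=
  [set q | arc_dom (y w) (q.1, j) /\ q.2 = y w q.1 j].

Definition graph_upto (l : nat) (w : Omega) : set (R * R * 'rV[R]_N) :=
  graph (y w) `&` [set q | 0 <= q.1.1 /\ exists2 j, (j <= l)%N & q.1.2 = j%:R].

Let graphP w t j : arc_dom (y w) (t, j) -> graph (y w) (t, j%:R, y w t j).
Proof. by move=> dtj; exists j. Qed.

Let graph_uptoP l w t j : arc_dom (y w) (t, j) -> (j <= l)%N ->
  graph_upto l w (t, j%:R, y w t j).
Proof.
move=> dtj jl; split; first exact: graphP.
by split; [exact: (y_dom w).1 dtj|exists j].
Qed.

Let closed_slice j w : closed (slice j w).
Proof.
have -> : slice j w = (fun q : R * 'rV[R]_N => (q.1, j%:R, q.2)) @^-1` graph (y w).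
  apply/seteqP; split=> [[t z] [/= dt ->]|[t z] [j' /= [dt /eqP jj ->]]].
    exact: graphP.
  by move: jj; rewrite eqr_nat => /eqP ->.
apply: closed_preimage => //; apply: continuous_pairf.
  apply: continuous_pairf; last by move=> q; exact: cvg_cst.
  by apply: continuous_fstf; exact: continuous_idf.
by apply: continuous_sndf; exact: continuous_idf.
Qed.

Let slice_fun j w t z z' : slice j w (t, z) -> slice j w (t, z') -> z = z'.
Proof. by move=> [_ /= ->] [_ /= ->]. Qed.

Let measurable_slice j : set_measurable (@measurable _ (past v j)) (slice j : past v j -> _).
Proof.
move=> O oO.
have -> : [set w | slice j w `&` O !=set0] =
    [set w | graph_upto j w `&` [set q | `|q.1.2 - j%:R| < 2^-1 /\ O (q.1.1, q.2)] !=set0].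
  apply/seteqP; split=> w /=.
    move=> [[t z] [[/= dt ->] Oz]]; exists (t, j%:R, y w t j); split.
      exact: graph_uptoP.
    by split => //=; rewrite subrr normr0 invr_gt0.
  move=> [[[t s] z] [[[j' /= [dt -> ->]] _] /= [/natr_close jj Oz]]].
  by exists (t, y w t j'); rewrite -{1}jj.
apply: y_adapted; apply: openI.
  apply: (@open_preimage _ _ (fun q : R * R * 'rV[R]_N => q.1.2) [set x | `|x - j%:R| < 2^-1]).
    exact: continuous_sndf (continuous_fstf (@continuous_idf _)).
  rewrite (_ : mkset _ = ball (j%:R : R) 2^-1); last first.
    by apply/seteqP; split=> x; rewrite -ball_normE /= distrC.
  exact: ball_open.
apply: (@open_preimage _ _ (fun q : R * R * 'rV[R]_N => (q.1.1, q.2)) O) => //.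
apply: continuous_pairf; last exact: continuous_sndf (@continuous_idf _).
exact: continuous_fstf (continuous_fstf (@continuous_idf _)).
Qed.

Let closed_graph_upto l w : closed (graph_upto l w).
Proof.
apply: closedI => //.
rewrite (_ : mkset _ = [set q : R * R * 'rV[R]_N | 0 <= q.1.1] `&`
   \bigcup_(j in [set j | (j < l.+1)%N]) [set q | q.1.2 = j%:R]); last first.
  by apply/seteqP; split=> q /= [q0 [j jl qj]]; split => //; exists j.
have c1 : continuous (fun q : R * R * 'rV[R]_N => q.1.1).
  exact: continuous_fstf (continuous_fstf (@continuous_idf _)).
have c2 : continuous (fun q : R * R * 'rV[R]_N => q.1.2).
  exact: continuous_sndf (continuous_fstf (@continuous_idf _)).
apply: closedI; first exact: (closed_preimage c1 (@closed_ge _ 0)).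
apply: closed_bigcup; first exact: finite_II.
by move=> i _; exact: (closed_preimage c2 (@closed_eq _ i%:R)).
Qed.

Section Branching.

(* The condition on truncations of a hybrid time domain lets one slice flow beyond
   the time at which the arc jumps out of it; j is branched if an earlier slice does. *)
Definition branched (j : nat) : set Omega := [set w | exists t t' l,
  [/\ arc_dom (y w) (t, j), arc_dom (y w) (t', l), (l < j)%N & t < t']].

(** A rational between [t] and [t'] separates the two slices by open conditions, each of which
    concerns only the graph up to jump [j]. *)
Let measurable_branched j : measurable (branched j : set (past v j)).
Proof.
have -> : branched j = \bigcup_(q in [set: rat])
    ([set w | slice j w `&` [set p | p.1 < ratr q] !=set0] `&`
     [set w | graph_upto j w `&` [set p | p.1.2 < j%:R - 2^-1 /\ ratr q < p.1.1] !=set0]).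
  apply/seteqP; split=> w /=.
    move=> [t [t' [l [dt dt' lj /rat_in_itvoo[q]]]]].
    rewrite in_itv /= => /andP[tq qt']; exists q => //; split.
      by exists (t, y w t j).
    exists (t', l%:R, y w t' l); split; first by apply: graph_uptoP => //; exact: ltnW.
    by split => //=; move: lj; rewrite -(ler_nat R) -natr1; lra.
  move=> [q _ [[[t z] [[/= dt _] tq]] [[[t' s] z'] [[[l /= [dt' -> _]] _] [/= lj qt']]]]].
  exists t, t', l; split => //; last exact: lt_trans qt'.
  by rewrite -(ltr_nat R); lra.
apply: (@bigcupT_measurable_rat _ (past v j)) => q; apply: (@measurableI _ (past v j)).
  apply: measurable_slice.
  exact: (open_preimage (continuous_fstf (@continuous_idf _)) (@open_lt _ _)).
apply: y_adapted; apply: openI.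
  apply: (@open_preimage _ _ (fun p : R * R * 'rV[R]_N => p.1.2) [set x | x < j%:R - 2^-1]).
    exact: continuous_sndf (continuous_fstf (@continuous_idf _)).
  exact: open_lt.
apply: (@open_preimage _ _ (fun p : R * R * 'rV[R]_N => p.1.1) [set x | ratr q < x]).
  exact: continuous_fstf (continuous_fstf (@continuous_idf _)).
exact: open_gt.
Qed.

Let dom_below w (s : R) j l : dom w (s, j) -> (l <= j)%N -> exists2 s', s' <= s & dom w (s', l).
Proof.
elim: j s => [|j IHj] s ds; first by rewrite leqn0 => /eqP ->; exists s.
rewrite leq_eqVlt => /predU1P[->|lj]; first by exists s.
have [s1 [s1s ds1 _ _]] := htd_pred (@y_dom w) ds.
by have [s2 s21 ds2] := IHj _ ds1 lj; exists s2 => //; exact: le_trans s1s.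
Qed.

(** The earlier slice must outlast the jump time [s], since by [htd_le] anything it contains up to
    [s] precedes slice [j]. It thus also outlasts the first time of slice [j.+1]. *)
Let branchedS w j s : dom w (s, j) -> dom w (s, j.+1) -> branched j w -> branched j.+1 w.
Proof.
move=> dj dj1 [t [t' [l [dt dt' lj tt']]]].
exists s, t', l; split => //; first exact: ltnW.
rewrite ltNge; apply/negP => t's.
by have := htd_le (@y_dom w) dj dt' lj t's dt; rewrite leNgt tt'.
Qed.

(** A slice that flows on past its own jump cannot sit above an earlier slice that does so: the
    truncation at [(t', j)] would contain two overlapping slices. With [branchedS], a path meets at
    most one such jump, so the weight [M] is spent once. *)
Let not_branched w j (s t' : R) : dom w (s, j) -> dom w (t', j) -> s < t' ->
  dom w (s, j.+1) -> ~ branched j w.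
Proof.
move=> ds dt' st' ds1 [t [t2 [l [dt dt2 lj tt2]]]].
have [t2t'|t't2] := leP t2 t'.
  by have := htd_le (@y_dom w) dt' dt2 lj t2t' dt; rewrite leNgt tt2.
have [s' s's ds'] := dom_below ds (ltnW lj).
have dl : dom w (t', l).
  by apply: (htd_convex (@y_dom w) ds' dt2); [exact: (le_trans s's (ltW st'))|exact: ltW].
by have := htd_le (@y_dom w) dt' dl lj (lexx _) ds; rewrite leNgt st'.
Qed.

(** In the application [X] is the norm of the x-component, [W] the root of the Lyapunov function,
    and [tm] recovers the flow time from the state. [K] and [K2] bound [W] and [X] along a flow by
    the initial [X], [c] is the mean factor of a jump from [W] to [X], and [q] bounds the factor of
    one flow followed by one jump. *)
Variables (X W tm : 'rV[R]_N -> R) (k K K2 Lg c q delta rho M : R).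
Hypothesis X_ge0 : forall z, 0 <= X z.
Hypothesis closed_jump : closed (jump_set H).
Hypothesis continuous_tm : continuous tm.
Hypothesis continuous_XG : continuous (fun z : 'rV[R]_N * 'rV[R]_m => X (jump_map H z.1 z.2)).
Variables (O : set 'rV[R]_N) (Kn : nat -> set 'rV[R]_N).
Hypothesis Kn_compact : forall n, compact (Kn n).
Hypothesis OE : O = \bigcup_n Kn n.
Variable th : \bar R.
Hypothesis jump_mean : forall z, jump_set H z ->
  (\int[mu]_u (X (jump_map H z u))%:E <= (c * W z)%:E)%E.
Hypothesis jump_lip : forall z u, jump_set H z -> values v u ->
  X (jump_map H z u) <= Lg * X z.
Hypotheses (c_ge0 : 0 <= c) (K2_ge1 : 1 <= K2) (Lg_ge0 : 0 <= Lg).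
Hypotheses (q_ge0 : 0 <= q) (cKq : expR k * c * K <= q).
Hypotheses (delta_gt0 : 0 < delta) (M_ge1 : 1 <= M) (LK_le : Lg * K2 * expR k <= delta * M).
Hypotheses (rho_lt1 : rho < 1) (rho1 : q * (1 + delta) <= rho)
  (rho2 : q * (rho + delta) <= rho ^+ 2).
Hypothesis y_time : forall w t j, arc_dom (y w) (t, j) -> tm (y w t j) = t.
Hypothesis y_flow : forall w j t1 t2, t1 <= t2 ->
  arc_dom (y w) (t1, j) -> arc_dom (y w) (t2, j) ->
  (forall t, t1 <= t -> t <= t2 -> ~ O (y w t j)) ->
  W (y w t2 j) * expR (k * t2) <= K * (X (y w t1 j) * expR (k * t1)) /\
  X (y w t2 j) * expR (k * t2) <= K2 * (X (y w t1 j) * expR (k * t1)).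

Let hitting (j : nat) : set Omega := [set w | graph_upto j w `&`
  [set p | ((p.1.1 + p.1.2)%:E <= th)%E /\ O p.2] !=set0].

(** Within the horizon the target is a countable union of products of compact sets, the boxes
    cutting down the unbounded plane of times; [hit_bigcup] on the past then applies. *)
Let measurable_hitting j : measurable (hitting j : set (past v j)).
Proof.
have cs : continuous (fun p : R * R => p.1 + p.2).
  by move=> p; apply: cvgD; [exact: cvg_fst|exact: cvg_snd].
pose box n := (`[- n%:R, n%:R] `*` `[- n%:R, n%:R] : set (R * R)%type) `&`
  [set p | ((p.1 + p.2)%:E <= th)%E].
have cbox n : compact (box n).
  apply: compact_closedI; first by apply: compact_setX; exact: segment_compact.
  case: th => [r| |].
  - exact: (closed_preimage cs (@closed_le _ r)).
  - by rewrite (_ : mkset _ = setT); [exact: closedT|apply/seteqP; split => // p _ /=; rewrite leey].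
  - by rewrite (_ : mkset _ = set0); [exact: closed0|apply/seteqP; split => // p].
have -> : hitting j = \bigcup_n [set w | graph_upto j w `&` \bigcup_i (box i `*` Kn n) !=set0].
  apply/seteqP; split=> w /=.
    move=> [[p z] [gp [/= pth]]]; rewrite OE => -[n _ Kz]; exists n => //=.
    exists (p, z); split => //; exists (Num.truncn (`|p.1| + `|p.2|)).+1 => //; split => //=.
    split => //; rewrite /= !in_itv /= -!ler_norml.
    have /ltW h := truncnS_gt (`|p.1| + `|p.2|).
    by split; apply: le_trans h; rewrite ?lerDl ?lerDr.
  move=> [n _ [[p z] [gp [i _ [[_ /= pth] Kz]]]]]; exists (p, z); split => //=.
  by split => //; rewrite OE; exists n.
apply: (@bigcupT_measurable _ (past v j)) => n.
apply: (@hit_bigcup R _ (past v j) _ (graph_upto j) _ (fun i => box i `*` Kn n)) => //.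
- exact: y_adapted.
- by move=> i; exact: compact_setX.
Qed.

(** Reading the flow time off the state turns the horizon into a closed condition on the end point
    of the slice alone. *)
Let jumpable (j : nat) : set 'rV[R]_N := jump_set H `&` [set z | ((tm z + j%:R)%:E <= th)%E].

Let closed_jumpable j : closed (jumpable j).
Proof.
apply: closedI => //; case: th => [r| |].
- apply: (@closed_preimage _ _ (fun z => tm z + j%:R) [set x | x <= r]); last exact: closed_le.
  by apply: continuous_addf => //; exact: continuous_cstf.
- by rewrite (_ : mkset _ = setT); [exact: closedT|apply/seteqP; split => // p _ /=; rewrite leey].
- by rewrite (_ : mkset _ = set0); [exact: closed0|apply/seteqP; split => // p].
Qed.

(** A jump from the last point of slice [j] is possible and still of interest. Whether it is taken
    is left open, as that could depend on the next input; this keeps the event in the past. *)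
Let ready (j : nat) : set Omega :=
  [set w | exists e z, is_end (slice j) w e z /\ jumpable j z] `&` ~` hitting j.

Let measurable_ready j : measurable (ready j : set (past v j)).
Proof.
apply: (@measurableI _ (past v j)); last by apply: (@measurableC _ (past v j)); exact: measurable_hitting.
apply: (@end_in_closed R _ (past v j)) => //.
Qed.

Let Y j : Omega -> 'rV[R]_N := end_val (slice j).
Let xi j w : R := 1 + (M - 1) * \1_(~` branched j) w.

(* The weighted norm after the jump that a path whose j-th flow interval ends at
   Y j takes there. *)
Let g j (p : Omega * 'rV[R]_m) : R := xi j p.1 * \1_(ready j) p.1 *
  expR (k * j.+1%:R) * (expR (k * tm (Y j p.1)) * X (jump_map H (Y j p.1) p.2)).

Let Q j w : R := if j is i.+1 then g i (w, v i w) else M * X y0.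

Let xi_ge1 j w : 1 <= xi j w.
Proof. by rewrite /xi lerDl mulr_ge0 ?subr_ge0. Qed.

Let xi_branched j w : branched j w -> xi j w = 1.
Proof. by move=> bw; rewrite /xi indicE memNset ?mulr0 ?addr0 //= => /(_ bw). Qed.

Let xi_unbranched j w : ~ branched j w -> xi j w = M.
Proof. by move=> bw; rewrite /xi indicE mem_set //= mulr1 addrC subrK. Qed.

Let g_ge0 j p : 0 <= g j p.
Proof.
rewrite /g !mulr_ge0 ?expR_ge0 // ?indicE ?ler0n //.
exact: le_trans (xi_ge1 _ _).
Qed.

Let Q_ge0 j w : 0 <= Q j w.
Proof. by case: j => [|j] //=; rewrite mulr_ge0 // (le_trans _ M_ge1). Qed.

Let measurable_g j : measurable_fun setT (g j : past v j * borelType 'rV[R]_m -> R).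
Proof.
have mfst (f : past v j -> R) : measurable_fun setT f ->
    measurable_fun setT (fun p : past v j * borelType 'rV[R]_m => f p.1).
  by move=> mf; apply: (measurableT_comp mf); exact: measurable_fst.
apply: measurable_funM; first apply: measurable_funM; first apply: measurable_funM.
- apply: mfst; apply: measurable_funD => //; apply: measurable_funM => //.
  apply: measurable_indic; apply: (@measurableC _ (past v j)).
  exact: measurable_branched.
- by apply: mfst; apply: measurable_indic; exact: measurable_ready.
- exact: measurable_cst.
pose phi (z : 'rV[R]_(N + m)) : R :=
  expR (k * tm (lsubmx z)) * X (jump_map H (lsubmx z) (rsubmx z)).
have lc : continuous (@lsubmx R 1 N m).
  by move=> z; exact/differentiable_continuous/differentiable_lsubmx.
have rc : continuous (@rsubmx R 1 N m).
  by move=> z; exact/differentiable_continuous/differentiable_rsubmx.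
have cphi : continuous phi.
  apply: continuous_mulf.
    apply: (@continuous_compf _ _ _ _ expR); last exact: continuous_expR.
    apply: continuous_mulf; first exact: continuous_cstf.
    exact: continuous_compf lc continuous_tm.
  apply: (@continuous_compf _ _ _ (fun z => (lsubmx z, rsubmx z))
    (fun z : 'rV[R]_N * 'rV[R]_m => X (jump_map H z.1 z.2))); last exact: continuous_XG.
  exact: continuous_pairf.
have := @measurable_continuous_rV R _ (past v j * borelType 'rV[R]_m)%type _
  (fun p => row_mx (Y j p.1) p.2) phi _ cphi.
rewrite (_ : phi \o _ = (fun p => expR (k * tm (Y j p.1)) * X (jump_map H (Y j p.1) p.2))).
  apply=> i; rewrite -(splitK i); case: (fintype.split i) => a /=.
    under eq_fun do rewrite row_mxEl.
    apply: (mfst (fun w => Y j w 0 a)); apply: (@measurable_end_val R _ (past v j)).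
    - exact: closed_slice.
    - exact: measurable_slice.
    - exact: slice_fun.
  under eq_fun do rewrite row_mxEr.
  apply: (measurableT_comp (f := fun u : borelType 'rV[R]_m => u 0 a)); last exact: measurable_snd.
  by apply: measurable_borel_continuous => u; exact: coord_continuous.
by apply/funext => p; rewrite /phi /= row_mxKl row_mxKr.
Qed.

Let measurable_Q j : measurable_fun setT (Q j).
Proof.
case: j => [|j]; first exact: measurable_cst.
have [mv _ _] := v_iid.
have mjoint : measurable_fun setT (fun w : Omega => (w : past v j, v j w : borelType 'rV[R]_m)).
  apply: measurable_fun_pair.
    by move=> _ A mA; rewrite setTI; exact: (past_measurable v_iid mA).
  by move=> _ A mA; rewrite setTI; exact: mv.
exact: (measurableT_comp (@measurable_g j) mjoint).
Qed.

(* The jump out of a slice that flows on is not taken at the end of that slice, so it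
   may anticipate the input that drives it and only the Lipschitz bound Lg applies to it;
   the weight M carried by unbranched paths pays for this, which happens at most once. *)
Let lineage w j t : dom w (t, j) -> ((t + j%:R)%:E <= th)%E ->
  (forall t' j', dom w (t', j') -> (j' <= j)%N -> ((t' + j'%:R)%:E <= th)%E -> ~ O (y w t' j')) ->
  exists s, [/\ dom w (s, j), s <= t, forall t', dom w (t', j) -> s <= t',
    ~ branched j w -> M * (X (y w s j) * expR (k * (s + j%:R))) <= Q j w &
    branched j w -> X (y w s j) * expR (k * (s + j%:R)) <= Q j w + delta * Q j.-1 w].
Proof.
elim: j t => [|j IHj] t dt tth nohit.
  have [d0 yw0] := y_init w; exists 0; split => //.
  - exact: (y_dom w).1 dt.
  - by move=> t' /(y_dom w).1.
  - by rewrite yw0 addr0 mulr0 expR0 mulr1.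
  - by move=> [? [? [? []]]].
have [s [st ds ds1 smin]] := htd_pred (@y_dom w) dt.
have sth : ((s + j%:R)%:E <= th)%E.
  by apply: le_trans tth; rewrite lee_fin lerD // ler_nat.
have [|s0 [ds0 s0s _ IHu IHb]] := IHj s ds sth.
  by move=> t' j' d' j'j; apply: nohit => //; exact: leqW.
have [_ Xs] : W (y w s j) * expR (k * s) <= K * (X (y w s0 j) * expR (k * s0)) /\
    X (y w s j) * expR (k * s) <= K2 * (X (y w s0 j) * expR (k * s0)).
  apply: y_flow => // t' s0t' t's; apply: nohit => //.
    exact: (htd_convex (@y_dom w) ds0 ds).
  by apply: le_trans sth; rewrite lee_fin lerD.
have [Js yjump] := y_jump ds ds1.
suff [Hu Hb] : (~ branched j.+1 w -> M * (X (y w s j.+1) * expR (k * (s + j.+1%:R))) <= Q j.+1 w) /\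
    (branched j.+1 w -> X (y w s j.+1) * expR (k * (s + j.+1%:R)) <= Q j.+1 w + delta * Q j w).
  by exists s.
have expE x : expR (k * (x + j.+1%:R)) = expR (k * x) * expR (k * j.+1%:R).
  by rewrite mulrDr expRD.
(* If slice [j] ends at the jump time, the jump starts from [Y j w] and is the one recorded in
   [Q j.+1]. If it flows on, the jump is not recorded, and the estimate goes back to [Q j]. *)
have [send|] := pselect (forall t', dom w (t', j) -> t' <= s).
  have ends : is_end (slice j) w s (y w s j).
    by split; [split|move=> [t' z] [/= /send]].
  have YE : Y j w = y w s j by apply: (end_valP (@slice_fun j) ends).
  have rw : ready j w.
    split; first by exists s, (y w s j); split => //; split => //=; rewrite y_time.
    move=> [[[t' r] z] [[[j' /= [dt' -> ->]] [_ [j2 j2j /eqP jj2]]] /= [tth' Oz]]].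
    move: jj2; rewrite eqr_nat => /eqP jj2; apply: (nohit t' j') => //.
    by rewrite jj2; exact: leqW.
  have QE : Q j.+1 w = xi j w * (X (y w s j.+1) * expR (k * (s + j.+1%:R))).
    rewrite /Q /g /= YE y_time // indicE mem_set // mulr1 -yjump expE; ring.
  split; rewrite QE => bw.
    rewrite xi_unbranched // => bj; exact/bw/(branchedS ds ds1).
  rewrite -[leLHS]addr0 lerD ?mulr_ge0 ?(ltW delta_gt0) //.
  by rewrite -[leLHS]mul1r ler_wpM2r // mulr_ge0 // expR_ge0.
move=> /existsNP[t' /not_implyP[dt' /negP]]; rewrite -ltNge => st'.
split=> bw.
  by exfalso; apply: bw; exists s, t', j; split.
rewrite -[leLHS]add0r lerD //=.
(* Slice [j] is still unbranched, so [Q j w] carries the factor [M], and [delta * M] covers the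
   Lipschitz jump. *)
have ub : ~ branched j w by exact: (@not_branched w j s t' ds dt' st' ds1).
apply: le_trans (ler_wpM2l (ltW delta_gt0) (IHu ub)).
rewrite yjump expE mulrA; apply: (@le_trans _ _ (Lg * X (y w s j) * expR (k * s) * expR (k * j.+1%:R))).
  by rewrite !ler_wpM2r ?expR_ge0 //; apply: jump_lip => //; exists j, w.
apply: (@le_trans _ _ (Lg * (K2 * (X (y w s0 j) * expR (k * s0))) * expR (k * j.+1%:R))).
  by rewrite ler_wpM2r ?expR_ge0 // -mulrA ler_wpM2l.
rewrite (_ : _ * expR (k * j.+1%:R) = Lg * K2 * expR k * (X (y w s0 j) * expR (k * (s0 + j%:R)))).
  by rewrite [leRHS]mulrA ler_wpM2r // mulr_ge0 // expR_ge0.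
rewrite -natr1 !mulrDr !mulr1 !expRD; ring.
Qed.

(** Off [ready j] the integrand on the left vanishes. On it, integrating the fresh input first
    produces [c * W] at the end of slice [j]; the flow bounds this by [X] at its start, and
    [lineage] bounds that by [Q]. For [j = 0] the term in [j.-1] repeats [Q 0] and is mere slack. *)
Let mean_step j : (\int[P]_w (Q j.+1 w)%:E <=
  \int[P]_w (q * (Q j w + delta * Q j.-1 w))%:E)%E.
Proof.
have mg : measurable_fun setT (EFin \o g j : past v j * borelType 'rV[R]_m -> \bar R).
  by apply/measurable_EFinP; exact: measurable_g.
rewrite (@past_integral _ _ _ P m mu v v_iid j (EFin \o g j)) //; last first.
  by move=> p; rewrite lee_fin.
apply: ge0_integral_mono => [w|w].
  by apply: integral_ge0 => u _; rewrite lee_fin.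
have [rw|rw] := pselect (ready j w); last first.
  rewrite integral0_eq ?lee_fin ?mulr_ge0 ?addr_ge0 ?mulr_ge0 ?(ltW delta_gt0) //.
  by move=> u _ /=; rewrite /g /= indicE memNset // mulr0 !mul0r.
have [[e [z [ez [Jz ezth]]]] nh] := rw.
have YE : Y j w = z by exact: (end_valP (@slice_fun j) ez).
have [[/= de zE] _] := ez; rewrite {}zE {z} in ez Jz ezth YE *.
have {}ezth : ((e + j%:R)%:E <= th)%E by move: ezth; rewrite /= y_time.
have nohit t' j' : dom w (t', j') -> (j' <= j)%N -> ((t' + j'%:R)%:E <= th)%E -> ~ O (y w t' j').
  move=> dt' j'j tth' Oy; apply: nh; exists (t', j'%:R, y w t' j').
  by split => //; exact: graph_uptoP.
have [s [ds se _ unb br]] := lineage de ezth nohit.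
have [WX _] : W (y w e j) * expR (k * e) <= K * (X (y w s j) * expR (k * s)) /\
    X (y w e j) * expR (k * e) <= K2 * (X (y w s j) * expR (k * s)).
  apply: y_flow => // t' st' t'e; apply: nohit => //.
    exact: (htd_convex (@y_dom w) ds de).
  by apply: le_trans ezth; rewrite lee_fin lerD.
pose a := xi j w * expR (k * j.+1%:R) * expR (k * e).
have a0 : 0 <= a by rewrite !mulr_ge0 ?expR_ge0 // (le_trans _ (xi_ge1 _ _)).
have gE u : (g j (w, u))%:E = (a%:E * (X (jump_map H (y w e j) u))%:E)%E.
  rewrite /g /= YE y_time // indicE mem_set // mulr1 -EFinM; congr EFin; rewrite /a; ring.
rewrite /=; under eq_integral do rewrite gE.
have mX : measurable_fun setT
    (fun u : borelType 'rV[R]_m => (X (jump_map H (y w e j) u))%:E).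
  apply/measurable_EFinP.
  apply: (@measurable_borel_continuous R m (fun u => X (jump_map H (y w e j) u))).
  apply: (@continuous_compf _ _ _ (fun u => (y w e j, u))
    (fun z : 'rV[R]_N * 'rV[R]_m => X (jump_map H z.1 z.2))) => //.
  by apply: continuous_pairf; [exact: continuous_cstf|exact: continuous_idf].
rewrite ge0_integralZl_EFin //; last by move=> u _; rewrite lee_fin.
apply: (le_trans (lee_wpmul2l _ (jump_mean Jz))); rewrite ?lee_fin //.
have -> : a * (c * W (y w e j)) = xi j w * (expR (k * j.+1%:R) * c) * (W (y w e j) * expR (k * e)).
  by rewrite /a; ring.
have xi0 : 0 <= xi j w by rewrite (le_trans _ (xi_ge1 _ _)).
apply: (le_trans (ler_wpM2l _ WX)).
  by rewrite !mulr_ge0 ?expR_ge0.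
have -> : xi j w * (expR (k * j.+1%:R) * c) * (K * (X (y w s j) * expR (k * s))) =
    (expR k * c * K) * (xi j w * (X (y w s j) * expR (k * (s + j%:R)))).
  by rewrite -natr1 !mulrDr !mulr1 !expRD; ring.
have NX : 0 <= X (y w s j) * expR (k * (s + j%:R)) by rewrite mulr_ge0 ?expR_ge0.
apply: (@le_trans _ _ (q * (xi j w * (X (y w s j) * expR (k * (s + j%:R)))))).
  by rewrite ler_wpM2r // mulr_ge0.
rewrite ler_wpM2l //; have [bw|bw] := pselect (branched j w).
  by rewrite xi_branched // mul1r; exact: br.
rewrite xi_unbranched // (le_trans (unb bw)) // lerDl mulr_ge0 //.
exact: ltW.
Qed.

Let rho_ge0 : 0 <= rho.
Proof. by apply: le_trans rho1; rewrite mulr_ge0 ?addr_ge0 // ltW. Qed.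

(** The recursion has two terms, so two consecutive bounds are proved together: [rho1] starts it and
    [rho2] propagates the ratio [rho]. *)
Let mean_Q j : (\int[P]_w (Q j w)%:E <= (M * X y0 * rho ^+ j)%:E)%E.
Proof.
have mQ i : measurable_fun setT (fun w => (Q i w)%:E) by apply/measurable_EFinP; exact: measurable_Q.
have MX : 0 <= M * X y0 by rewrite mulr_ge0 // (le_trans _ M_ge1).
have step i a b : (\int[P]_w (Q i w)%:E <= a%:E)%E -> (\int[P]_w (Q i.-1 w)%:E <= b%:E)%E ->
    (\int[P]_w (Q i.+1 w)%:E <= (q * (a + delta * b))%:E)%E.
  move=> Qa Qb; apply: (le_trans (mean_step i)).
  under eq_integral do rewrite EFinM EFinD EFinM.
  have mD : measurable_fun setT (fun w => delta%:E * (Q i.-1 w)%:E)%E.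
    exact: measurable_funeM.
  have dQ0 w : (0 <= delta%:E * (Q i.-1 w)%:E)%E.
    by rewrite mule_ge0 ?lee_fin ?(ltW delta_gt0).
  have mQD : measurable_fun setT (fun w => (Q i w)%:E + delta%:E * (Q i.-1 w)%:E)%E.
    exact: emeasurable_funD.
  rewrite ge0_integralZl_EFin //; last by move=> w _; apply: adde_ge0; [rewrite lee_fin|exact: dQ0].
  rewrite ge0_integralD //; last by move=> w _; rewrite lee_fin.
  rewrite ge0_integralZl_EFin ?(ltW delta_gt0) //; last by move=> w _; rewrite lee_fin.
  rewrite EFinM lee_wpmul2l ?lee_fin // EFinD EFinM leeD // lee_wpmul2l ?lee_fin ?(ltW delta_gt0) //.
suff : (\int[P]_w (Q j w)%:E <= (M * X y0 * rho ^+ j)%:E)%E /\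
  (\int[P]_w (Q j.+1 w)%:E <= (M * X y0 * rho ^+ j.+1)%:E)%E by case.
have Q0 : (\int[P]_w (Q 0 w)%:E <= (M * X y0)%:E)%E.
  by rewrite /Q integral_cst //= probability_setT mule1.
elim: j => [|j [IH1 IH2]].
  rewrite expr0 mulr1; split => //; apply: (le_trans (step 0%N _ _ Q0 Q0)).
  rewrite lee_fin expr1 (_ : _ * _ = M * X y0 * (q * (1 + delta))); last by ring.
  by rewrite ler_wpM2l.
split => //; apply: (le_trans (step j.+1 _ _ IH2 IH1)).
rewrite lee_fin (_ : _ * _ = M * X y0 * (q * (rho + delta)) * rho ^+ j); last by rewrite exprS; ring.
rewrite (_ : M * X y0 * rho ^+ j.+2 = M * X y0 * rho ^+ 2 * rho ^+ j); last by rewrite !exprS; ring.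
rewrite ler_wpM2r ?exprn_ge0 //.
by rewrite ler_wpM2l.
Qed.

(** The sum of all [Q i], rather than a supremum over times, is taken as majorant: it is measurable,
    dominates every slice at once, and its mean is bounded by a geometric series. [K2] covers the
    flow inside a slice and [1 + delta] the two terms given by [lineage]. *)
Lemma decay_majorant : exists B : Omega -> \bar R,
  [/\ measurable_fun setT B, forall w, (0 <= B w)%E,
     (\int[P]_w B w <= (K2 * (1 + delta) * (M * X y0 / (1 - rho)))%:E)%E
   & forall w t j, arc_dom (y w) (t, j) -> ((t + j%:R)%:E <= th)%E ->
     (forall t' j', arc_dom (y w) (t', j') -> ((t' + j'%:R)%:E <= th)%E -> ~ O (y w t' j')) ->
     ((X (y w t j) * expR (k * (t + j%:R)))%:E <= B w)%E].
Proof.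
have mQ i : measurable_fun setT (fun w => (Q i w)%:E) by apply/measurable_EFinP; exact: measurable_Q.
have Q0 i w : (0 <= (Q i w)%:E)%E by rewrite lee_fin.
have A0 : 0 <= K2 * (1 + delta).
  by rewrite mulr_ge0 ?addr_ge0 ?(ltW delta_gt0) // (le_trans _ K2_ge1).
have MX : 0 <= M * X y0 by rewrite mulr_ge0 // (le_trans _ M_ge1).
have mS : measurable_fun setT (fun w => \sum_(i <oo) (Q i w)%:E)%E.
  by apply: ge0_emeasurable_sum.
have S0 w : (0 <= \sum_(i <oo) (Q i w)%:E)%E by exact: nneseries_ge0.
exists (fun w => (K2 * (1 + delta))%:E * \sum_(i <oo) (Q i w)%:E)%E; split.
- exact: measurable_funeM.
- by move=> w; rewrite mule_ge0.
- rewrite ge0_integralZl_EFin // [X in (_ <= X)%E]EFinM.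
  rewrite lee_wpmul2l ?lee_fin // integral_nneseries //.
  apply: lime_le; first by apply: is_cvg_nneseries => i _ _; exact: integral_ge0.
  apply: nearW => n; apply: (@le_trans _ _ (\sum_(0 <= i < n) (M * X y0 * rho ^+ i)%:E)%E).
    by apply: lee_sum => i _; exact: mean_Q.
  rewrite sumEFin lee_fin -mulr_sumr ler_wpM2l //.
  have rho1' : 0 < 1 - rho by rewrite subr_gt0.
  rewrite -[leRHS]mul1r ler_pdivlMr // big_mkord mulrC.
  have := subrX1 rho n; rewrite -opprB -[rho - 1]opprB mulNr => /oppr_inj <-.
  by rewrite gerBl exprn_ge0.
- move=> w t j dt tth nohit.
  have [|s [ds st _ unb br]] := lineage dt tth.
    by move=> t' j' d' _; exact: nohit.
  have [_ Xt] : W (y w t j) * expR (k * t) <= K * (X (y w s j) * expR (k * s)) /\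
      X (y w t j) * expR (k * t) <= K2 * (X (y w s j) * expR (k * s)).
    apply: y_flow => // t' st' t't; apply: nohit => //.
      exact: (htd_convex (@y_dom w) ds dt).
    by apply: le_trans tth; rewrite lee_fin lerD.
  have NX : 0 <= X (y w s j) * expR (k * (s + j%:R)) by rewrite mulr_ge0 ?expR_ge0.
  have NQ : X (y w s j) * expR (k * (s + j%:R)) <= Q j w + delta * Q j.-1 w.
    have [/br //|bw] := pselect (branched j w).
    apply: (@le_trans _ _ (Q j w)); last by rewrite lerDl mulr_ge0 // ltW.
    by apply: le_trans (unb bw); rewrite ler_peMl.
  have QS i : ((Q i w)%:E <= \sum_(i <oo) (Q i w)%:E)%E.
    apply: le_trans (nneseries_lim_ge i.+1 _) => //.
    by rewrite big_nat_recr //= leeDr // sume_ge0.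
  apply: (@le_trans _ _ (K2 * (Q j w + delta * Q j.-1 w))%:E).
    rewrite lee_fin mulrDr expRD mulrA.
    apply: (@le_trans _ _ (K2 * (X (y w s j) * expR (k * s)) * expR (k * j%:R))).
      by rewrite ler_wpM2r ?expR_ge0.
    rewrite -mulrA ler_wpM2l ?(le_trans _ K2_ge1) //; apply: le_trans NQ.
    by rewrite -mulrA -expRD -mulrDr.
  rewrite !EFinM -muleA lee_wpmul2l ?lee_fin ?(le_trans _ K2_ge1) //.
  rewrite !EFinD ge0_muleDl ?lee_fin ?(ltW delta_gt0) // mul1e leeD // EFinM.
  by rewrite lee_wpmul2l ?lee_fin ?(ltW delta_gt0).
Qed.

End Branching.

End RandomSolutionDecay.

(** * Weighted integrals over a time window *)

Section WindowAverages.
Context {R : realType}.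
Notation mu := lebesgue_measure.

Lemma is_derive_comp_path (V W : normedModType R) (F : V -> W) (p : R -> V) (t : R) (p' : V) :
  is_derive t (1 : R) p p' -> differentiable F (p t) ->
  is_derive t (1 : R) (F \o p) ('d F (p t) p').
Proof.
move=> [dp <-] dF; have dp' : differentiable p t by exact/derivable1_diffP.
have dFp : differentiable (F \o p) t by exact: differentiable_comp.
apply: DeriveDef; first exact/derivable1_diffP.
by rewrite deriveE // diff_comp //= deriveE.
Qed.

Lemma derivable_oo_LR (F : R -> R) (a b : R) :
  (forall t, a <= t -> t <= b -> derivable F t 1) -> a <= b -> derivable_oo_LRcontinuous F a b.
Proof.
move=> dF ab; have cF t : a <= t -> t <= b -> {for t, continuous F}.
  by move=> at_ tb; apply: differentiable_continuous; apply/derivable1_diffP; exact: dF.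
split.
- by move=> t; rewrite in_itv /= => /andP[/ltW ? /ltW ?]; exact: dF.
- by apply: cvg_at_right_filter; apply: cF.
- by apply: cvg_at_left_filter; apply: cF.
Qed.

Lemma continuous_FTC2_Rint (G g : R -> R) (a b : R) : a <= b -> continuous g ->
  (forall t, a <= t -> t <= b -> is_derive t (1 : R) G (g t)) ->
  \int[mu]_(t in `[a, b]) g t = G b - G a.
Proof.
rewrite le_eqVlt => /predU1P[->|ab] cg dG.
  by rewrite set_itv1 Rintegral_set1 subrr.
rewrite /Rintegral (@continuous_FTC2 _ g G a b) //.
- exact: continuous_subspaceT.
- by apply: derivable_oo_LR => [t at_ tb|]; [have [] := dG t at_ tb|exact: ltW].
- move=> t; rewrite in_itv /= => /andP[/ltW at_ /ltW tb].
  by rewrite derive1E; have [] := dG t at_ tb.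
Qed.

Lemma is_derive_weight (L t : R) : is_derive t (1 : R) (fun q => 1 - q / L) (- L^-1).
Proof.
have -> : (fun q : R => 1 - q / L) = cst 1 - (L^-1 \*: id).
  by apply/funext => q /=; rewrite !fctE /= [in RHS]/GRing.scale /= mulrC.
have -> : - L^-1 = 0 - L^-1 *: (1 : R) by rewrite sub0r [_ *: _]mulr1.
exact: is_deriveB.
Qed.

(** The weight is 1 at 0 and vanishes at [L], so integration by parts leaves only the boundary term
    at 0: the derivative is traded for the mean over the window minus the present value. *)
Lemma weighted_parts (G g : R -> R) (L : R) : 0 < L ->
  {within `[0, L], continuous g} -> derivable_oo_LRcontinuous G 0 L ->
  {in `]0, L[, G^`()%classic =1 g} ->
  \int[mu]_(q in `[0, L]) ((1 - q / L) * g q) = L^-1 * \int[mu]_(q in `[0, L]) G q - G 0.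
Proof.
move=> L0 cg dG G'.
have cG := derivable_oo_LRcontinuous_within dG.
have iG : mu.-integrable `[0, L] (EFin \o G) by exact: continuous_integrable.
rewrite (@Rintegration_by_parts _ _ G (fun=> - L^-1) g) //.
- rewrite divff ?gt_eqF // subrr mul0r !mul0r subr0 mul1r.
  under [X in _ - X = _]eq_Rintegral do rewrite mulNr.
  under [X in _ - X = _]eq_Rintegral do rewrite -mulNr.
  by rewrite RintegralZl // mulNr opprK sub0r addrC.
- exact: continuous_subspaceT (@cst_continuous _ _ _).
- by apply: derivable_oo_LR; [move=> t _ _; have [] := is_derive_weight L t|exact: ltW].
- by move=> t _; rewrite derive1E; have [] := is_derive_weight L t.
Qed.

Lemma continuous_weight (L : R) : continuous (fun q : R => 1 - q / L).
Proof.
move=> t; apply: differentiable_continuous; apply/derivable1_diffP.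
by have [] := is_derive_weight L t.
Qed.

Lemma fine_lebesgue_itv (a b : R) : a <= b -> fine (mu (`[a, b]%classic : set R)) = b - a.
Proof.
rewrite lebesgue_measure_itv /= lte_fin => ab; case: ltP => //= ba.
by apply/esym/eqP; rewrite subr_eq0 eq_le ba.
Qed.

Lemma within_continuousM (f g : R -> R) (D : set R) : {within D, continuous f} ->
  {within D, continuous g} -> {within D, continuous (fun x => f x * g x)}.
Proof.
move=> /subspace_continuousP cf /subspace_continuousP cg.
by apply/subspace_continuousP => x Dx; apply: cvgM; [exact: cf|exact: cg].
Qed.

Lemma within_continuousB (f g : R -> R) (D : set R) : {within D, continuous f} ->
  {within D, continuous g} -> {within D, continuous (fun x => f x - g x)}.
Proof.
move=> /subspace_continuousP cf /subspace_continuousP cg.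
by apply/subspace_continuousP => x Dx; apply: cvgB; [exact: cf|exact: cg].
Qed.

Lemma within_continuous_cst (c : R) (D : set R) : {within D, continuous (fun _ : R => c)}.
Proof. exact: continuous_subspaceT (@cst_continuous _ _ _). Qed.

Lemma normr_Rintegral_le (h : R -> R) (a b B : R) : a <= b -> {within `[a, b], continuous h} ->
  (forall t, a <= t -> t <= b -> `|h t| <= B) -> `|\int[mu]_(t in `[a, b]) h t| <= (b - a) * B.
Proof.
move=> ab ch hB; have ih := continuous_integrable ch.
apply: (le_trans (le_normr_Rintegral _ ih)) => //.
apply: (@le_trans _ _ (\int[mu]_(t in `[a, b]) B)).
  apply: le_Rintegral => //.
  - apply: continuous_integrable => t; apply: continuous_comp; first exact: ch.
    exact: norm_continuous.
  - exact: continuous_integrable (continuous_subspaceT (@cst_continuous _ _ _)).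
  - by move=> t /=; rewrite in_itv /= => /andP[]; exact: hB.
by rewrite Rintegral_cst // fine_lebesgue_itv // mulrC.
Qed.

(** By [weighted_parts] the weighted integral is the average over [l] in [[0, L]] of the integrals
    of [g] over [[0, l]]. The averaging assumption bounds exactly these, whereas it says nothing
    about the size of [g] itself. *)
Lemma weighted_bound (g : R -> R) (L B : R) : 0 < L -> {within `[0, L], continuous g} ->
  (forall l, 0 <= l -> l <= L -> `|\int[mu]_(q in `[0, l]) g q| <= B) ->
  `|\int[mu]_(q in `[0, L]) ((1 - q / L) * g q)| <= B.
Proof.
move=> L0 cg gB; pose g' := g \o clamp 0 L.
have cg' : continuous g' by exact: continuous_comp_clamp (ltW L0) cg.
have gE q : q \in `[0, L] -> g q = g' q by move=> q0L; rewrite /g' /= clamp_id.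
have [G G'] := primitive_exists (-1) cg'.
have dG (t : R) : 0 <= t -> is_derive t (1 : R) G (g' t) by move=> t0; apply: G'; lra.
rewrite (_ : Rintegral _ _ _ = \int[mu]_(q in `[0, L]) ((1 - q / L) * g' q)); last first.
  by apply: eq_Rintegral => q; rewrite inE => q0L; rewrite gE.
have dG' : derivable_oo_LRcontinuous G 0 L.
  by apply: derivable_oo_LR => [t t0 _|]; [have [] := dG t t0|exact: ltW].
have cG := derivable_oo_LRcontinuous_within dG'.
rewrite (@weighted_parts G) //; last 2 first.
- exact: continuous_subspaceT.
- by move=> t /itvP t0L; rewrite derive1E; have [] := dG t; rewrite ?t0L.
have -> : L^-1 * \int[mu]_(q in `[0, L]) G q - G 0 =
    L^-1 * \int[mu]_(q in `[0, L]) (G q - G 0).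
  rewrite RintegralB //; last 2 first.
  - exact: continuous_integrable.
  - exact: continuous_integrable (continuous_subspaceT (@cst_continuous _ _ _)).
  rewrite Rintegral_cst // fine_lebesgue_itv ?(ltW L0) // subr0 mulrBr.
  by rewrite (mulrC (G 0)) mulrA mulVf ?gt_eqF // mul1r.
rewrite normrM ger0_norm ?invr_ge0 ?(ltW L0) // mulrC ler_pdivrMr // mulrC -[L in leRHS]subr0.
apply: normr_Rintegral_le; first exact: ltW.
  by apply: within_continuousB => //; exact: within_continuous_cst.
move=> l l0 lL; have <- := @continuous_FTC2_Rint G g' 0 l l0 cg' (fun t t0 _ => dG t t0).
rewrite (_ : Rintegral _ _ _ = \int[mu]_(q in `[0, l]) g q) ?gB //.
apply: eq_Rintegral => q; rewrite inE /= in_itv /= => /andP[q0 ql].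
by rewrite -gE // in_itv /= q0 (le_trans ql).
Qed.

Lemma Rintegral_shift (g : R -> R) (s l : R) : 0 <= l -> {within `[s, s + l], continuous g} ->
  \int[mu]_(q in `[0, l]) g (s + q) = \int[mu]_(t in `[s, s + l]) g t.
Proof.
move=> l0 cg; pose g' := g \o clamp s (s + l).
have sl : s <= s + l by rewrite lerDl.
have cg' : continuous g' by exact: continuous_comp_clamp sl cg.
have [G G'] := primitive_exists (s - 1) cg'.
transitivity (\int[mu]_(t in `[s, s + l]) g' t); last first.
  by apply: eq_Rintegral => t; rewrite inE => tsl; rewrite /g' /= clamp_id.
transitivity (\int[mu]_(q in `[0, l]) (g' \o shift s) q).
  apply: eq_Rintegral => q; rewrite inE /= in_itv /= => /andP[q0 ql].
  by rewrite /g' /= clamp_id addrC // in_itv /= lerDl q0 lerD2l.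
have G'_s (t : R) : s <= t -> is_derive t (1 : R) G (g' t) by move=> st; apply: G'; lra.
have -> := @continuous_FTC2_Rint G g' s (s + l) sl cg' (fun t st _ => G'_s t st).
suff -> : \int[mu]_(q in `[0, l]) (g' \o shift s) q = (G \o shift s) l - (G \o shift s) 0.
  by rewrite /= add0r (addrC l).
apply: continuous_FTC2_Rint => //.
- apply: (continuous_compf _ cg'); apply: continuous_addf; [exact: continuous_idf|exact: continuous_cstf].
- move=> t t0 _; have Gs : is_derive (shift s t) (1 : R) G (g' (shift s t)).
    by apply: G'; rewrite /=; lra.
  have [dG dGE] := Gs.
  have dG' : differentiable G (shift s t) by exact/derivable1_diffP.
  have := is_derive_comp_path (is_derive_shift t (1 : R) s) dG'.
  by rewrite -deriveE // dGE.
Qed.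

(** Here [B] is the q-derivative of [E], so the large multiple [c] of [B] can be integrated by parts
    after differentiating under the integral, with [K] as dominating constant. Only the mean of [E]
    and its value at [q = 0] keep the factor [c]. *)
Lemma window_derivative (E A B : R -> R -> R) (a b L c t0 K : R) :
  a < t0 -> t0 < b -> 0 < L ->
  (forall t q, a < t -> t < b -> 0 <= q -> q <= L ->
     is_derive t (1 : R) (E ^~ q) (A t q + c * B t q)) ->
  (forall t q, a < t -> t < b -> 0 <= q -> q <= L -> `|A t q + c * B t q| <= K) ->
  (forall t, a < t -> t < b -> {within `[0, L], continuous (E t)}) ->
  {within `[0, L], continuous (A t0)} -> {within `[0, L], continuous (B t0)} ->
  derivable_oo_LRcontinuous (E t0) 0 L -> {in `]0, L[, (E t0)^`()%classic =1 B t0} ->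
  is_derive t0 (1 : R) (fun t => \int[mu]_(q in `[0, L]) ((1 - q / L) * E t q))
    (\int[mu]_(q in `[0, L]) ((1 - q / L) * A t0 q) +
     c * (L^-1 * \int[mu]_(q in `[0, L]) E t0 q - E t0 0)).
Proof.
move=> at0 t0b L0 dE ABK cE cA cB dEt0 E'B.
have cw : {within `[0, L], continuous (fun q : R => 1 - q / L)}.
  exact: continuous_subspaceT (@continuous_weight L).
pose f t q := (1 - q / L) * E t q.
have cf t : a < t -> t < b -> {within `[0, L], continuous (f t)}.
  by move=> at_ tb; apply: within_continuousM; [exact: cw|exact: cE].
have df t q : a < t -> t < b -> 0 <= q -> q <= L ->
    is_derive t (1 : R) (f ^~ q) ((1 - q / L) * (A t q + c * B t q)).
  move=> at_ tb q0 qL; have := dE t q at_ tb q0 qL => dEt.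
  exact: (@is_deriveZ _ _ _ (E ^~ q) (1 - q / L)).
have in_ab t : `]a, b[%classic t -> a < t /\ t < b by rewrite /= in_itv /= => /andP.
have in_0L q : `[0, L]%classic q -> 0 <= q /\ q <= L by rewrite /= in_itv /= => /andP.
have t0ab : `]a, b[%classic t0 by rewrite /= in_itv /= at0.
have h1 t : `]a, b[%classic t -> mu.-integrable `[0, L] (EFin \o f t).
  by move=> /in_ab[? ?]; apply: continuous_integrable; exact: cf.
have h2 t q : `]a, b[%classic t -> `[0, L]%classic q -> derivable (f ^~ q) t 1.
  by move=> /in_ab[? ?] /in_0L[? ?]; have [] := df t q.
have K0 : 0 <= K by apply: le_trans (ABK t0 0 _ _ _ _) => //; exact: ltW.
have h3 t q : `]a, b[%classic t -> `[0, L]%classic q -> `|partial1of2 f t q| <= K.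
  move=> /in_ab[at_ tb] /in_0L[q0 qL]; rewrite partial1of2E.
  have [_ ->] := df t q at_ tb q0 qL; rewrite normrM -[leRHS]mul1r ler_pM //; last exact: ABK.
  rewrite ler_norml; apply/andP; split; last by rewrite gerBl divr_ge0 // ltW.
  by rewrite lerBrDl -lerBrDr; apply: (@le_trans _ _ 1); rewrite ?ler_pdivrMr ?mul1r //; lra.
have iK : mu.-integrable `[0, L] (EFin \o (fun=> K)).
  exact: continuous_integrable (continuous_subspaceT (@cst_continuous _ _ _)).
apply: is_derive_derive1.
  exact: (@derivable_under_integral _ _ _ mu f `[0, L] _ t0 a b t0ab h1 h2 (fun=> K)).
rewrite (@differentiation_under_integral _ _ _ mu f `[0, L] _ t0 a b t0ab h1 h2 (fun=> K)) //.
have cwA : {within `[0, L], continuous (fun q => (1 - q / L) * A t0 q)}.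
  by apply: within_continuousM.
have cwB : {within `[0, L], continuous (fun q => (1 - q / L) * B t0 q)}.
  by apply: within_continuousM.
have ccwB : {within `[0, L], continuous (fun q => c * ((1 - q / L) * B t0 q))}.
  by apply: within_continuousM => //; exact: within_continuous_cst.
rewrite -(@weighted_parts (E t0) (B t0)) // -RintegralZl //; last exact: continuous_integrable.
rewrite -RintegralD //; [|exact: continuous_integrable..].
apply: eq_Rintegral => q; rewrite inE => /in_0L[q0 qL].
by rewrite partial1of2E; have [_ ->] := df t0 q at0 t0b q0 qL; ring.
Qed.

Lemma closed_oo_cc (T : topologicalType) (h : R -> T) (S : set T) (a b : R) : a < b ->
  closed S -> {within `[a, b], continuous h} ->
  (forall s, a < s -> s < b -> S (h s)) -> forall t, a <= t -> t <= b -> S (h t).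
Proof.
move=> ab cS /subspace_continuousP ch hS t at_ tb; apply: cS => A.
have tab : `[a, b]%classic t by rewrite /= in_itv /= at_.
move=> /(ch t tab); rewrite /= /within /= => /nbhs_ballP[e /= e0 eA].
have [s [as_ sb ts]] : exists s, [/\ a < s, s < b & `|t - s| < e].
  have [ta|nta] := eqVneq t a.
    exists (a + Num.min (b - a) e / 2); rewrite ta.
    have h1 : 0 < Num.min (b - a) e by rewrite lt_min subr_gt0 ab.
    have h2 : Num.min (b - a) e <= b - a by rewrite ge_min lexx.
    have h3 : Num.min (b - a) e <= e by rewrite ge_min lexx orbT.
    split; [lra|lra|rewrite ltr_norml; apply/andP; split; lra].
  have [tb'|ntb] := eqVneq t b.
    exists (b - Num.min (b - a) e / 2); rewrite tb'.
    have h1 : 0 < Num.min (b - a) e by rewrite lt_min subr_gt0 ab.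
    have h2 : Num.min (b - a) e <= b - a by rewrite ge_min lexx.
    have h3 : Num.min (b - a) e <= e by rewrite ge_min lexx orbT.
    split; [lra|lra|rewrite ltr_norml; apply/andP; split; lra].
  exists t; rewrite subrr normr0; split => //; first by rewrite lt_neqAle eq_sym nta.
  by rewrite lt_neqAle ntb.
exists (h s); split; first exact: hS.
apply: eA; first by rewrite -ball_normE.
by rewrite /= in_itv /= !ltW.
Qed.

End WindowAverages.

(** * Chain rule and joint continuity of derivatives *)

Section ChainRule.
Context {R : realType}.

Lemma continuous_sumf (T : topologicalType) (W : normedModType R) k (a : 'I_k -> T -> W) :
  (forall j, continuous (a j)) -> continuous (fun z => \sum_j a j z).
Proof.
elim: k a => [|k IH] a ca.
  by under eq_fun do rewrite big_ord0; exact: continuous_cstf.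
by under eq_fun do rewrite big_ord_recr /=; apply: continuous_addf => //; apply: IH.
Qed.

Lemma is_derive_pair (V W : normedModType R) (a : R -> V) (b : R -> W) (t : R) a' b' :
  is_derive t (1 : R) a a' -> is_derive t (1 : R) b b' ->
  is_derive t (1 : R) (fun t => (a t, b t)) (a', b').
Proof.
move=> [da <-] [db <-].
have da' : differentiable a t by exact/derivable1_diffP.
have db' : differentiable b t by exact/derivable1_diffP.
apply: DeriveDef; first by apply/derivable1_diffP; exact: differentiable_pair.
rewrite deriveE; last exact: differentiable_pair.
by rewrite diff_pair //= !deriveE.
Qed.

Lemma is_derive_lin (V W : normedModType R) (f : {linear V -> W}) (a : R -> V) (t : R) a' :
  continuous f -> is_derive t (1 : R) a a' -> is_derive t (1 : R) (f \o a) (f a').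
Proof.
move=> cf da; have := is_derive_comp_path da (linear_differentiable (a t) cf).
by rewrite diff_lin.
Qed.

Lemma continuous_lsubmx k l : continuous (@lsubmx R 1 k l).
Proof. by move=> z; exact/differentiable_continuous/differentiable_lsubmx. Qed.

Lemma continuous_rsubmx k l : continuous (@rsubmx R 1 k l).
Proof. by move=> z; exact/differentiable_continuous/differentiable_rsubmx. Qed.

Lemma continuous_row_mx (T : topologicalType) k l (a : T -> 'rV[R]_k) (b : T -> 'rV[R]_l) :
  continuous a -> continuous b -> continuous (fun t => row_mx (a t) (b t)).
Proof.
move=> ca cb t; apply/cvgrPdist_le => e e0.
have /cvgrPdist_le/(_ _ e0) na := ca t; have /cvgrPdist_le/(_ _ e0) nb := cb t.
near=> s; rewrite opp_row_mx add_row_mx.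
rewrite [leLHS]/Num.norm /= mx_normrE; apply/bigmax_leP; split; first exact: ltW.
move=> [i j] _ /=; rewrite ord1 -(splitK j); case: (fintype.split j) => c /=.
  rewrite row_mxEl; apply: le_trans (coord_le_norm _ _ _) _.
  by near: s.
rewrite row_mxEr; apply: le_trans (coord_le_norm _ _ _) _.
by near: s.
Unshelve. all: by end_near. Qed.

Lemma is_derive_row_mx k l (a : R -> 'rV[R]_k) (b : R -> 'rV[R]_l) (t : R) a' b' :
  is_derive t (1 : R) a a' -> is_derive t (1 : R) b b' ->
  is_derive t (1 : R) (fun t => row_mx (a t) (b t)) (row_mx a' b').
Proof.
move=> /is_derive_coord da /is_derive_coord db; apply/is_derive_coord => i.
rewrite -(splitK i); case: (fintype.split i) => c /=.
  by rewrite row_mxEl; under eq_fun do rewrite row_mxEl.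
by rewrite row_mxEr; under eq_fun do rewrite row_mxEr.
Qed.

Lemma is_derive_const (V : normedModType R) (c : V) (t : R) :
  is_derive t (1 : R) (fun=> c) 0.
Proof. exact: is_derive_cst. Qed.

Lemma diff_gradient k (V : 'rV[R]_k -> R) (z v : 'rV[R]_k) : differentiable V z ->
  'd V z v = dotv (gradient V z) v.
Proof.
move=> dV; rewrite {1}(row_sum_delta v) linear_sum /dotv; apply: eq_bigr => i _.
by rewrite linearZ /= mxE deriveE // mulrC.
Qed.

Lemma coord_addZ k (A B : 'rV[R]_k) (c : R) i : (A + c *: B) 0 i = A 0 i + c * B 0 i.
Proof. by rewrite !mxE. Qed.

Section PairDecomposition.
Variables (n p : nat) (W : normedModType R).

Let T2 : normedModType R := ('rV[R]_n * 'rV[R]_p)%type.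
Let T4 : normedModType R := ('rV[R]_n * 'rV[R]_p * R * R)%type.

Let linear_rV k (V : normedModType R) (L : {linear V -> W}) (i : 'rV[R]_k -> V) :
  (forall a u v, i (a *: u + v) = a *: i u + i v) ->
  forall u, L (i u) = \sum_j u 0 j *: L (i (delta_mx 0 j)).
Proof.
move=> ilin u; have i0 : i 0 = 0.
  have := ilin 0 0 0; rewrite scaler0 addr0 scale0r add0r => i00.
  by have := ilin 1 0 0; rewrite scale1r addr0 scale1r -{1}(addr0 (i 0)) => /addrI.
suff h (s : seq 'I_k) : L (i (\sum_(j <- s) u 0 j *: delta_mx 0 j)) =
    \sum_(j <- s) u 0 j *: L (i (delta_mx 0 j)).
  by rewrite {1}(row_sum_delta u) h.
elim: s => [|j s IH]; first by rewrite !big_nil i0 linear0.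
by rewrite !big_cons ilin linearD linearZ /= IH.
Qed.

Let addp (V1 V2 : normedModType R) (a b : V1) (c d : V2) : (a, c) + (b, d) = (a + b, c + d).
Proof. by []. Qed.

Let scalep (V1 V2 : normedModType R) (k : R) (a : V1) (b : V2) :
  k *: (a, b) = (k *: a, k *: b).
Proof. by []. Qed.

Lemma linear_pair2 (L : {linear T2 -> W}) (w : T2) :
  L w = \sum_j w.1 0 j *: L (delta_mx 0 j, 0) + \sum_j w.2 0 j *: L (0, delta_mx 0 j).
Proof.
rewrite -(@linear_rV _ T2 L (fun u => (u, 0))); last first.
  by move=> a u v; rewrite scalep addp scaler0 addr0.
rewrite -(@linear_rV _ T2 L (fun u => (0, u))); last first.
  by move=> a u v; rewrite scalep addp scaler0 addr0.
by rewrite -linearD addp addr0 add0r; case: w.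
Qed.

Lemma linear_pair4 (L : {linear T4 -> W}) (w : T4) :
  L w = \sum_j w.1.1.1 0 j *: L (delta_mx 0 j, 0, 0, 0) +
        \sum_j w.1.1.2 0 j *: L (0, delta_mx 0 j, 0, 0) +
        w.1.2 *: L (0, 0, 1, 0) + w.2 *: L (0, 0, 0, 1).
Proof.
rewrite -(@linear_rV _ T4 L (fun u => (u, 0, 0, 0))); last first.
  by move=> a u v; rewrite !scalep !addp !scaler0 !addr0.
rewrite -(@linear_rV _ T4 L (fun u => (0, u, 0, 0))); last first.
  by move=> a u v; rewrite !scalep !addp !scaler0 !addr0.
rewrite -!linearZ -!linearD /= !scalep !addp !scaler0 !addr0 !add0r.
by rewrite ![_ *: (1 : R)]mulr1; case: w => [[[]]].
Qed.

Lemma linear_quad (L : {linear T4 -> W}) a b (c : R) :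
  L (a, b, c, 0) = L (a, b, 0, 0) + c *: L (0, 0, 1, 0).
Proof. by rewrite -linearZ -linearD !scalep addp !addp !scaler0 !addr0 add0r [_ *: (1 : R)]mulr1. Qed.

Variable Z : topologicalType.

Lemma C1_continuous_scale_diff (V : normedModType R) (U : set V) (F : V -> W) (P : Z -> V)
    (a : Z -> R) e : Ck_open 1 U F -> (forall z, U (P z)) -> continuous P ->
  continuous a -> continuous (fun z => a z *: 'd F (P z) e).
Proof.
move=> [dF cF] UP cP ca z; apply: cvgZ; first exact: ca.
rewrite (_ : (fun z => _) = (fun x => 'D_e F x) \o P); last first.
  by apply/funext => s /=; rewrite deriveE //; exact: dF.
rewrite -deriveE; last exact: dF.
by apply: continuous_comp; [exact: cP|exact: cF].
Qed.

(** [Ck_open] gives continuity of the derivative in each fixed direction. A moving direction is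
    decomposed over the finitely many basis vectors, with continuous coefficients. *)
Lemma C1_continuous_diff4 (U : set T4) (F : T4 -> W) (P w : Z -> T4) :
  Ck_open 1 U F -> (forall z, U (P z)) -> continuous P -> continuous w ->
  continuous (fun z => 'd F (P z) (w z)).
Proof.
move=> C1F UP cP cw; have cs := C1_continuous_scale_diff C1F UP cP.
rewrite (_ : (fun z => _) = fun z =>
    \sum_j (w z).1.1.1 0 j *: 'd F (P z) (delta_mx 0 j, 0, 0, 0) +
    \sum_j (w z).1.1.2 0 j *: 'd F (P z) (0, delta_mx 0 j, 0, 0) +
    (w z).1.2 *: 'd F (P z) (0, 0, 1, 0) + (w z).2 *: 'd F (P z) (0, 0, 0, 1)); last first.
  by apply/funext => z; exact: (linear_pair4 ('d F (P z)) (w z)).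
have c1 := continuous_fstf cw; have c11 := continuous_fstf c1.
apply: continuous_addf; first apply: continuous_addf; first apply: continuous_addf.
- apply: continuous_sumf => j; apply: cs.
  apply: (@continuous_compf _ _ _ (fun z => (w z).1.1.1) (fun u : 'rV[R]_n => u 0 j)).
    exact: continuous_fstf c11.
  exact: coord_continuous.
- apply: continuous_sumf => j; apply: cs.
  apply: (@continuous_compf _ _ _ (fun z => (w z).1.1.2) (fun u : 'rV[R]_p => u 0 j)).
    exact: continuous_sndf c11.
  exact: coord_continuous.
- by apply: cs; exact: continuous_sndf c1.
- by apply: cs; exact: continuous_sndf cw.
Qed.

Lemma C1_continuous_diff2 (U : set T2) (F : T2 -> W) (P w : Z -> T2) :
  Ck_open 1 U F -> (forall z, U (P z)) -> continuous P -> continuous w ->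
  continuous (fun z => 'd F (P z) (w z)).
Proof.
move=> C1F UP cP cw; have cs := C1_continuous_scale_diff C1F UP cP.
rewrite (_ : (fun z => _) = fun z =>
    \sum_j (w z).1 0 j *: 'd F (P z) (delta_mx 0 j, 0) +
    \sum_j (w z).2 0 j *: 'd F (P z) (0, delta_mx 0 j)); last first.
  by apply/funext => z; exact: (linear_pair2 ('d F (P z)) (w z)).
apply: continuous_addf.
- apply: continuous_sumf => j; apply: cs.
  apply: (@continuous_compf _ _ _ (fun z => (w z).1) (fun u : 'rV[R]_n => u 0 j)).
    exact: continuous_fstf cw.
  exact: coord_continuous.
- apply: continuous_sumf => j; apply: cs.
  apply: (@continuous_compf _ _ _ (fun z => (w z).2) (fun u : 'rV[R]_p => u 0 j)).
    exact: continuous_sndf cw.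
  exact: coord_continuous.
Qed.

End PairDecomposition.

End ChainRule.

(** * Derivative of the window integral of the deviation along a flow *)

Section WindowDrift.
Context {R : realType}.
Notation mu := lebesgue_measure.
Variables n p : nat.
Let T2 : normedModType R := ('rV[R]_n * 'rV[R]_p)%type.
Let T4 : normedModType R := ('rV[R]_n * 'rV[R]_p * R * R)%type.
Variables (U : set T4) (F : T4 -> 'rV[R]_n) (G : T2 -> 'rV[R]_n).
Hypotheses (C1F : Ck_open 1 U F) (C1G : Ck_open 1 setT G).
Variables (x xd : R -> 'rV[R]_n) (r rd : R -> 'rV[R]_p) (tau : R -> R) (a b c : R).
Hypotheses (cx : continuous x) (cxd : continuous xd) (cr : continuous r) (crd : continuous rd)
  (ctau : continuous tau).
Hypothesis U_path : forall t q, 0 <= q -> U (x t, r t, tau t + q, 0).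
Hypothesis dx : forall t, a < t -> t < b -> is_derive t (1 : R) x (xd t).
Hypothesis dr : forall t, a < t -> t < b -> is_derive t (1 : R) r (rd t).
Hypothesis dtau : forall t, a < t -> t < b -> is_derive t (1 : R) tau c.

Lemma compact_rect_bound (h : R * R -> R) (a0 b0 a1 b1 : R) : continuous h ->
  exists K, forall t q, a0 <= t -> t <= b0 -> a1 <= q -> q <= b1 -> `|h (t, q)| <= K.
Proof.
move=> ch.
have cK : compact (`[a0, b0]%classic `*` `[a1, b1]%classic : set (R * R)%type).
  by apply: compact_setX; exact: segment_compact.
have [K [_ HK]] := compact_bounded (continuous_compact (continuous_subspaceT ch) cK).
exists (K + 1) => t q at_ tb aq qb; apply: HK; first by rewrite ltrDl.
by exists (t, q) => //; split; rewrite /= in_itv /= ?at_ ?aq.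
Qed.

Definition path_deviation i t q : R := F (x t, r t, tau t + q, 0) 0 i - G (x t, r t) 0 i.
Definition diff_coord i (P w : T4) : R := 'd F P w 0 i.
Definition diff_coord2 i (Q u : T2) : R := 'd G Q u 0 i.
(** The t-derivative of the deviation has a slow part, through [x] and [r], and [c] times a fast
    part, through [tau]. As [tau] and [q] enter through their sum, the fast part is also the
    q-derivative. *)
Definition slow_derivative i t q : R :=
  diff_coord i (x t, r t, tau t + q, 0) (xd t, rd t, 0, 0) - diff_coord2 i (x t, r t) (xd t, rd t).
Definition fast_derivative i t q : R := diff_coord i (x t, r t, tau t + q, 0) (0, 0, 1, 0).

Lemma diff_coord_quad i P a' b' (c' : R) :
  diff_coord i P (a', b', c', 0) = diff_coord i P (a', b', 0, 0) + c' * diff_coord i P (0, 0, 1, 0).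
Proof. by rewrite /diff_coord linear_quad coord_addZ. Qed.

Lemma is_derive_diff_coord i (y : R -> T4) (t : R) y' : is_derive t (1 : R) y y' -> U (y t) ->
  is_derive t (1 : R) (fun t => F (y t) 0 i) (diff_coord i (y t) y').
Proof.
move=> dy Uy; have [dF _] := C1F.
by have := is_derive_comp_path dy (dF _ Uy) => /is_derive_coord /(_ i).
Qed.

Lemma is_derive_diff_coord2 i (y : R -> T2) (t : R) y' : is_derive t (1 : R) y y' ->
  is_derive t (1 : R) (fun t => G (y t) 0 i) (diff_coord2 i (y t) y').
Proof.
move=> dy; have [dG _] := C1G.
by have := is_derive_comp_path dy (dG _ I) => /is_derive_coord /(_ i).
Qed.

Lemma window_drift i t0 L : a < t0 -> t0 < b -> 0 < L ->
  [/\ {within `[0, L], continuous (path_deviation i t0)},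
      {within `[0, L], continuous (slow_derivative i t0)} &
  is_derive t0 (1 : R)
    (fun t => \int[mu]_(q in `[0, L]) ((1 - q / L) * path_deviation i t q))
    (\int[mu]_(q in `[0, L]) ((1 - q / L) * slow_derivative i t0 q) +
     c * (L^-1 * \int[mu]_(q in `[0, L]) path_deviation i t0 q - path_deviation i t0 0))].
Proof.
move=> at0 t0b L0.
pose Z := (R * R)%type.
(* Clamping [q] keeps the point in [U], which is known to contain the path only for nonnegative [q],
   and makes everything continuous on the whole plane. *)
pose Pz (z : Z) : T4 := (x z.1, r z.1, tau z.1 + clamp 0 L z.2, 0).
pose P2 (z : Z) : T2 := (x z.1, r z.1).
have cfs : continuous (fun z : Z => z.1) by apply: continuous_fstf; exact: continuous_idf.
have csn : continuous (fun z : Z => z.2) by apply: continuous_sndf; exact: continuous_idf.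
have cx1 := continuous_compf cfs cx; have cr1 := continuous_compf cfs cr.
have cxd1 := continuous_compf cfs cxd; have crd1 := continuous_compf cfs crd.
have ctau1 := continuous_compf cfs ctau.
have ccl := continuous_compf csn (@continuous_clamp R 0 L).
have c0 (V : normedModType R) (v : V) : continuous (fun _ : Z => v) by exact: continuous_cstf.
have cP2 : continuous P2 by exact: continuous_pairf.
have cP : continuous Pz.
  apply: continuous_pairf; last exact: c0.
  by apply: continuous_pairf => //; exact: continuous_addf.
have UP z : U (Pz z).
  by apply: U_path; have := clamp_itv z.2 (ltW L0); rewrite in_itv /= => /andP[].
have ci (h : Z -> 'rV[R]_n) : continuous h -> continuous (fun z => h z 0 i).
  by move=> ch; apply: (continuous_compf ch (g := fun u : 'rV[R]_n => u 0 i)); exact: coord_continuous.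
have [dF _] := C1F; have [dG _] := C1G.
have cFP : continuous (F \o Pz).
  by move=> z; apply: continuous_comp; [exact: cP|apply: differentiable_continuous; exact: dF].
have cGP : continuous (G \o P2).
  by move=> z; apply: continuous_comp; [exact: cP2|apply: differentiable_continuous; exact: dG].
have cE : continuous (fun z => (F \o Pz) z 0 i - (G \o P2) z 0 i).
  by apply: continuous_subf; exact: ci.
have cA : continuous (fun z => diff_coord i (Pz z) (xd z.1, rd z.1, 0, 0) -
    diff_coord2 i (P2 z) (xd z.1, rd z.1)).
  rewrite /diff_coord /diff_coord2; apply: continuous_subf; apply: ci.
    apply: (C1_continuous_diff4 C1F UP cP); apply: continuous_pairf; last exact: c0.
    by apply: continuous_pairf; [exact: continuous_pairf|exact: c0].
  by apply: (C1_continuous_diff2 C1G _ cP2); last exact: continuous_pairf.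
have cB : continuous (fun z => diff_coord i (Pz z) (0, 0, 1, 0)).
  by rewrite /diff_coord; apply: ci; apply: (C1_continuous_diff4 C1F UP cP); exact: (c0 T4).
have inL q : q \in (`[0, L]%classic : set R) -> clamp 0 L q = q.
  by rewrite inE => qL; rewrite clamp_id.
have PzE t q : q \in (`[0, L]%classic : set R) -> Pz (t, q) = (x t, r t, tau t + q, 0).
  by move=> /inL qL; rewrite /Pz /= qL.
have cst2 (h : Z -> R) t : continuous h -> continuous (fun q => h (t, q)).
  move=> ch; apply: (continuous_compf _ ch); apply: continuous_pairf.
    exact: continuous_cstf.
  exact: continuous_idf.
have cEt t : {within `[0, L], continuous (path_deviation i t)}.
  apply: (subspace_eq_continuous (f := fun q => (F \o Pz) (t, q) 0 i - (G \o P2) (t, q) 0 i)).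
    by move=> q qL; rewrite /= (PzE t q qL).
  exact: continuous_subspaceT (cst2 _ t cE).
have cAt t : {within `[0, L], continuous (slow_derivative i t)}.
  apply: (subspace_eq_continuous (f := fun q => diff_coord i (Pz (t, q)) (xd t, rd t, 0, 0) -
                               diff_coord2 i (P2 (t, q)) (xd t, rd t))).
    by move=> q qL; rewrite /= (PzE t q qL).
  exact: continuous_subspaceT (cst2 _ t cA).
have cBt t : {within `[0, L], continuous (fast_derivative i t)}.
  apply: (subspace_eq_continuous (f := fun q => diff_coord i (Pz (t, q)) (0, 0, 1, 0))).
    by move=> q qL; rewrite /= (PzE t q qL).
  exact: continuous_subspaceT (cst2 _ t cB).
split=> //.
have [K1 hK1] := compact_rect_bound a b 0 L cA; have [K2 hK2] := compact_rect_bound a b 0 L cB.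
have dE t q : a < t -> t < b -> 0 <= q -> q <= L ->
    is_derive t (1 : R) (path_deviation i ^~ q) (slow_derivative i t q + c * fast_derivative i t q).
  move=> at_ tb q0 qL.
  have dxt := dx at_ tb; have drt := dr at_ tb; have dtt := dtau at_ tb.
  have dP : is_derive t (1 : R) (fun t => (x t, r t, tau t + q, 0 : R)) (xd t, rd t, c, 0).
    have dtq : is_derive t (1 : R) (fun t => tau t + q) c.
      by have := is_deriveD dtt (is_derive_const q t); rewrite addr0.
    exact: (is_derive_pair (is_derive_pair (is_derive_pair dxt drt) dtq) (is_derive_const (0 : R) t)).
  have d1 := is_derive_diff_coord i dP (U_path t q0).
  have d2 := is_derive_diff_coord2 i (is_derive_pair dxt drt).
  by apply: (is_derive_eq (is_deriveB d1 d2)); rewrite diff_coord_quad addrAC.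
have dq (q : R) : 0 <= q ->
    is_derive q (1 : R) (path_deviation i t0) (fast_derivative i t0 q).
  move=> q0; have dtq : is_derive q (1 : R) (fun q => tau t0 + q) 1.
    by have := is_deriveD (is_derive_const (tau t0) q) (@is_derive_id _ R q 1); rewrite add0r.
  have dP := is_derive_pair (is_derive_pair (is_derive_pair (is_derive_const (x t0) q)
        (is_derive_const (r t0) q)) dtq) (is_derive_const (0 : R) q).
  have d1 := is_derive_diff_coord i dP (U_path t0 q0).
  by apply: (is_derive_eq (is_deriveB d1 (is_derive_const (G (x t0, r t0) 0 i) q))); rewrite subr0.
apply: (@window_derivative _ (path_deviation i) (slow_derivative i) (fast_derivative i) a b L c t0
   (K1 + `|c| * K2)) => //.
- move=> t q at_ tb q0 qL; apply: le_trans (ler_normD _ _) _; apply: lerD.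
    have := hK1 t q (ltW at_) (ltW tb) q0 qL; rewrite PzE ?inE /= ?in_itv /= ?q0 //; exact.
  rewrite normrM; apply: ler_wpM2l => //.
  have := hK2 t q (ltW at_) (ltW tb) q0 qL; rewrite PzE ?inE /= ?in_itv /= ?q0 //; exact.
- by apply: derivable_oo_LR; [move=> q q0 _; have [] := dq q q0|exact: ltW].
- move=> q /itvP qL; rewrite derive1E; have [] := dq q; rewrite ?qL //.
Qed.

End WindowDrift.

(** * Bounds on integrals of the deviation and of its Jacobian *)

Section DeviationBounds.
Context {R : realType}.
Notation mu := lebesgue_measure.
Variables n p : nat.
Let T2 : normedModType R := ('rV[R]_n * 'rV[R]_p)%type.
Let T4 : normedModType R := ('rV[R]_n * 'rV[R]_p * R * R)%type.
Variables (f : 'rV[R]_n -> 'rV[R]_p -> R -> R -> 'rV[R]_n) (fave : 'rV[R]_n -> 'rV[R]_p -> 'rV[R]_n).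
Variables (U : set T4) (F : T4 -> 'rV[R]_n).
Let G : T2 -> 'rV[R]_n := fun q => fave q.1 q.2.
Hypotheses (C1F : Ck_open 1 U F) (C1G : Ck_open 1 setT G).
Hypothesis U_nonneg : forall x r (s e : R), 0 <= s -> 0 <= e -> U (x, r, s, e).
Hypothesis fF : forall x r (s e : R), 0 <= s -> 0 <= e -> f x r s e = F (x, r, s, e).

Lemma deviationE z s : 0 <= s ->
  deviation f fave z s = F (lsubmx z, rsubmx z, s, 0) - G (lsubmx z, rsubmx z).
Proof. by move=> s0; rewrite /deviation fF. Qed.

Lemma differentiable_deviation z s : 0 <= s ->
  differentiable (fun z : 'rV[R]_(n + p) => deviation f fave z s) z.
Proof.
move=> s0; have [dF _] := C1F; have [dG _] := C1G.
rewrite (_ : (fun z => _) = (F \o (fun z : 'rV[R]_(n + p) => (lsubmx z, rsubmx z, s, 0 : R))) -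
    (G \o (fun z : 'rV[R]_(n + p) => (lsubmx z, rsubmx z)))); last first.
  by apply/funext => y; rewrite deviationE.
have dl := differentiable_lsubmx z; have dr := differentiable_rsubmx z.
have d2 := differentiable_pair dl dr.
apply: differentiableB; apply: differentiable_comp => //; last exact: dG.
  apply: differentiable_pair; last exact: differentiable_cst.
  by apply: differentiable_pair; last exact: differentiable_cst.
by apply: dF; exact: U_nonneg.
Qed.

Lemma is_derive_line k (z v : 'rV[R]_k) (t0 : R) :
  is_derive t0 (1 : R) (fun t : R => z + t *: v) v.
Proof.
apply/is_derive_coord => i.
have -> : (fun t : R => (z + t *: v) 0 i) = cst (z 0 i) + (v 0 i \*: id).
  by apply/funext => t; rewrite coord_addZ mulrC.
suff : is_derive t0 (1 : R) (cst (z 0 i) + (v 0 i \*: id)) (0 + v 0 i *: (1 : R)).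
  by rewrite add0r [_ *: _]mulr1.
exact: is_deriveD.
Qed.

Lemma is_derive_unique (h1 h2 : R -> R) (t l1 l2 : R) : h1 =1 h2 ->
  is_derive t (1 : R) h1 l1 -> is_derive t (1 : R) h2 l2 -> l1 = l2.
Proof. by move=> /funext -> [_ <-] [_ <-]. Qed.

Lemma coord_subE k (A B : 'rV[R]_k) i : (A - B) 0 i = A 0 i - B 0 i.
Proof. by rewrite !mxE. Qed.

(** Both sides are the derivative at 0 of the deviation along the line through [row_mx x r] with
    direction [row_mx a b], once on stacked vectors and once on pairs. *)
Lemma row_mul_jacobian i x r a b s : 0 <= s ->
  (row_mx a b *m 'J (fun z => deviation f fave z s) (row_mx x r)) 0 i =
  diff_coord F i (x, r, s, 0) (a, b, 0, 0) - diff_coord2 G i (x, r) (a, b).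
Proof.
move=> s0; rewrite /jacobian mul_rV_lin1.
pose y t := row_mx x r + t *: row_mx a b.
have y0 : y 0 = row_mx x r by rewrite /y scale0r addr0.
have d1 := is_derive_comp_path (is_derive_line (row_mx x r) (row_mx a b) 0).
have {d1} := d1 _ _ (differentiable_deviation _ s0) => /is_derive_coord /(_ i).
rewrite scale0r addr0 => d1.
have dx := is_derive_line x a 0; have dr := is_derive_line r b 0.
have dP := is_derive_pair (is_derive_pair (is_derive_pair dx dr)
  (is_derive_const s (0 : R))) (is_derive_const (0 : R) (0 : R)).
have UP : U (x + 0 *: a, r + 0 *: b, s, 0) by exact: U_nonneg.
have d2 := is_deriveB (is_derive_diff_coord C1F i dP UP)
  (is_derive_diff_coord2 C1G i (is_derive_pair dx dr)).
rewrite !scale0r !addr0 in d2.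
apply: (is_derive_unique _ d1 d2) => t /=; rewrite deviationE //.
rewrite scale_row_mx add_row_mx row_mxKl row_mxKr; exact: coord_subE.
Qed.

Lemma frozen_diff_coord i x r b s : 0 <= s ->
  b *m 'J (fun r' => f x r' s 0) r = 0 -> diff_coord F i (x, r, s, 0) (0, b, 0, 0) = 0.
Proof.
move=> s0; rewrite /jacobian mul_rV_lin1 => d0.
have [dF _] := C1F.
have fE : (fun r' => f x r' s 0) = F \o (fun r' => (x, r', s, 0 : R)).
  by apply/funext => r'; rewrite fF.
have df : differentiable (fun r' => f x r' s 0) r.
  rewrite fE; apply: differentiable_comp; last by apply: dF; exact: U_nonneg.
  apply: differentiable_pair; last exact: differentiable_cst.
  apply: differentiable_pair; last exact: differentiable_cst.
  by apply: differentiable_pair; [exact: differentiable_cst|exact: ex_diff].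
have dr := is_derive_line r b 0.
have := is_derive_comp_path dr; move=> /(_ _ (fun r' => f x r' s 0)).
rewrite scale0r addr0 => /(_ df); rewrite d0 => /is_derive_coord /(_ i); rewrite mxE => d1.
have dP := is_derive_pair (is_derive_pair (is_derive_pair (is_derive_const x (0 : R)) dr)
  (is_derive_const s (0 : R))) (is_derive_const (0 : R) (0 : R)).
have UP : U (x, r + 0 *: b, s, 0) by exact: U_nonneg.
have d2 := is_derive_diff_coord C1F i dP UP.
rewrite scale0r addr0 in d2.
by apply: (is_derive_unique _ d2 d1) => t /=; rewrite fF.
Qed.

Lemma continuous_coord_path i (x : 'rV[R]_n) (r : 'rV[R]_p) :
  continuous (fun s : R => F (x, r, Num.max 0 s, 0) 0 i).
Proof.
have [dF _] := C1F.
apply: (continuous_compf (g := fun u : 'rV[R]_n => u 0 i)); last exact: coord_continuous.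
move=> s; apply: (continuous_comp (f := fun s : R => (x, r, Num.max 0 s, 0 : R))).
  apply: continuous_pairf; last exact: continuous_cstf.
  apply: continuous_pairf; first exact: continuous_cstf.
  by move=> t; apply: continuous_max; [exact: cst_continuous|exact: cvg_id].
by apply: differentiable_continuous; apply: dF; apply: U_nonneg => //; rewrite le_max lexx.
Qed.

Lemma continuous_diff_coord_path i (x : 'rV[R]_n) (r : 'rV[R]_p) a b :
  continuous (fun s : R => diff_coord F i (x, r, Num.max 0 s, 0) (a, b, 0, 0)).
Proof.
apply: (continuous_compf (g := fun u : 'rV[R]_n => u 0 i)); last exact: coord_continuous.
apply: (C1_continuous_diff4 C1F).
- by move=> s; apply: U_nonneg => //; rewrite le_max lexx.
- apply: continuous_pairf; last exact: continuous_cstf.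
  apply: continuous_pairf; first exact: continuous_cstf.
  by move=> t; apply: continuous_max; [exact: cst_continuous|exact: cvg_id].
- exact: continuous_cstf.
Qed.

Lemma within_diff_coord i (x : 'rV[R]_n) (r : 'rV[R]_p) a b (tau l : R) : 0 <= tau ->
  {within `[tau, l], continuous (fun s => diff_coord F i (x, r, s, 0) (a, b, 0, 0) -
     diff_coord2 G i (x, r) (a, b))}.
Proof.
move=> tau0; apply: within_continuousB; last exact: within_continuous_cst.
apply: (subspace_eq_continuous
  (f := fun s : R => diff_coord F i (x, r, Num.max 0 s, 0) (a, b, 0, 0))).
  move=> s; rewrite inE /= in_itv /= => /andP[ts _]; rewrite max_r //; exact: le_trans ts.
by apply: continuous_subspaceT; exact: continuous_diff_coord_path.
Qed.

Lemma within_deviation i (x : 'rV[R]_n) (r : 'rV[R]_p) (tau l : R) : 0 <= tau ->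
  {within `[tau, l], continuous (fun s => F (x, r, s, 0) 0 i - G (x, r) 0 i)}.
Proof.
move=> tau0; apply: within_continuousB; last exact: within_continuous_cst.
apply: (subspace_eq_continuous (f := fun s : R => F (x, r, Num.max 0 s, 0) 0 i)).
  move=> s; rewrite inE /= in_itv /= => /andP[ts _]; rewrite max_r //; exact: le_trans ts.
by apply: continuous_subspaceT; exact: continuous_coord_path.
Qed.

Lemma within_continuousZ (c : R) (h : R -> R) (S : set R) :
  {within S, continuous h} -> {within S, continuous (fun q => c * h q)}.
Proof. by move=> ch; apply: within_continuousM => //; exact: within_continuous_cst. Qed.

Lemma Rintegral_lincomb k (c : 'I_k -> R) (h : 'I_k -> R -> R) (a b : R) :
  (forall j, {within `[a, b], continuous (h j)}) ->
  {within `[a, b], continuous (fun q => \sum_j c j * h j q)} /\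
  \int[mu]_(q in `[a, b]) (\sum_j c j * h j q) = \sum_j c j * \int[mu]_(q in `[a, b]) h j q.
Proof.
elim: k c h => [|k IH] c h ch.
  split.
    rewrite (_ : (fun q => _) = (fun=> 0)); first exact: within_continuous_cst.
    by apply/funext => q; rewrite big_ord0.
  rewrite big_ord0; under eq_Rintegral do rewrite big_ord0.
  by rewrite Rintegral_cst // mul0r.
have [cs IHs] := IH (fun j => c (widen_ord (leqnSn k) j)) (fun j => h (widen_ord (leqnSn k) j))
  (fun j => ch _).
have cl := within_continuousZ (c := c ord_max) (ch ord_max).
split.
  rewrite (_ : (fun q => _) = (fun q => \sum_(j < k) c (widen_ord (leqnSn k) j) *
    h (widen_ord (leqnSn k) j) q + c ord_max * h ord_max q)); last first.
    by apply/funext => q; rewrite big_ord_recr.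
  by move=> q; apply: cvgD; [exact: cs|exact: cl].
under eq_Rintegral do rewrite big_ord_recr /=.
rewrite RintegralD //; [|exact: continuous_integrable..].
rewrite IHs RintegralZl //; last exact: continuous_integrable.
by rewrite big_ord_recr.
Qed.

Variables (K : set 'rV[R]_p) (gamma : R -> R).
Hypothesis dev_avg : forall x r (tau T : R), K r -> 0 <= tau -> 0 < T ->
  enorm (T^-1 *: mxint tau (tau + T) (deviation f fave (row_mx x r))) <= gamma T * enorm x /\
  opnorm (T^-1 *: mxint tau (tau + T)
    (fun s => 'J (fun z => deviation f fave z s) (row_mx x r))) <= gamma T.

Let avg_bound (l m B : R) : 0 < l -> `|l^-1 * m| <= B -> `|m| <= l * B.
Proof.
move=> l0; rewrite normrM ger0_norm ?invr_ge0 ?(ltW l0) // => mB.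
by rewrite -ler_pdivrMl // mulrC.
Qed.

Lemma deviation_integral_le i x r (tau l : R) : K r -> 0 <= tau -> 0 < l ->
  `|\int[mu]_(q in `[0, l]) (F (x, r, tau + q, 0) 0 i - G (x, r) 0 i)|
    <= l * (gamma l * enorm x).
Proof.
move=> Kr tau0 l0; have [h _] := dev_avg x Kr tau0 l0.
rewrite (Rintegral_shift (ltW l0) (@within_deviation i x r tau (tau + l) tau0)).
apply: avg_bound => //; apply: le_trans h; apply: le_trans (normr_coord_le _ i).
rewrite !mxE; set A := Rintegral _ _ _; set B := Rintegral _ _ _; suff -> : A = B by [].
apply: eq_Rintegral => s; rewrite inE /= in_itv /= => /andP[ts _].
by rewrite deviationE ?(le_trans tau0) // row_mxKl row_mxKr !mxE.
Qed.

(** The direction does not depend on time, so it leaves the integral coordinate by coordinate, and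
    each entry of the averaged Jacobian is below its operator norm. *)
Lemma jacobian_integral_le i x r a b (tau l : R) : K r -> 0 <= tau -> 0 < l ->
  `|\int[mu]_(q in `[0, l]) (diff_coord F i (x, r, tau + q, 0) (a, b, 0, 0) -
      diff_coord2 G i (x, r) (a, b))|
    <= l * (gamma l * \sum_j `|row_mx a b 0 j|).
Proof.
move=> Kr tau0 l0; have [_ h] := dev_avg x Kr tau0 l0.
rewrite (Rintegral_shift (ltW l0) (@within_diff_coord i x r a b tau (tau + l) tau0)).
pose J s := 'J (fun z => deviation f fave z s) (row_mx x r).
have cJ j : {within `[tau, tau + l], continuous (fun s => J s j i)}.
  pose e : 'rV[R]_(n + p) := delta_mx 0 j.
  apply: (subspace_eq_continuous
    (f := fun s => diff_coord F i (x, r, s, 0) (lsubmx e, rsubmx e, 0, 0) -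
     diff_coord2 G i (x, r) (lsubmx e, rsubmx e))).
    move=> s; rewrite inE /= in_itv /= => /andP[ts _].
    by rewrite -row_mul_jacobian ?(le_trans tau0) // hsubmxK -rowE mxE.
  exact: within_diff_coord.
rewrite (_ : Rintegral _ _ _ = \int[mu]_(s in `[tau, tau + l]) (\sum_j row_mx a b 0 j * J s j i)); last first.
  apply: eq_Rintegral => s; rewrite inE /= in_itv /= => /andP[ts _].
  by rewrite -row_mul_jacobian ?(le_trans tau0) // mxE.
rewrite (Rintegral_lincomb _ cJ).2 mulrA mulr_sumr.
apply: le_trans (ler_norm_sum _ _ _) _; apply: ler_sum => j _.
rewrite normrM mulrC; apply: ler_wpM2r => //; apply: avg_bound => //; apply: le_trans h.
by apply: le_trans (coord_le_opnorm _ j i); rewrite !mxE.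
Qed.

End DeviationBounds.

(** * Decay of the Lyapunov function under a near-identity change of variable *)

Section LyapunovDecay.
Context {R : realType}.

Lemma within_continuous_is_derive (h h' : R -> R) (s t : R) :
  (forall u, s <= u -> u <= t -> is_derive u (1 : R) h (h' u)) ->
  {within `[s, t], continuous h}.
Proof.
move=> dh; apply: continuous_in_subspaceT => u; rewrite inE /= in_itv /= => /andP[su ut].
apply: differentiable_continuous; apply/derivable1_diffP.
by have [] := dh u su ut.
Qed.

Lemma is_derive_MVT (h h' : R -> R) (s t : R) : s <= t ->
  (forall u, s <= u -> u <= t -> is_derive u (1 : R) h (h' u)) ->
  exists u, [/\ s <= u, u <= t & h t - h s = h' u * (t - s)].
Proof.
move=> st dh.
have [|u] := @MVT_segment _ h h' s t st _ (within_continuous_is_derive dh).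
  by move=> u; rewrite in_itv /= => /andP[su ut]; apply: dh; exact: ltW.
by rewrite in_itv /= => /andP[su ut] hu; exists u.
Qed.

Lemma is_derive_nonincreasing (h h' : R -> R) (s t : R) : s <= t ->
  (forall u, s <= u -> u <= t -> is_derive u (1 : R) h (h' u)) ->
  (forall u, s <= u -> u <= t -> h' u <= 0) -> h t <= h s.
Proof.
move=> st dh h'0; have [u [su ut hu]] := is_derive_MVT st dh.
by rewrite -subr_le0 hu mulr_le0_ge0 ?h'0 ?subr_ge0.
Qed.

Variables n p : nat.
Variables (V : 'rV[R]_(n + p) -> R) (K Cs : set 'rV[R]_p).
Variables (fave : 'rV[R]_n -> 'rV[R]_p -> 'rV[R]_n) (w : 'rV[R]_p -> 'rV[R]_p).
Variables (c1 c3 c4 : R).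
Hypotheses (c1_gt0 : 0 < c1) (c3_gt0 : 0 < c3) (c4_gt0 : 0 < c4).
Hypothesis V_diff : forall x r, K r -> differentiable V (row_mx x r).
Hypothesis V_ge : forall x r, K r -> c1 * enorm x ^+ 2 <= V (row_mx x r).
Hypothesis V_grad : forall x r, K r -> enorm (gradient V (row_mx x r)) <= c3 * enorm x.
Hypothesis CsK : Cs `<=` K.
Hypothesis V_flow : forall x r, Cs r ->
  dotv (gradient V (row_mx x r)) (row_mx (fave x r) (w r)) <= - c4 * V (row_mx x r).

(** Mean value theorem on the segment from [x] to [xh]: the difference is at most
    [c3 * alpha * (1 + alpha)] times the square of the norm of [x], and (1 + 1/250) / 12 < 9/100. *)
Lemma lyapunov_perturb x xh r (alpha : R) : K r -> enorm (xh - x) <= alpha * enorm x ->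
  0 <= alpha -> alpha <= 250^-1 -> 12 * c3 * alpha <= c1 ->
  `|V (row_mx xh r) - V (row_mx x r)| <= (9 / 100) * V (row_mx x r).
Proof.
move=> Kr xhx a0 a1 a2.
have dl t : is_derive t (1 : R) (fun t : R => V (row_mx (x + t *: (xh - x)) r))
    (dotv (gradient V (row_mx (x + t *: (xh - x)) r)) (row_mx (xh - x) 0)).
  have h := is_derive_row_mx (is_derive_line x (xh - x) t) (is_derive_const r t).
  have dV := V_diff (x + t *: (xh - x)) Kr.
  by rewrite -diff_gradient //; exact: is_derive_comp_path h dV.
have [u [u0 u1]] := is_derive_MVT (@ler01 R) (fun u _ _ => dl u).
rewrite scale0r addr0 scale1r addrCA subrr addr0 subr0 mulr1 => ->.
apply: le_trans (normr_dotv_le _ _) _; rewrite enorm_row_mx0.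
have e0 := enorm_ge0 x.
have h1 : enorm (x + u *: (xh - x)) <= (1 + alpha) * enorm x.
  apply: le_trans (enormD _ _) _; rewrite enormZ ger0_norm //.
  have : u * enorm (xh - x) <= 1 * enorm (xh - x) by apply: ler_wpM2r => //; exact: enorm_ge0.
  lra.
have h2 := V_grad (x + u *: (xh - x)) Kr.
apply: (@le_trans _ _ (c3 * ((1 + alpha) * enorm x) * (alpha * enorm x))).
  apply: ler_pM => //; try exact: enorm_ge0.
  apply: le_trans h2 _; apply: ler_wpM2l => //; exact: ltW.
have h3 := V_ge x Kr.
have -> : c3 * ((1 + alpha) * enorm x) * (alpha * enorm x) =
  (c3 * alpha * (1 + alpha)) * enorm x ^+ 2 by ring.
have h4 : 0 <= enorm x ^+ 2 by exact: exprn_ge0.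
apply: (@le_trans _ _ ((9 / 100) * c1 * enorm x ^+ 2)); last first.
  by rewrite -mulrA; apply: ler_wpM2l h3; lra.
apply: ler_wpM2r => //.
have h5 : 0 <= c3 * alpha by apply: mulr_ge0 => //; exact: ltW.
have : c3 * alpha * (1 + alpha) <= c3 * alpha * (1 + 250^-1) by apply: ler_wpM2l => //; lra.
lra.
Qed.

Variables (x xh xhd : R -> 'rV[R]_n) (r : R -> 'rV[R]_p) (a b alpha eta : R).
Hypothesis r_Cs : forall t, a < t -> t < b -> Cs (r t).
Hypothesis dxh : forall t, a < t -> t < b -> is_derive t (1 : R) xh (xhd t).
Hypothesis dr : forall t, a < t -> t < b -> is_derive t (1 : R) r (w (r t)).
Hypothesis xh_x : forall t, a < t -> t < b -> enorm (xh t - x t) <= alpha * enorm (x t).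
Hypothesis xhd_fave : forall t, a < t -> t < b ->
  enorm (xhd t - fave (xh t) (r t)) <= eta * enorm (x t).
Hypotheses (alpha_ge0 : 0 <= alpha) (alpha_le : alpha <= 250^-1) (alpha_c : 12 * c3 * alpha <= c1).
Hypotheses (eta_ge0 : 0 <= eta) (eta_le : 4 * c3 * eta <= c1 * c4).

(** The error term is at most [c3 * eta] times the product of the norms of [xh] and [x]. As the norm
    of [x] is at most twice that of [xh], the choice of [eta] makes it cost half of the decay
    rate. *)
Lemma averaged_rate (t : R) : a < t -> t < b ->
  dotv (gradient V (row_mx (xh t) (r t))) (row_mx (xhd t) (w (r t)))
    <= - (c4 / 2) * V (row_mx (xh t) (r t)).
Proof.
move=> at_ tb; have Cr := r_Cs at_ tb; have Kr := CsK Cr.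
have -> : row_mx (xhd t) (w (r t)) = row_mx (fave (xh t) (r t)) (w (r t)) +
    row_mx (xhd t - fave (xh t) (r t)) 0.
  by rewrite add_row_mx addrC subrK addr0.
rewrite dotvC dotvDl -[X in X + _]dotvC -[X in _ + X]dotvC.
have h1 := V_flow (xh t) Cr.
have h2 : dotv (gradient V (row_mx (xh t) (r t))) (row_mx (xhd t - fave (xh t) (r t)) 0)
    <= c3 * enorm (xh t) * (eta * enorm (x t)).
  apply: le_trans (dotv_le _ _) _; rewrite enorm_row_mx0.
  by apply: ler_pM; [exact: enorm_ge0|exact: enorm_ge0|exact: V_grad|exact: xhd_fave].
have h3 := V_ge (xh t) Kr.
have e0 := enorm_ge0 (xh t); have e1 := enorm_ge0 (x t).
have h4 : enorm (x t) <= 2 * enorm (xh t).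
  have := enorm_triB (x t) (xh t); have := xh_x at_ tb; rewrite enormB.
  have : alpha * enorm (x t) <= 250^-1 * enorm (x t) by apply: ler_wpM2r.
  lra.
have h5 : c3 * enorm (xh t) * (eta * enorm (x t)) <= c4 / 2 * V (row_mx (xh t) (r t)).
  apply: (@le_trans _ _ (c3 * enorm (xh t) * (eta * (2 * enorm (xh t))))).
    apply: ler_wpM2l; first by apply: mulr_ge0 => //; exact: ltW.
    exact: ler_wpM2l.
  have -> : c3 * enorm (xh t) * (eta * (2 * enorm (xh t))) =
    (4 * c3 * eta) / 2 * enorm (xh t) ^+ 2 by field.
  apply: (@le_trans _ _ ((c1 * c4) / 2 * enorm (xh t) ^+ 2)).
    by apply: ler_wpM2r; [exact: exprn_ge0|rewrite ler_pM2r // invr_gt0].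
  have -> : c1 * c4 / 2 * enorm (xh t) ^+ 2 = c4 / 2 * (c1 * enorm (xh t) ^+ 2) by field.
  by apply: ler_wpM2l => //; apply: divr_ge0 => //; exact: ltW.
lra.
Qed.

Lemma averaged_decay (kappa s t : R) : a < s -> s <= t -> t < b -> 2 * kappa <= c4 ->
  V (row_mx (x t) (r t)) * expR (kappa * t) <= (121 / 100) * (V (row_mx (x s) (r s)) * expR (kappa * s)).
Proof.
move=> as_ st tb kc.
pose h u := V (row_mx (xh u) (r u)) * expR (kappa * u).
have ab u : s <= u -> u <= t -> a < u /\ u < b.
  by move=> su ut; rewrite (lt_le_trans as_) // (le_lt_trans ut).
have dh u : s <= u -> u <= t -> is_derive u (1 : R) h
    ((dotv (gradient V (row_mx (xh u) (r u))) (row_mx (xhd u) (w (r u))) +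
      kappa * V (row_mx (xh u) (r u))) * expR (kappa * u)).
  move=> su ut; have [au ub] := ab u su ut; have Kr := CsK (r_Cs au ub).
  have d1 := is_derive_comp_path (is_derive_row_mx (dxh au ub) (dr au ub)) (V_diff (xh u) Kr).
  have dk : is_derive u (1 : R) (fun u => kappa * u) kappa.
    suff : is_derive u (1 : R) (kappa \*: (id : R -> R^o)) (kappa *: (1 : R)).
      by rewrite [_ *: _]mulr1.
    exact: is_deriveZ.
  have d2 : is_derive u (1 : R) (fun u => expR (kappa * u)) (expR (kappa * u) * kappa).
    exact: (@is_derive1_comp _ expR (fun u => kappa * u) u).
  have := is_deriveM d1 d2; rewrite diff_gradient; last exact: V_diff.
  move=> dm; apply: (is_derive_eq dm).
  rewrite /= [X in X + _]/GRing.scale /= [X in _ + X]/GRing.scale /=; ring.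
have hts : h t <= h s.
  apply: (is_derive_nonincreasing st dh) => u su ut; have [au ub] := ab u su ut.
  have Kr := CsK (r_Cs au ub).
  apply: mulr_le0_ge0; last exact: expR_ge0.
  have h1 := averaged_rate au ub.
  have V0 : 0 <= V (row_mx (xh u) (r u)).
    by apply: le_trans (V_ge (xh u) Kr); apply: mulr_ge0; [exact: ltW|exact: exprn_ge0 (enorm_ge0 _)].
  have : kappa * V (row_mx (xh u) (r u)) <= c4 / 2 * V (row_mx (xh u) (r u)).
    by apply: ler_wpM2r => //; lra.
  lra.
have pert u : s <= u -> u <= t ->
    `|V (row_mx (xh u) (r u)) - V (row_mx (x u) (r u))| <= (9 / 100) * V (row_mx (x u) (r u)).
  move=> su ut; have [au ub] := ab u su ut.
  by apply: (@lyapunov_perturb _ _ _ alpha) => //; [exact: CsK (r_Cs au ub)|exact: xh_x].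
(* Comparing [x] with [xh] at both ends costs 109/91, which is below 121/100, the square of
   11/10. *)
have := pert s (lexx s) st; have := pert t st (lexx t); rewrite /h in hts.
rewrite !ler_norml => /andP[t1 t2] /andP[s1 s2].
have et := expR_gt0 (kappa * t); have es := expR_gt0 (kappa * s).
have p1 : (1 - (9 / 100)) * V (row_mx (x t) (r t)) * expR (kappa * t) <=
   V (row_mx (xh t) (r t)) * expR (kappa * t) by apply: ler_wpM2r; [exact: ltW|lra].
have p2 : V (row_mx (xh s) (r s)) * expR (kappa * s) <=
   (1 + (9 / 100)) * V (row_mx (x s) (r s)) * expR (kappa * s) by apply: ler_wpM2r; [exact: ltW|lra].
have V0 : 0 <= V (row_mx (x s) (r s)) * expR (kappa * s).
  apply: mulr_ge0; last exact: ltW.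
  have [as' sb] := ab s (lexx s) st.
  apply: le_trans (V_ge (x s) (CsK (r_Cs as' sb))).
  by apply: mulr_ge0; [exact: ltW|exact: exprn_ge0 (enorm_ge0 _)].
lra.
Qed.

End LyapunovDecay.

(** * Size and drift of the averaging correction *)

Section FlowEstimate.
Context {R : realType}.
Notation mu := lebesgue_measure.
Variables n p : nat.
Let T2 : normedModType R := ('rV[R]_n * 'rV[R]_p)%type.
Let T4 : normedModType R := ('rV[R]_n * 'rV[R]_p * R * R)%type.
Variables (f : 'rV[R]_n -> 'rV[R]_p -> R -> R -> 'rV[R]_n) (fave : 'rV[R]_n -> 'rV[R]_p -> 'rV[R]_n).
Variables (U : set T4) (F : T4 -> 'rV[R]_n).
Let G : T2 -> 'rV[R]_n := fun q => fave q.1 q.2.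
Hypotheses (C1F : Ck_open 1 U F) (C1G : Ck_open 1 setT G).
Hypothesis U_nonneg : forall x r (s e : R), 0 <= s -> 0 <= e -> U (x, r, s, e).
Hypothesis fF : forall x r (s e : R), 0 <= s -> 0 <= e -> f x r s e = F (x, r, s, e).
Variables (K : set 'rV[R]_p) (gamma : R -> R).
Hypothesis dev_avg : forall x r (tau T : R), K r -> 0 <= tau -> 0 < T ->
  enorm (T^-1 *: mxint tau (tau + T) (deviation f fave (row_mx x r))) <= gamma T * enorm x /\
  opnorm (T^-1 *: mxint tau (tau + T)
    (fun s => 'J (fun z => deviation f fave z s) (row_mx x r))) <= gamma T.
Variables (L eps Mg : R).
Hypotheses (L_gt0 : 0 < L) (eps_gt0 : 0 < eps) (Mg_ge0 : 0 <= Mg).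
Hypothesis gamma_ge0 : forall s, 0 < s -> 0 <= gamma s.
Hypothesis gamma_le : forall s, 0 < s -> gamma s <= Mg.

Variables (x xd : R -> 'rV[R]_n) (r rd rb : R -> 'rV[R]_p) (tau : R -> R) (a b : R).
Hypotheses (cx : continuous x) (cxd : continuous xd) (cr : continuous r) (crd : continuous rd)
  (ctau : continuous tau).
Hypothesis K_r : forall t, K (r t).
Hypothesis tau_ge0 : forall t, 0 <= tau t.
Hypothesis dx : forall t, a < t -> t < b -> is_derive t (1 : R) x (xd t).
Hypothesis dr : forall t, a < t -> t < b -> is_derive t (1 : R) r (rd t).
Hypothesis dtau : forall t, a < t -> t < b -> is_derive t (1 : R) tau (eps^-1).
Hypothesis slow_rb : forall i t q, 0 <= q ->
  slow_derivative F G x xd r rd tau i t q =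
  diff_coord F i (x t, r t, tau t + q, 0) (xd t, rb t, 0, 0) -
  diff_coord2 G i (x t, r t) (xd t, rb t).

Let E i t q := path_deviation F G x r tau i t q.
Let A i t q := slow_derivative F G x xd r rd tau i t q.

(* eps * window_average is the near-identity change of variable x -> xh *)
Definition window_average t : 'rV[R]_n :=
  \row_i \int[mu]_(q in `[0, L]) ((1 - q / L) * E i t q).

Definition window_average_derivative t : 'rV[R]_n :=
  \row_i (\int[mu]_(q in `[0, L]) ((1 - q / L) * A i t q) +
     eps^-1 * (L^-1 * \int[mu]_(q in `[0, L]) E i t q - E i t 0)).

Let drift i t (at_ : a < t) (tb : t < b) := @window_drift R n p U F G C1F C1G x xd r rd tau a b
  eps^-1 cx cxd cr crd ctau (fun t q q0 => U_nonneg (x t) (r t) (addr_ge0 (tau_ge0 t) q0) (lexx 0))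
  dx dr dtau i t L at_ tb L_gt0.

Let upto_le (l B : R) : 0 <= l -> l <= L -> 0 <= B -> l * (gamma l * B) <= L * (Mg * B).
Proof.
(* The bounds on [gamma] are assumed at positive lengths only; for [l = 0] the left side is 0. *)
rewrite le_eqVlt => /predU1P[<- _|l0 lL] B0.
  by rewrite mul0r mulr_ge0 ?mulr_ge0 // ltW.
apply: (@le_trans _ _ (l * (Mg * B))).
  by apply: ler_wpM2l; [exact: ltW|apply: ler_wpM2r => //; exact: gamma_le].
by apply: ler_wpM2r => //; apply: mulr_ge0.
Qed.

Let weighted_le (h : R -> R) (B : R) : {within `[0, L], continuous h} -> 0 <= B ->
  (forall l, 0 < l -> `|\int[mu]_(q in `[0, l]) h q| <= l * (gamma l * B)) ->
  `|\int[mu]_(q in `[0, L]) ((1 - q / L) * h q)| <= L * (Mg * B).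
Proof.
move=> ch B0 hB; apply: weighted_bound => // l l0 lL.
apply: le_trans _ (upto_le l0 lL B0).
move: l0; rewrite le_eqVlt => /predU1P[<-|]; last exact: hB.
by rewrite set_itv1 Rintegral_set1 normr0 mul0r.
Qed.

Lemma enorm_window_average t : a < t -> t < b ->
  enorm (window_average t) <= n%:R * (L * (Mg * enorm (x t))).
Proof.
move=> at_ tb; apply: enorm_coord_le => i; rewrite mxE; have [cE _ _] := drift i at_ tb.
apply: weighted_le => //; first exact: enorm_ge0.
move=> l l0; rewrite /E /path_deviation.
exact: (deviation_integral_le C1F U_nonneg fF dev_avg i (x t) (K_r t) (tau_ge0 t) l0).
Qed.

Lemma is_derive_window t : a < t -> t < b ->
  is_derive t (1 : R) (fun t => x t + eps *: window_average t)
    (xd t + eps *: window_average_derivative t).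
Proof.
move=> at_ tb; apply: is_deriveD; first exact: dx.
apply: is_deriveZ; apply/is_derive_coord => i; have [_ _] := drift i at_ tb.
rewrite mxE (_ : (fun s => window_average s 0 i) =
  fun t => \int[mu]_(q in `[0, L]) ((1 - q / L) * E i t q)) //.
by apply/funext => s; rewrite mxE.
Qed.

Lemma sum_row_mx_le (u : 'rV[R]_n) (v : 'rV[R]_p) :
  \sum_j `|row_mx u v 0 j| <= n%:R * enorm u + p%:R * enorm v.
Proof.
have sum_le k (z : 'rV[R]_k) : \sum_j `|z 0 j| <= k%:R * enorm z.
  rewrite -[k in k%:R]card_ord -sum1_card natr_sum mulr_suml; apply: ler_sum => j _.
  by rewrite mul1r normr_coord_le.
rewrite big_split_ord /=; apply: lerD; apply: le_trans (sum_le _ _).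
  by apply: ler_sum => j _; rewrite row_mxEl.
by apply: ler_sum => j _; rewrite row_mxEr.
Qed.

(** The factors [eps] and [eps^-1] cancel, and the value of the deviation at [q = 0] replaces the
    field by its average. What remains is [eps] times the weighted slow derivative, plus the mean of
    the deviation over the window. *)
Lemma window_drift_le t gL : a < t -> t < b -> gamma L <= gL ->
  enorm (xd t + eps *: window_average_derivative t -
      (xd t - F (x t, r t, tau t, 0) + G (x t, r t)))
    <= n%:R * (eps * (L * (Mg * (n%:R * enorm (xd t) + p%:R * enorm (rb t)))) + gL * enorm (x t)).
Proof.
move=> at_ tb hgL; apply: enorm_coord_le => i; have [cE cA _] := drift i at_ tb.
have -> : (xd t + eps *: window_average_derivative t -
      (xd t - F (x t, r t, tau t, 0) + G (x t, r t))) 0 i =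
    eps * \int[mu]_(q in `[0, L]) ((1 - q / L) * A i t q) + L^-1 * \int[mu]_(q in `[0, L]) E i t q.
  rewrite coord_subE coord_addZ [window_average_derivative t 0 i]mxE.
  have cD (M N : 'rV[R]_n) : (M + N) 0 i = M 0 i + N 0 i by rewrite mxE.
  have E0 : E i t 0 = F (x t, r t, tau t, 0) 0 i - G (x t, r t) 0 i.
    by rewrite /E /path_deviation addr0.
  rewrite cD coord_subE E0; field.
  by rewrite !gt_eqF.
apply: le_trans (ler_normD _ _) _; apply: lerD.
  rewrite normrM ger0_norm ?(ltW eps_gt0) //; apply: ler_wpM2l; first exact: ltW.
  apply: weighted_le => //.
    by apply: addr_ge0; apply: mulr_ge0 => //; exact: enorm_ge0.
  move=> l l0; rewrite (_ : Rintegral _ _ _ = \int[mu]_(q in `[0, l])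
      (diff_coord F i (x t, r t, tau t + q, 0) (xd t, rb t, 0, 0) -
       diff_coord2 G i (x t, r t) (xd t, rb t))); last first.
    by apply: eq_Rintegral => q; rewrite inE /= in_itv /= => /andP[q0 _]; exact: slow_rb.
  apply: le_trans (jacobian_integral_le C1F C1G U_nonneg fF dev_avg i (x t) (xd t) (rb t)
    (K_r t) (tau_ge0 t) l0) _.
  apply: ler_wpM2l; first exact: ltW.
  by apply: ler_wpM2l; [exact: gamma_ge0|exact: sum_row_mx_le].
rewrite normrM ger0_norm ?invr_ge0 ?(ltW L_gt0) // ler_pdivrMl //; rewrite /E /path_deviation.
apply: le_trans (deviation_integral_le C1F U_nonneg fF dev_avg i (x t) (K_r t) (tau_ge0 t) L_gt0) _.
by apply: ler_wpM2l; [exact: ltW|apply: ler_wpM2r => //; exact: enorm_ge0].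
Qed.

End FlowEstimate.

Section StackClosed.
Context {R : realType}.

Lemma closed_stack k l (S : set 'rV[R]_k) (T : set 'rV[R]_l) :
  closed S -> closed T -> closed (stack S T).
Proof.
move=> cS cT; rewrite (_ : stack S T = lsubmx @^-1` S `&` rsubmx @^-1` T) //.
by apply: closedI; apply: closed_preimage => //; [exact: continuous_lsubmx|exact: continuous_rsubmx].
Qed.

Lemma continuous_coord00 : continuous (fun s : 'rV[R]_1 => s 0 0).
Proof. exact: coord_continuous. Qed.

Lemma closed_nonneg1 : closed (@nonneg1 R).
Proof. exact: (closed_preimage continuous_coord00 (@closed_ge R 0)). Qed.

End StackClosed.

(** * Smooth coordinates of a single flow of the system *)

Section OneFlow.
Context {R : realType}.
Variables n p m : nat.
Variables (C D : set 'rV[R]_p) (f : 'rV[R]_n -> 'rV[R]_p -> R -> R -> 'rV[R]_n).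
Variables (w : 'rV[R]_p -> 'rV[R]_p) (g : 'rV[R]_n -> 'rV[R]_p -> 'rV[R]_m -> 'rV[R]_n).
Variables (h : 'rV[R]_p -> 'rV[R]_m -> 'rV[R]_p) (eps : R).
Let T4 : normedModType R := ('rV[R]_n * 'rV[R]_p * R * R)%type.
Variables (U : set T4) (F : T4 -> 'rV[R]_n).
Hypothesis C1F : Ck_open 1 U F.
Hypothesis U_nonneg : forall x r (s e : R), 0 <= s -> 0 <= e -> U (x, r, s, e).
Hypothesis fF : forall x r (s e : R), 0 <= s -> 0 <= e -> f x r s e = F (x, r, s, e).
Hypotheses (cC : closed C) (cw : continuous w) (eps_gt0 : 0 < eps).
Let H := two_time_scale_SHDS C D f w g h eps.
Variables (y : R -> 'rV[R]_(n + p + 1)) (a b : R).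
Hypotheses (ab : a < b) (acy : abs_continuous a b y) (fy : flows_ae H `[a, b] y).

Definition state_x (z : 'rV[R]_(n + p + 1)) : 'rV[R]_n := lsubmx (lsubmx z).
Definition state_r (z : 'rV[R]_(n + p + 1)) : 'rV[R]_p := rsubmx (lsubmx z).
Definition state_tau (z : 'rV[R]_(n + p + 1)) : R := rsubmx z 0 0.

Lemma continuous_state_x : continuous state_x.
Proof. by apply: continuous_compf; [exact: continuous_lsubmx|exact: continuous_lsubmx]. Qed.

Lemma continuous_state_r : continuous state_r.
Proof. by apply: continuous_compf; [exact: continuous_lsubmx|exact: continuous_rsubmx]. Qed.

Lemma continuous_state_tau : continuous state_tau.
Proof. by apply: (continuous_compf _ continuous_coord00); exact: continuous_rsubmx. Qed.

(** The path held constant outside [[a, b]]: it is continuous on the whole line and stays in the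
    flow set, and it agrees with [y] near each interior time, so derivatives there are unchanged. *)
Let yc t := y (clamp a b t).
Let x t := state_x (yc t).
Let r t := state_r (yc t).
Let tau t := state_tau (yc t).
Let xd t := f (x t) (r t) (tau t) eps.

Let cyc : continuous yc.
Proof. exact: (continuous_comp_clamp (ltW ab) (abs_continuous_within acy)). Qed.
Let cx : continuous x. Proof. exact: (continuous_compf cyc continuous_state_x). Qed.
Let cr : continuous r. Proof. exact: (continuous_compf cyc continuous_state_r). Qed.
Let ctau : continuous tau. Proof. exact: (continuous_compf cyc continuous_state_tau). Qed.

(** The flow set is closed and [y] continuous, so membership at almost every time extends to every
    time. *)
Let y_flow_set t : `[a, b]%classic t -> flow_set H (y t).
Proof.
apply: (ae_closed_itv ab _ (abs_continuous_within acy)).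
  by apply: closed_stack (closed_stack _ cC) closed_nonneg1; exact: closedT.
by apply: filterS fy; [exact: (ae_filter_ringOfSetsType lebesgue_measure)|move=> u hu /hu[]].
Qed.

Let r_C t : C (r t).
Proof. by have [[_ Cr] _] := y_flow_set (clamp_itv t (ltW ab)). Qed.

Let tau_ge0 t : 0 <= tau t.
Proof. by have [_ t0] := y_flow_set (clamp_itv t (ltW ab)). Qed.

Let cxd : continuous xd.
Proof.
rewrite (_ : xd = fun t => F (x t, r t, tau t, eps)); last first.
  by apply/funext => t; rewrite /xd fF // ltW.
have [dF _] := C1F.
move=> t; apply: (continuous_comp (f := fun t => (x t, r t, tau t, eps) : T4)).
  apply: continuous_pairf; last exact: continuous_cstf.
  by apply: continuous_pairf => //; exact: continuous_pairf.
by apply: differentiable_continuous; apply: dF; apply: U_nonneg => //; exact: ltW.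
Qed.

Let dy t : a < t -> t < b -> is_derive t (1 : R) y
  (row_mx (row_mx (xd t) (w (r t))) (const_mx eps^-1)).
Proof.
move=> at_ tb.
pose phi t : 'rV[R]_(n + p + 1) := row_mx (row_mx (xd t) (w (r t))) (const_mx eps^-1).
apply: (@ac_ode_C1 _ _ y phi a b (ltW ab) acy); last by rewrite in_itv /= at_.
  apply: continuous_subspaceT; apply: continuous_row_mx; last exact: continuous_cstf.
  by apply: continuous_row_mx => //; exact: continuous_compf cr cw.
apply: filterS fy; first exact: (ae_filter_ringOfSetsType lebesgue_measure).
move=> s hs sab; have [_] := hs sab.
by rewrite /phi /xd /x /r /tau /yc clamp_id.
Qed.

Let yc_near t : a < t -> t < b -> \forall s \near t, y s = yc s.
Proof.
move=> at_ tb; near=> s; rewrite /yc clamp_id // in_itv /=; apply/andP; split; apply: ltW.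
  by near: s; exact: lt_nbhsr.
by near: s; exact: lt_nbhsl.
Unshelve. all: by end_near. Qed.

Let dyc t : a < t -> t < b -> is_derive t (1 : R) yc
  (row_mx (row_mx (xd t) (w (r t))) (const_mx eps^-1)).
Proof.
by move=> at_ tb; apply: near_eq_is_derive (yc_near at_ tb) (dy at_ tb).
Qed.

Let dx t : a < t -> t < b -> is_derive t (1 : R) x (xd t).
Proof.
move=> at_ tb.
have := is_derive_lin (f := lsubmx) (@continuous_lsubmx _ _ _)
  (is_derive_lin (f := lsubmx) (@continuous_lsubmx _ _ _) (dyc at_ tb)).
by move=> d; apply: (is_derive_eq d); rewrite /= !row_mxKl.
Qed.

Let dr t : a < t -> t < b -> is_derive t (1 : R) r (w (r t)).
Proof.
move=> at_ tb.
have := is_derive_lin (f := rsubmx) (@continuous_rsubmx _ _ _)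
  (is_derive_lin (f := lsubmx) (@continuous_lsubmx _ _ _) (dyc at_ tb)).
by move=> d; apply: (is_derive_eq d); rewrite /= row_mxKl row_mxKr.
Qed.

Let dtau t : a < t -> t < b -> is_derive t (1 : R) tau eps^-1.
Proof.
move=> at_ tb.
have := is_derive_lin (f := rsubmx) (@continuous_rsubmx _ _ _) (dyc at_ tb).
by move=> /is_derive_coord/(_ 0) d; apply: (is_derive_eq d); rewrite /= row_mxKr mxE.
Qed.

Lemma flow_path : exists (x xd : R -> 'rV[R]_n) (r : R -> 'rV[R]_p) (tau : R -> R),
  [/\ [/\ continuous x, continuous xd, continuous r & continuous tau],
      forall t, C (r t), forall t, 0 <= tau t,
      forall t, xd t = F (x t, r t, tau t, eps)
    & (forall t, a < t -> t < b -> [/\ is_derive t (1 : R) x (xd t),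
          is_derive t (1 : R) r (w (r t)) & is_derive t (1 : R) tau eps^-1]) /\
      forall t, a <= t -> t <= b ->
        [/\ x t = state_x (y t), r t = state_r (y t) & tau t = state_tau (y t)]].
Proof.
exists x, xd, r, tau; split => //.
  by move=> t; rewrite /xd fF // ltW.
split; first by move=> t at_ tb; split; [exact: dx|exact: dr|exact: dtau].
by move=> t at_ tb; rewrite /x /r /tau /yc clamp_id // in_itv /= at_.
Qed.

Lemma flow_tau s t : a <= s -> s <= t -> t <= b ->
  state_tau (y t) - state_tau (y s) = (t - s) / eps.
Proof.
move=> as_ st tb.
have taE u : a <= u -> u <= b -> tau u = state_tau (y u).
  by move=> au ub; rewrite /tau /yc clamp_id // in_itv /= au.
rewrite -!taE ?(le_trans as_) ?(le_trans _ tb) // mulrC.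
have dt u : u \in `]s, t[ -> is_derive u (1 : R) tau eps^-1.
  rewrite in_itv /= => /andP[su ut]; apply: dtau.
    exact: le_lt_trans su.
  exact: lt_le_trans tb.
by have [u _ ->] := @MVT_segment R tau (fun=> eps^-1) s t st dt (continuous_subspaceT ctau).
Qed.

End OneFlow.

(** * Decay of the Lyapunov function along one flow *)

Section SystemFlow.
Context {R : realType}.
Notation mu := lebesgue_measure.
Variables n p m : nat.
Let T2 : normedModType R := ('rV[R]_n * 'rV[R]_p)%type.
Let T4 : normedModType R := ('rV[R]_n * 'rV[R]_p * R * R)%type.

Lemma diff_coord_split (F : T4 -> 'rV[R]_n) i P (a : 'rV[R]_n) (b : 'rV[R]_p) :
  diff_coord F i P (a, b, 0, 0) = diff_coord F i P (a, 0, 0, 0) + diff_coord F i P (0, b, 0, 0).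
Proof.
rewrite /diff_coord.
have -> : ((a, b, 0, 0) : T4) = (a, 0, 0, 0) + (0, b, 0, 0).
  by congr (_, _, _, _); rewrite ?addr0 ?add0r.
by rewrite linearD mxE.
Qed.

Lemma diff_coord2_split (G : T2 -> 'rV[R]_n) i P (a : 'rV[R]_n) (b : 'rV[R]_p) :
  diff_coord2 G i P (a, b) = diff_coord2 G i P (a, 0) + diff_coord2 G i P (0, b).
Proof.
rewrite /diff_coord2.
have -> : ((a, b) : T2) = (a, 0) + (0, b).
  by congr (_, _); rewrite ?addr0 ?add0r.
by rewrite linearD mxE.
Qed.

Variables (C D : set 'rV[R]_p) (f : 'rV[R]_n -> 'rV[R]_p -> R -> R -> 'rV[R]_n).
Variables (w : 'rV[R]_p -> 'rV[R]_p) (g : 'rV[R]_n -> 'rV[R]_p -> 'rV[R]_m -> 'rV[R]_n).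
Variables (h : 'rV[R]_p -> 'rV[R]_m -> 'rV[R]_p) (fave : 'rV[R]_n -> 'rV[R]_p -> 'rV[R]_n).
Variables (U : set T4) (F : T4 -> 'rV[R]_n).
Let G : T2 -> 'rV[R]_n := fun q => fave q.1 q.2.
Let K := C `|` D.
Hypotheses (C1F : Ck_open 1 U F) (C1G : Ck_open 1 setT G).
Hypothesis U_nonneg : forall x r (s e : R), 0 <= s -> 0 <= e -> U (x, r, s, e).
Hypothesis fF : forall x r (s e : R), 0 <= s -> 0 <= e -> f x r s e = F (x, r, s, e).
Hypotheses (cC : closed C) (cw : continuous w).
Variable (gamma : R -> R).
Hypothesis dev_avg : forall x r (tau T : R), K r -> 0 <= tau -> 0 < T ->
  enorm (T^-1 *: mxint tau (tau + T) (deviation f fave (row_mx x r))) <= gamma T * enorm x /\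
  opnorm (T^-1 *: mxint tau (tau + T)
    (fun s => 'J (fun z => deviation f fave z s) (row_mx x r))) <= gamma T.
Hypothesis gamma_small : forall e : R, 0 < e -> exists2 T, 0 < T & gamma T <= e.

(* Along w, the r-derivative of the deviation is constant in time; its averages tend to 0. *)
Lemma frozen_fave i x r : C r ->
  (forall s, 0 <= s -> w r *m 'J (fun r' => f x r' s 0) r = 0) ->
  diff_coord2 G i (x, r) (0, w r) = 0.
Proof.
move=> Cr frozen; set k := diff_coord2 _ _ _ _.
pose S := \sum_j `|row_mx (0 : 'rV[R]_n) (w r) 0 j|.
have S0 : 0 <= S by apply: sumr_ge0.
have kS l : 0 < l -> `|k| <= gamma l * S.
  move=> l0; have := jacobian_integral_le C1F C1G U_nonneg fF dev_avg i x 0 (w r) (or_introl Cr)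
    (lexx (0 : R)) l0.
  rewrite (_ : Rintegral _ _ _ = \int[mu]_(q in `[0, l]) (- k)); last first.
    apply: eq_Rintegral => q; rewrite inE /= in_itv /= => /andP[q0 _].
    by rewrite add0r (frozen_diff_coord C1F U_nonneg fF i q0 (frozen q q0)) sub0r.
  rewrite Rintegral_cst // fine_lebesgue_itv ?(ltW l0) // subr0 mulNr normrN normrM.
  by rewrite (ger0_norm (ltW l0)) mulrC ler_pM2l.
apply/eqP; rewrite -normr_eq0; apply/negPn/negP => k0.
have k0' : 0 < `|k| by rewrite lt_neqAle eq_sym k0 normr_ge0.
have [l l0 gl] := gamma_small (divr_gt0 k0' (ltr_wpDl S0 (@ltr01 R))).
have := kS l l0; apply/negP; rewrite -ltNge.
apply: (@le_lt_trans _ _ (`|k| / (S + 1) * S)); first exact: ler_wpM2r.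
rewrite -[ltRHS]mulr1 -mulrA ltr_pM2l // mulrC ltr_pdivrMr ?mul1r; lra.
Qed.

Variables (Lx Le Lave Mg L Wm : R).
Hypotheses (Lave_ge0 : 0 <= Lave) (Mg_ge0 : 0 <= Mg)
  (L_gt0 : 0 < L).
Hypothesis gamma_ge0 : forall s, 0 < s -> 0 <= gamma s.
Hypothesis gamma_le : forall s, 0 < s -> gamma s <= Mg.
Hypothesis w_le : forall r, C r -> enorm (w r) <= Wm.
Hypothesis fave_lip : forall x1 x2 r, K r -> enorm (fave x1 r - fave x2 r) <= Lave * enorm (x1 - x2).
Variables (V : 'rV[R]_(n + p) -> R) (c1 c3 c4 : R).
Hypotheses (c1_gt0 : 0 < c1) (c3_gt0 : 0 < c3) (c4_gt0 : 0 < c4).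
Hypothesis V_diff : forall x r, K r -> differentiable V (row_mx x r).
Hypothesis V_ge : forall x r, K r -> c1 * enorm x ^+ 2 <= V (row_mx x r).
Hypothesis V_grad : forall x r, K r -> enorm (gradient V (row_mx x r)) <= c3 * enorm x.
Hypothesis V_flow : forall x r, C r ->
  dotv (gradient V (row_mx x r)) (row_mx (fave x r) (w r)) <= - c4 * V (row_mx x r).

Variables (eps alpha gL eta eta0 K1 : R).
Hypothesis eps_gt0 : 0 < eps.
Hypothesis F_lip : forall x r tau, K r -> 0 <= tau -> enorm (F (x, r, tau, eps)) <= Lx * enorm x.
Hypothesis F_eps : forall x r tau, K r -> 0 <= tau ->
  enorm (F (x, r, tau, eps) - F (x, r, tau, 0)) <= Le * enorm x * eps.
Hypothesis gammaL : gamma L <= gL.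
Hypothesis alphaE : alpha = eps * (n%:R * (L * Mg)).
Hypotheses (alpha_le : alpha <= 250^-1) (alpha_c : 12 * c3 * alpha <= c1).
Hypotheses (eta_ge0 : 0 <= eta) (eta_le : 4 * c3 * eta <= c1 * c4) (eta0_ge0 : 0 <= eta0).
Hypothesis K1_large : n%:R * (L * (Mg * (p%:R * Wm))) <= eta0 * K1.
Hypothesis eta_split :
  n%:R * (eps * (L * (Mg * (n%:R * Lx))) + gL) + Le * eps + Lave * alpha + eta0 <= eta.

Let H := two_time_scale_SHDS C D f w g h eps.

Lemma flow_decay (y : R -> 'rV[R]_(n + p + 1)) (a b kappa : R) : a < b ->
  abs_continuous a b y -> flows_ae H `[a, b] y -> 2 * kappa <= c4 ->
  (forall x r s, C r -> 0 <= s -> w r *m 'J (fun r' => f x r' s 0) r = 0) \/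
  (forall t, a <= t -> t <= b -> K1 * eps <= enorm (state_x (y t))) ->
  V (lsubmx (y b)) * expR (kappa * b) <= 121 / 100 * (V (lsubmx (y a)) * expR (kappa * a)).
Proof.
move=> ab acy fy kc frozen_or_far.
have [x [xd [r [tau [[cx cxd cr ctau] rC tau0 xdE [dpath pathE]]]]]] :=
  flow_path C1F U_nonneg fF cC cw eps_gt0 ab acy fy.
have rK t : K (r t) by left; exact: rC.
(* If the field is frozen along [w], the velocity [rb] may be taken to be 0. Otherwise it is the
   true one, and its contribution of order [eps] is at most [eta0] times the norm of [x], because
   that norm is at least [K1 * eps]. *)
have [rb [slow_rb rb_le]] : exists rb : R -> 'rV[R]_p,
    (forall i t q, 0 <= q -> slow_derivative F G x xd r (w \o r) tau i t q =
       diff_coord F i (x t, r t, tau t + q, 0) (xd t, rb t, 0, 0) -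
       diff_coord2 G i (x t, r t) (xd t, rb t)) /\
    (forall t, a < t -> t < b -> n%:R * (eps * (L * (Mg * (p%:R * enorm (rb t))))) <= eta0 * enorm (x t)).
  case: frozen_or_far => [frozen|far].
    exists (fun=> 0); split=> [i t q q0|t at_ tb]; last first.
      by rewrite enorm0 !mulr0 mulr_ge0 // enorm_ge0.
    have tq : 0 <= tau t + q by exact: addr_ge0.
    rewrite /slow_derivative diff_coord_split [diff_coord2 _ _ _ _]diff_coord2_split.
    rewrite (frozen_diff_coord C1F U_nonneg fF i tq (frozen _ _ _ (rC t) tq)).
    by rewrite (frozen_fave i (rC t) (fun s => frozen _ _ s (rC t))) !addr0.
  exists (w \o r); split=> // t at_ tb /=.
  have [xE _ _] := pathE t (ltW at_) (ltW tb); have := far t (ltW at_) (ltW tb); rewrite -xE => farx.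
  apply: (@le_trans _ _ (eta0 * (K1 * eps))); last exact: ler_wpM2l.
  rewrite [leLHS]mulrCA [leRHS]mulrA [leRHS]mulrC ler_pM2l //.
  apply: le_trans K1_large; apply: ler_wpM2l => //; apply: ler_wpM2l; first exact: ltW.
  by do 2 (apply: ler_wpM2l => //); exact: w_le.
pose xh t := x t + eps *: window_average fave F L x r tau t.
pose xhd t := xd t + eps *: window_average_derivative fave F L eps x xd r (w \o r) tau t.
have crd : continuous (w \o r) by exact: continuous_compf cr cw.
have dx t : a < t -> t < b -> is_derive t (1 : R) x (xd t) by move=> at_ /(dpath _ at_)[].
have dr t : a < t -> t < b -> is_derive t (1 : R) r ((w \o r) t) by move=> at_ /(dpath _ at_)[].
have dtau t : a < t -> t < b -> is_derive t (1 : R) tau eps^-1 by move=> at_ /(dpath _ at_)[].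
have alpha0 : 0 <= alpha.
  by rewrite alphaE mulr_ge0 ?(ltW eps_gt0) // mulr_ge0 // mulr_ge0 // ltW.
have xh_x t : a < t -> t < b -> enorm (xh t - x t) <= alpha * enorm (x t).
  move=> at_ tb; rewrite /xh addrAC subrr add0r enormZ (ger0_norm (ltW eps_gt0)) alphaE.
  rewrite -mulrA ler_pM2l // -!mulrA.
  exact: (enorm_window_average C1F C1G U_nonneg fF dev_avg L_gt0 Mg_ge0 gamma_le
    cx cxd cr crd ctau rK tau0 dx dr dtau).
have xhd_fave t : a < t -> t < b -> enorm (xhd t - fave (xh t) (r t)) <= eta * enorm (x t).
  move=> at_ tb.
  have h1 := window_drift_le C1F C1G U_nonneg fF dev_avg L_gt0 eps_gt0 Mg_ge0 gamma_ge0 gamma_le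
    cx cxd cr crd ctau rK tau0 dx dr dtau slow_rb at_ tb gammaL.
  have e0 := enorm_ge0 (x t).
  have h2 := F_eps (x t) (rK t) (tau0 t).
  have h3 := fave_lip (xh t) (x t) (rK t).
  have h4 := xh_x t at_ tb.
  have h5 := F_lip (x t) (rK t) (tau0 t); rewrite -xdE in h5.
  have h6 := rb_le t at_ tb.
  (* Three errors: averaging over the window, evaluating the field at [eps] instead of 0, and
     evaluating the averaged field at [xh] instead of [x]. *)
  have split3 : xhd t - fave (xh t) (r t) =
     (xhd t - (xd t - F (x t, r t, tau t, 0) + G (x t, r t))) +
     (xd t - F (x t, r t, tau t, 0)) + (G (x t, r t) - fave (xh t) (r t)).
    move: (xhd t) (G _) (fave _ _) (xd t - _) => M1 M2 M3 M4.
    by apply/rowP => i; rewrite !mxE; ring.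
  rewrite split3.
  apply: le_trans (enormD _ _) _; rewrite [X in _ + X]enormB.
  apply: le_trans (lerD (enormD _ _) h3) _.
  rewrite {2}xdE.
  have h7 : Lave * enorm (xh t - x t) <= Lave * (alpha * enorm (x t)) by exact: ler_wpM2l.
  have h8 : n%:R * (eps * (L * (Mg * (n%:R * enorm (xd t))))) <=
      n%:R * (eps * (L * (Mg * (n%:R * (Lx * enorm (x t)))))).
    apply: ler_wpM2l => //; apply: ler_wpM2l; first exact: ltW.
    by apply: ler_wpM2l; [exact: ltW|do 2 (apply: ler_wpM2l => //)].
  have h9 := ler_wpM2r e0 eta_split.
  rewrite -/(xhd t) in h1; rewrite !mulrDr !mulrDl in h1 h9 *.
  rewrite -[fave (x t, r t).1 _]/(G (x t, r t)) in h1.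
  have e1 : n%:R * (eps * (L * (Mg * (n%:R * (Lx * enorm (x t)))))) =
    n%:R * (eps * (L * (Mg * (n%:R * Lx)))) * enorm (x t) by ring.
  have e2 : n%:R * (gL * enorm (x t)) = n%:R * gL * enorm (x t) by ring.
  lra.
have dec (s t : R) : a < s -> s <= t -> t < b ->
    V (row_mx (x t) (r t)) * expR (kappa * t) <=
    121 / 100 * (V (row_mx (x s) (r s)) * expR (kappa * s)).
  move=> as_ st tb.
  apply: (averaged_decay (xh := xh) (xhd := xhd) (eta := eta) c1_gt0 c3_gt0 c4_gt0 V_diff V_ge V_grad _ V_flow
    (fun t _ _ => rC t) _ dr xh_x xhd_fave alpha0 alpha_le alpha_c eta_ge0 eta_le as_ st tb kc).
    by move=> ? ?; left.
  move=> u au ub.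
  exact: (is_derive_window C1F C1G U_nonneg L_gt0 cx cxd cr crd ctau tau0 dx dr dtau).
pose phi t := V (row_mx (x t) (r t)) * expR (kappa * t).
have cphi : continuous phi.
  apply: continuous_mulf.
    move=> t; apply: (continuous_comp (f := fun t => row_mx (x t) (r t)) (g := V)).
      exact: continuous_row_mx.
    by apply: differentiable_continuous; exact: V_diff.
  apply: (@continuous_compf _ _ _ (fun t : R => kappa * t)); last exact: continuous_expR.
  by apply: continuous_mulf; [exact: continuous_cstf|exact: continuous_idf].
have row t : a <= t -> t <= b -> row_mx (x t) (r t) = lsubmx (y t).
  by move=> at_ tb; have [-> -> _] := pathE t at_ tb; rewrite hsubmxK.
rewrite -!row ?lexx ?(ltW ab) //.
have closed0 : closed [set z : R | 0 <= z] by exact: closed_ge.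
(* Derivatives are known only inside []a, b[]; the two end points are recovered one after the other
   by continuity. *)
have to_b s : a < s -> s < b -> 0 <= 121 / 100 * phi s - phi b.
  move=> as_ sb.
  apply: (closed_oo_cc (h := fun t => 121 / 100 * phi s - phi t) sb closed0 _ _ (ltW sb) (lexx b)).
    apply: continuous_subspaceT; apply: continuous_subf => //; exact: continuous_cstf.
  by move=> t st tb; rewrite /= subr_ge0; apply: dec => //; exact: ltW.
rewrite -subr_ge0.
apply: (closed_oo_cc (h := fun s => 121 / 100 * phi s - phi b) ab closed0 _ _ (lexx a) (ltW ab)) => //.
apply: continuous_subspaceT; apply: continuous_subf; last exact: continuous_cstf.
by apply: continuous_mulf => //; exact: continuous_cstf.
Qed.

End SystemFlow.

(** * First moments from second moments *)

Section SquareRootMoment.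
Context {R : realType} {d : measure_display} {T : measurableType d}.
Variables (nu : probability T R) (A : set T) (X Y : T -> R) (c M : R).
Hypotheses (mA : measurable A) (nuA : nu (~` A) = 0%E).
Hypotheses (mX : measurable_fun setT X) (X_ge0 : forall u, 0 <= X u).
Hypotheses (c_gt0 : 0 < c) (M_ge0 : 0 <= M).
Hypothesis XY : forall u, A u -> c * X u ^+ 2 <= Y u.
Hypothesis Y_mean : (\int[nu]_u (Y u)%:E <= M%:E)%E.

Let Z u : R := c * X u ^+ 2 * \1_A u.

Let Z_ge0 u : 0 <= Z u.
Proof. by rewrite mulr_ge0 ?mulr_ge0 ?exprn_ge0 ?(ltW c_gt0) // indicE ler0n. Qed.

Let mZ : measurable_fun setT Z.
Proof.
apply: measurable_funM; last exact: measurable_indic.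
by apply: measurable_funM; [exact: measurable_cst|exact: measurable_funX].
Qed.

Let neg_mean : (\int[nu]_u ((EFin \o Y)^\- u) = 0)%E.
Proof.
apply/eqP; rewrite eq_le; apply/andP; split; last by apply: integral_ge0 => u _; exact: funeneg_ge0.
have <- : (\int[nu]_u ((cst +oo) \_ (~` A)) u = 0)%E.
  rewrite -integral_mkcond integral_cst; last exact: measurableC.
  by rewrite [X in (_ * X)%E]nuA mule0.
apply: ge0_integral_mono => u; first exact: funeneg_ge0.
rewrite /patch; case: ifPn => [_|]; first by rewrite leey.
rewrite notin_setE /= => /contrapT Au; rewrite funenegE (_ : point = 0%E) // ge_max lexx andbT /=.
by rewrite lee_fin oppr_le0 (le_trans _ (XY Au)) // mulr_ge0 ?exprn_ge0 // ltW.
Qed.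

Let Z_mean : (\int[nu]_u (Z u)%:E <= M%:E)%E.
Proof.
apply: le_trans Y_mean; rewrite [leRHS]integralE neg_mean sube0.
apply: ge0_integral_mono => u; first by rewrite lee_fin.
rewrite funeposE le_max /Z indicE; case: (boolP (u \in A)) => [|_].
  by rewrite inE => Au; rewrite mulr1 lee_fin XY.
by rewrite mulr0 lexx orbT.
Qed.

(* By AM-GM, X <= s / 2 + X ^ 2 / (2 s) with s the right-hand side.  Off the
   full-measure set A, the function Y is arbitrary and need not be measurable. *)
Lemma sqrt_moment_le : (\int[nu]_u (X u)%:E <= (Num.sqrt (M / c))%:E)%E.
Proof.
have amgm s : 0 < s -> (\int[nu]_u (X u)%:E <= (s / 2 + (2 * s * c)^-1 * M)%:E)%E.
  move=> s0; have sc0 : 0 < 2 * s * c by rewrite !mulr_gt0.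
  apply: (@le_trans _ _ (\int[nu]_u ((s / 2)%:E + ((2 * s * c)^-1)%:E * (Z u)%:E))%E).
    apply: ae_ge0_le_integral => //.
    - by move=> u _; rewrite lee_fin.
    - exact/measurable_EFinP.
    - move=> u _; apply: adde_ge0; first by rewrite lee_fin divr_ge0 // ltW.
      by rewrite -EFinM lee_fin mulr_ge0 // invr_ge0 ltW.
    - apply: emeasurable_funD; first exact: measurable_cst.
      by apply: emeasurable_funM; [exact: measurable_cst|exact/measurable_EFinP].
    exists (~` A); split => //; first exact: measurableC.
    move=> u /= /not_implyP[_ nXu] Au; apply: nXu.
    rewrite -EFinM -EFinD lee_fin /Z indicE mem_set // mulr1.
    have -> : s / 2 + (2 * s * c)^-1 * (c * X u ^+ 2) = X u + (s - X u) ^+ 2 / (2 * s).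
      by field; rewrite !gt_eqF.
    by rewrite lerDl divr_ge0 ?sqr_ge0 // mulr_ge0 // ltW.
  rewrite ge0_integralD //; last 3 first.
  - by move=> u _; rewrite lee_fin divr_ge0 // ltW.
  - by move=> u _; rewrite -EFinM lee_fin mulr_ge0 // invr_ge0 ltW.
  - by apply: emeasurable_funM; [exact: measurable_cst|exact/measurable_EFinP].
  rewrite integral_cst // [X in (_ * X)%E]probability_setT mule1 EFinD leeD2l //.
  rewrite ge0_integralZl_EFin //; last 3 first.
  - by move=> u _; rewrite lee_fin.
  - exact/measurable_EFinP.
  - by rewrite invr_ge0 ltW.
  by rewrite EFinM; apply: lee_wpmul2l => //; rewrite lee_fin invr_ge0 ltW.
have Mc : 0 <= M / c by rewrite divr_ge0 // ltW.
have [t0|t0] := ltP 0 (Num.sqrt (M / c)).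
  apply: le_trans (amgm _ t0) _; rewrite lee_fin.
  rewrite (_ : M = Num.sqrt (M / c) ^+ 2 * c); last by rewrite sqr_sqrtr // divfK // gt_eqF.
  have -> : Num.sqrt (M / c) ^+ 2 * c / c = M / c by rewrite sqr_sqrtr // mulfK // gt_eqF.
  rewrite le_eqVlt; apply/orP; left; apply/eqP.
  move: t0; set th := Num.sqrt _ => t0; field; rewrite !gt_eqF //.
(* The optimal [s] would be 0, which the AM-GM bound excludes; arbitrarily small positive values are
   used instead. *)
have M0 : M = 0.
  have /eqP : Num.sqrt (M / c) = 0 by apply/le_anti; rewrite t0 sqrtr_ge0.
  rewrite sqrtr_eq0 => h; have : M / c = 0 by apply/le_anti; rewrite h.
  by move/eqP; rewrite mulf_eq0 invr_eq0 (gt_eqF c_gt0) orbF => /eqP.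
apply/lee_addgt0Pr => e e0.
apply: le_trans (amgm _ e0) _; rewrite -EFinD lee_fin M0 mul0r sqrtr0 mulr0 addr0 add0r.
by rewrite ler_pdivrMr // ler_peMr ?(ltW e0) // ler1n.
Qed.

End SquareRootMoment.

(** * The abstract decay applied to the two-time-scale system *)

Section SystemDecay.
Context {R : realType} {d : measure_display} {Omega : measurableType d}.
Variables (P : probability Omega R) (n p m : nat).
Variables (mu : probability (borelType 'rV[R]_m) R) (v : nat -> Omega -> 'rV[R]_m).
Hypothesis v_iid : iid P mu v.
Variables (C D : set 'rV[R]_p) (f : 'rV[R]_n -> 'rV[R]_p -> R -> R -> 'rV[R]_n).
Variables (w : 'rV[R]_p -> 'rV[R]_p) (g : 'rV[R]_n -> 'rV[R]_p -> 'rV[R]_m -> 'rV[R]_n).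
Variables (h : 'rV[R]_p -> 'rV[R]_m -> 'rV[R]_p) (eps : R).
Let T4 : normedModType R := ('rV[R]_n * 'rV[R]_p * R * R)%type.
Variables (U : set T4) (F : T4 -> 'rV[R]_n).
Let K := C `|` D.
Hypothesis C1F : Ck_open 1 U F.
Hypothesis U_nonneg : forall x r (s e : R), 0 <= s -> 0 <= e -> U (x, r, s, e).
Hypothesis fF : forall x r (s e : R), 0 <= s -> 0 <= e -> f x r s e = F (x, r, s, e).
Hypotheses (cC : closed C) (cD : closed D) (cw : continuous w) (eps_gt0 : 0 < eps).
Hypothesis cg : continuous (fun q : 'rV[R]_n * 'rV[R]_p * 'rV[R]_m => g q.1.1 q.1.2 q.2).
Hypothesis ch : continuous (fun q : 'rV[R]_p * 'rV[R]_m => h q.1 q.2).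
Let H := two_time_scale_SHDS C D f w g h eps.
Let domH := flow_set H `|` jump_set H.
Hypothesis jump_K : forall x r u, D r -> values v u ->
  stack setT K (row_mx (g x r u) (h r u)).
Variables (y0 : 'rV[R]_(n + p + 1)) (y : Omega -> @hybrid_arc R (n + p + 1)).
Hypothesis y_sol : random_solution v H y0 y.

Lemma domHP z : domH z <-> K (state_r z) /\ 0 <= state_tau z.
Proof.
rewrite /domH /= /stack /= /state_r /state_tau /nonneg1 /=; split.
  by move=> [[[_ ?] ?]|[[_ ?] ?]]; split => //; [left|right].
by move=> [[Cr|Dr] ?]; [left|right].
Qed.

Lemma state_x_jump z u : state_x (jump_map H z u) = g (state_x z) (state_r z) u.
Proof. by rewrite /state_x /= !row_mxKl. Qed.

Lemma state_r_jump z u : state_r (jump_map H z u) = h (state_r z) u.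
Proof. by rewrite /state_r /= row_mxKl row_mxKr. Qed.

Lemma state_tau_jump z u : state_tau (jump_map H z u) = state_tau z.
Proof. by rewrite /state_tau /= row_mxKr mxE. Qed.

Let y_init om : arc_dom (y om) (0, 0%N) /\ y om 0 0%N = y0.
Proof. by case: y_sol => _ _ /(_ om)[]. Qed.

Let y_flows om j t1 t2 : arc_dom (y om) (t1, j) -> arc_dom (y om) (t2, j) -> t1 < t2 ->
  abs_continuous t1 t2 (fun t => y om t j) /\ flows_ae H `[t1, t2] (fun t => y om t j).
Proof.
move=> d1 d2 t12; split; last by case: y_sol => _ _ /(_ om)[_ fl _]; exact: fl.
apply: (@arc_lac _ _ (y om) j t1 t2 (ltW t12)) => t; rewrite /= in_itv /= => /andP[t1t tt2].
exact: (htd_convex (arc_domP (y om)) d1 d2).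
Qed.

Let y_jumps om t j : arc_dom (y om) (t, j) -> arc_dom (y om) (t, j.+1) ->
  jump_set H (y om t j) /\ y om t j.+1 = jump_map H (y om t j) (v j om).
Proof. by case: y_sol => _ _ /(_ om)[_ _]; exact. Qed.

Let y_flow_set om j t1 t2 t : arc_dom (y om) (t1, j) -> arc_dom (y om) (t2, j) -> t1 < t2 ->
  t1 <= t -> t <= t2 -> flow_set H (y om t j).
Proof.
move=> d1 d2 t12 t1t tt2; have [acy fy] := y_flows d1 d2 t12.
have [x [xd [r [tau [_ rC tau0 _ [_ pathE]]]]]] :=
  flow_path C1F U_nonneg fF cC cw eps_gt0 t12 acy fy.
have [_ rE tE] := pathE t t1t tt2.
by split; [split => //; rewrite -[rsubmx _]/(state_r _) -rE
  |rewrite /nonneg1 /= -[rsubmx _ _ _]/(state_tau _) -tE].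
Qed.

Let y_tau om j t1 t2 : arc_dom (y om) (t1, j) -> arc_dom (y om) (t2, j) -> t1 <= t2 ->
  state_tau (y om t2 j) - state_tau (y om t1 j) = (t2 - t1) / eps.
Proof.
rewrite le_eqVlt => d1 d2 /predU1P[->|t12]; first by rewrite !subrr mul0r.
have [acy fy] := y_flows d1 d2 t12.
exact: (flow_tau C1F U_nonneg fF cC cw eps_gt0 t12 acy fy (lexx _) (ltW t12) (lexx _)).
Qed.

Let dom_ge0 om t j : arc_dom (y om) (t, j) -> 0 <= t.
Proof. by have [h0 _] := arc_domP (y om); move/h0. Qed.

(* The flow time is a function of the state: tau' = 1 / eps and jumps fix tau. *)
Definition clock (z : 'rV[R]_(n + p + 1)) : R := eps * (state_tau z - state_tau y0).

Lemma clock_time om t j : arc_dom (y om) (t, j) -> clock (y om t j) = t.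
Proof.
have [d0 y00] := y_init om.
rewrite /clock; elim: j t => [|j IH] t dt.
  have := y_tau d0 dt (dom_ge0 dt); rewrite y00 subr0 => ->.
  by rewrite mulrC divfK // gt_eqF.
have [s [st ds ds1 _]] := htd_pred (arc_domP (y om)) dt.
have [_ yj] := y_jumps ds ds1.
have := y_tau ds1 dt st; rewrite yj state_tau_jump => tauE.
have := IH s ds; have -> : state_tau (y om t j.+1) - state_tau y0 =
  (state_tau (y om t j.+1) - state_tau (y om s j)) + (state_tau (y om s j) - state_tau y0).
  by rewrite addrA subrK.
by move=> hs; rewrite mulrDr hs tauE [eps * (_ / eps)]mulrC divfK ?gt_eqF // subrK.
Qed.

(** Every point except the initial one is reached by a nontrivial flow, which stays in the closed
    flow set, or by a jump, which lands in [K] by assumption and does not change [tau]. *)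
Lemma solution_in_domain om t j : arc_dom (y om) (t, j) ->
  domH y0 \/ (t, j) <> (0, 0%N) -> domH (y om t j).
Proof.
have [d0 y00] := y_init om; case: j => [|j] dt hyp.
  have := dom_ge0 dt; rewrite le_eqVlt => /predU1P[t0|t0].
    by case: hyp => [|/(_ _)/[!t0]//]; rewrite -t0 y00.
  by left; exact: (y_flow_set d0 dt t0 (ltW t0) (lexx _)).
have [s [st ds ds1 _]] := htd_pred (arc_domP (y om)) dt.
move: st; rewrite le_eqVlt => /predU1P[st|st]; last first.
  by left; exact: (y_flow_set ds1 dt st (ltW st) (lexx _)).
have [[[_ Dr] t0] yj] := y_jumps ds ds1; rewrite -st yj; apply/domHP.
rewrite state_r_jump state_tau_jump; split => //.
have vu : values v (v j om) by exists j, om.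
by have [_] := jump_K (state_x (y om s j)) Dr vu; rewrite row_mxKr.
Qed.

(** A flow of positive length would put the initial state in the closed flow set, and a jump would
    put it in the jump set. *)
Lemma start_outside_domain om t j : ~ domH y0 -> arc_dom (y om) (t, j) -> (t, j) = (0, 0%N).
Proof.
have [d0 y00] := y_init om; move=> ny0; elim: j t => [|j IH] t dt.
  have := dom_ge0 dt; rewrite le_eqVlt => /predU1P[<-//|t0].
  by case: ny0; left; rewrite -y00; exact: (y_flow_set d0 dt t0 (lexx _) (ltW t0)).
have [s [st ds ds1 _]] := htd_pred (arc_domP (y om)) dt.
have [s0 j0] := IH s ds; case: ny0; right; rewrite -y00.
by have [] := y_jumps ds ds1; rewrite s0 j0.
Qed.

Variables (V : 'rV[R]_(n + p) -> R) (c1 c2 c5 k Lg : R).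
Hypotheses (c1_gt0 : 0 < c1) (c2_gt0 : 0 < c2) (c5_gt0 : 0 < c5).
Hypothesis V_ge : forall x r, K r -> c1 * enorm x ^+ 2 <= V (row_mx x r).
Hypothesis V_le : forall x r, K r -> V (row_mx x r) <= c2 * enorm x ^+ 2.
Hypothesis V_jump : forall z, stack setT D z ->
  (\int[mu]_u (V (Gave g h z u))%:E <= (c5 * V z)%:E)%E.
Hypothesis lambda_lt : c2 / c1 * c5 < 2^-1.
Hypothesis Lg_ge0 : 0 <= Lg.
Hypothesis g_lip : forall x r u, D r -> values v u -> enorm (g x r u) <= Lg * enorm x.
Hypothesis k_le : k <= 11^-1.

Variables (O : set 'rV[R]_(n + p + 1)) (Kn : nat -> set 'rV[R]_(n + p + 1)).
Hypothesis Kn_compact : forall i, compact (Kn i).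
Hypothesis OE : O = \bigcup_i Kn i.
Hypothesis V_flow : forall (z : R -> 'rV[R]_(n + p + 1)) (a b : R), a < b ->
  abs_continuous a b z -> flows_ae H `[a, b] z ->
  (forall t, a <= t -> t <= b -> ~ O (z t)) ->
  V (lsubmx (z b)) * expR (2 * k * b) <= 121 / 100 * (V (lsubmx (z a)) * expR (2 * k * a)).

Let X (z : 'rV[R]_(n + p + 1)) : R := enorm (state_x z).
Let W (z : 'rV[R]_(n + p + 1)) : R := Num.sqrt (V (lsubmx z)).
Let Kc : R := 11 / 10 * Num.sqrt c2.
Let K2 : R := Num.max 1 (Kc / Num.sqrt c1).
Let c : R := Num.sqrt (c5 / c1).

Let V_bounds z : domH z -> c1 * X z ^+ 2 <= V (lsubmx z) /\ V (lsubmx z) <= c2 * X z ^+ 2.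
Proof.
move=> /domHP[Kr _]; rewrite -[lsubmx z]hsubmxK /X /state_x.
by split; [exact: V_ge|exact: V_le].
Qed.

Let X_W z : domH z -> X z <= W z / Num.sqrt c1.
Proof.
move=> /V_bounds[h1 _]; rewrite ler_pdivlMr ?sqrtr_gt0 //.
rewrite -(@ger0_norm _ (X z)) ?enorm_ge0 // -sqrtr_sqr -sqrtrM ?sqr_ge0 // mulrC.
by rewrite ler_sqrt // (le_trans _ h1) // mulr_ge0 ?sqr_ge0 // ltW.
Qed.

Let W_X z : domH z -> W z <= Num.sqrt c2 * X z.
Proof.
move=> /V_bounds[_ h2].
rewrite -(@ger0_norm _ (X z)) ?enorm_ge0 // -sqrtr_sqr -sqrtrM ?(ltW c2_gt0) //.
by rewrite ler_sqrt // mulr_ge0 ?sqr_ge0 // ltW.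
Qed.

(** The root of [V_flow]: the rate [2 * k] becomes [k] and the factor 121/100 becomes 11/10. *)
Let flow_bound om j t1 t2 : domH y0 -> t1 <= t2 ->
  arc_dom (y om) (t1, j) -> arc_dom (y om) (t2, j) ->
  (forall t, t1 <= t -> t <= t2 -> ~ O (y om t j)) ->
  W (y om t2 j) * expR (k * t2) <= Kc * (X (y om t1 j) * expR (k * t1)) /\
  X (y om t2 j) * expR (k * t2) <= K2 * (X (y om t1 j) * expR (k * t1)).
Proof.
move=> y0d t12 d1 d2 nO.
have D1 := solution_in_domain d1 (or_introl y0d); have D2 := solution_in_domain d2 (or_introl y0d).
have e1 := expR_gt0 (k * t1); have e2 := expR_gt0 (k * t2).
have s1 : 0 < Num.sqrt c1 by rewrite sqrtr_gt0.
have s2 : 0 < Num.sqrt c2 by rewrite sqrtr_gt0.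
have X0 z : 0 <= X z by exact: enorm_ge0.
have first : W (y om t2 j) * expR (k * t2) <= Kc * (X (y om t1 j) * expR (k * t1)).
  have [t12'|t12'] := ltP t1 t2; last first.
    have -> : t2 = t1 by apply/le_anti; rewrite t12' t12.
    rewrite mulrA ler_pM2r // (le_trans (W_X D1)) // ler_wpM2r // /Kc.
    by rewrite ler_peMl // ?(ltW s2) //; lra.
  have [acy fy] := y_flows d1 d2 t12'.
  have hV := V_flow t12' acy fy nO.
  have [_ hV1] := V_bounds D1; have [hV2 _] := V_bounds D2.
  rewrite /W -(@ger0_norm _ (expR (k * t2))) ?(ltW e2) // -sqrtr_sqr -sqrtrM; last first.
    by rewrite (le_trans _ hV2) // mulr_ge0 ?sqr_ge0 // ltW.
  have -> : Kc * (X (y om t1 j) * expR (k * t1)) =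
     Num.sqrt (121 / 100 * (c2 * X (y om t1 j) ^+ 2 * expR (k * t1) ^+ 2)).
    have -> : 121 / 100 * (c2 * X (y om t1 j) ^+ 2 * expR (k * t1) ^+ 2) =
       c2 * (11 / 10 * (X (y om t1 j) * expR (k * t1))) ^+ 2 by field.
    rewrite sqrtrM ?(ltW c2_gt0) // sqrtr_sqr ger0_norm; last by rewrite !mulr_ge0 // ltW.
    by rewrite /Kc; ring.
  rewrite ler_sqrt; last by rewrite !mulr_ge0 // ?sqr_ge0 // ltW.
  have sq t : expR (k * t) ^+ 2 = expR (2 * k * t).
    by rewrite expr2 -expRD; congr expR; ring.
  rewrite !sq; apply: le_trans hV _; apply: ler_wpM2l; first by lra.
  by apply: ler_wpM2r; [exact: expR_ge0|].
split => //.
apply: (@le_trans _ _ (Kc / Num.sqrt c1 * (X (y om t1 j) * expR (k * t1)))); last first.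
  apply: ler_wpM2r; first by rewrite mulr_ge0 // ltW.
  by rewrite /K2 le_max lexx orbT.
have -> : Kc / Num.sqrt c1 * (X (y om t1 j) * expR (k * t1)) =
  Kc * (X (y om t1 j) * expR (k * t1)) / Num.sqrt c1 by ring.
rewrite ler_pdivlMr //; apply: le_trans first.
rewrite mulrAC ler_pM2r // -ler_pdivlMr //; exact: X_W.
Qed.

(** The invariance assumption concerns the values taken by the inputs, while the mean is an integral
    against [mu]. Since [mu] is the law of [v 0], and [v 0] never falls outside [A], the complement
    of [A] is null. *)
Let mu_jump_K r : D r -> exists2 A : set (borelType 'rV[R]_m),
  measurable A & mu (~` A) = 0%E /\ forall u, A u <-> K (h r u).
Proof.
move=> Dr; pose A : set (borelType 'rV[R]_m) := [set u | K (h r u)].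
have mA : measurable A.
  have oA : open (~` ([set u | K (h r u)] : set 'rV[R]_m)).
    apply: closed_openC; apply: (closed_preimage (f := fun u => h r u)).
      by apply: (continuous_compf (f := fun u => (r, u)) (g := fun q : 'rV[R]_p * 'rV[R]_m => h q.1 q.2) _ ch);
        apply: continuous_pairf; [exact: continuous_cstf|exact: continuous_idf].
    exact: closedU.
  by rewrite -[A]setCK; apply: measurableC; exact: sub_sigma_algebra oA.
exists A => //; split => //.
have [_ vP _] := v_iid.
rewrite -(vP 0%N (~` A)); last exact: measurableC.
rewrite (_ : _ @^-1` _ = set0) ?measure0 //; apply/seteqP; split => // om /=; apply.
have vu : values v (v 0%N om) by exists 0%N, om.
by have [_] := jump_K 0 Dr vu; rewrite row_mxKr.
Qed.

Let jump_mean z : jump_set H z -> (\int[mu]_u (X (jump_map H z u))%:E <= (c * W z)%:E)%E.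
Proof.
move=> Jz; have Dz : domH z by right.
case: Jz => -[_ Dr] t0; have [A mA [muA AE]] := mu_jump_K Dr.
have [V1 V2] := V_bounds Dz.
have V0 : 0 <= V (lsubmx z) by rewrite (le_trans _ V1) // mulr_ge0 ?sqr_ge0 // ltW.
have -> : c * W z = Num.sqrt (c5 * V (lsubmx z) / c1).
  by rewrite /c /W -sqrtrM ?divr_ge0 ?(ltW c5_gt0) ?(ltW c1_gt0) // mulrAC.
apply: (@sqrt_moment_le _ _ _ mu A _ (fun u => V (Gave g h (lsubmx z) u))) => //.
- apply: measurable_borel_continuous.
  rewrite (_ : (fun u => _) = fun u => enorm (g (state_x z) (state_r z) u)); last first.
    by apply/funext => u; rewrite /X state_x_jump.
  apply: (continuous_compf (g := fun x : 'rV[R]_n => enorm x)); last exact: continuous_enorm.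
  apply: (continuous_compf (g := fun q : 'rV[R]_n * 'rV[R]_p * 'rV[R]_m => g q.1.1 q.1.2 q.2)
    (f := fun u => (state_x z, state_r z, u)) _ cg).
  by apply: continuous_pairf; [exact: continuous_cstf|exact: continuous_idf].
- by move=> u; exact: enorm_ge0.
- by rewrite mulr_ge0 // ltW.
- by move=> u /AE Ku; rewrite /X state_x_jump; exact: V_ge.
- by apply: V_jump; split.
Qed.

(** From [1 - k <= expR (- k)] and [1 - k >= 10 / 11]. *)
Lemma expR_le_11_10 : expR k <= 11 / 10.
Proof.
have := expR_ge1Dx (- k); rewrite expRN => h1; have k1 := k_le.
have h2 : 10 / 11 <= (expR k)^-1 by lra.
by rewrite -[leLHS]invrK -[leRHS]invrK lef_pV2 ?posrE ?invr_gt0 ?expR_gt0 //; lra.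
Qed.

(* (11 / 10) ^ 2 * sqrt (1 / 2) < 86 / 100 *)
Let contraction : expR k * c * Kc <= 86 / 100.
Proof.
have l0 : 0 <= c2 / c1 * c5 by rewrite mulr_ge0 ?divr_ge0 ?(ltW c1_gt0) ?(ltW c2_gt0) ?(ltW c5_gt0).
have -> : expR k * c * Kc = expR k * (11 / 10 * Num.sqrt (c2 / c1 * c5)).
  have -> : Num.sqrt (c2 / c1 * c5) = c * Num.sqrt c2.
    by rewrite /c -sqrtrM ?divr_ge0 ?(ltW c5_gt0) ?(ltW c1_gt0) //; congr Num.sqrt; ring.
  by rewrite /Kc; ring.
have s0 : Num.sqrt (c2 / c1 * c5) <= 71 / 100.
  rewrite -[leRHS]ger0_norm; last by lra.
  by rewrite -sqrtr_sqr ler_sqrt ?sqr_ge0 //; have l1 := lambda_lt; lra.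
have := expR_le_11_10 => e1; have e0 := expR_gt0 k; have s1 := sqrtr_ge0 (c2 / c1 * c5).
apply: (@le_trans _ _ (11 / 10 * (11 / 10 * (71 / 100)))); last by lra.
by apply: ler_pM => //; rewrite ?mulr_ge0 ?(ltW e0) //; lra.
Qed.

(** With [q] = 86/100 these numbers satisfy 0.86 * 1.07 = 0.9202 < 0.93 and 0.86 * (0.93 + 0.07) =
    0.86 < 0.93 ^ 2 = 0.8649. [M] is chosen so that [delta * M] exceeds the factor of a Lipschitz
    jump, the added 1 giving [M >= 1]. *)
Let delta : R := 7 / 100.
Let rho : R := 93 / 100.
Let M : R := Lg * K2 * expR k / delta + 1.

Definition majorant_constant : R := K2 * (1 + delta) * M / (1 - rho).

Let K2_ge1 : 1 <= K2. Proof. by rewrite /K2 le_max lexx. Qed.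

Let delta_gt0 : 0 < delta. Proof. by rewrite /delta; lra. Qed.

Let M_ge1 : 1 <= M.
Proof.
by rewrite /M lerDr !mulr_ge0 ?expR_ge0 ?invr_ge0 ?(ltW delta_gt0) // (le_trans ler01 K2_ge1).
Qed.

Lemma majorant_constant_gt0 : 0 < majorant_constant.
Proof.
have K21 := K2_ge1; have M1 := M_ge1; have d0 := delta_gt0.
have r0 : 0 < 1 - rho by rewrite /rho; lra.
apply: divr_gt0 => //; apply: mulr_gt0; last by lra.
by apply: mulr_gt0; lra.
Qed.

Lemma system_majorant (th : \bar R) : domH y0 -> exists B : Omega -> \bar R,
  [/\ measurable_fun setT B, forall om, (0 <= B om)%E,
     (\int[P]_om B om <= (majorant_constant * enorm (state_x y0))%:E)%E
   & forall om t j, arc_dom (y om) (t, j) -> ((t + j%:R)%:E <= th)%E ->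
     (forall t' j', arc_dom (y om) (t', j') -> ((t' + j'%:R)%:E <= th)%E -> ~ O (y om t' j')) ->
     ((enorm (state_x (y om t j)) * expR (k * (t + j%:R)))%:E <= B om)%E].
Proof.
move=> y0d.
have XG : continuous (fun z : 'rV[R]_(n + p + 1) * 'rV[R]_m => X (jump_map H z.1 z.2)).
  rewrite (_ : (fun z => _) = fun z => enorm (g (state_x z.1) (state_r z.1) z.2)); last first.
    by apply/funext => z; rewrite /X state_x_jump.
  apply: (continuous_compf (g := fun x : 'rV[R]_n => enorm x)); last exact: continuous_enorm.
  apply: (continuous_compf (g := fun q : 'rV[R]_n * 'rV[R]_p * 'rV[R]_m => g q.1.1 q.1.2 q.2)
    (f := fun z : 'rV[R]_(n + p + 1) * 'rV[R]_m => (state_x z.1, state_r z.1, z.2)) _ cg).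
  have c1' : continuous (fun z : 'rV[R]_(n + p + 1) * 'rV[R]_m => z.1).
    by apply: continuous_fstf; exact: continuous_idf.
  apply: continuous_pairf; last by apply: continuous_sndf; exact: continuous_idf.
  by apply: continuous_pairf;
    [exact: (continuous_compf c1' (@continuous_state_x R n p))
    |exact: (continuous_compf c1' (@continuous_state_r R n p))].
have ctm : continuous clock.
  apply: continuous_mulf; first exact: continuous_cstf.
  by apply: continuous_subf; [exact: continuous_state_tau|exact: continuous_cstf].
have cJ : closed (jump_set H) by apply: closed_stack (closed_stack closedT cD) closed_nonneg1.
have jl z u : jump_set H z -> values v u -> X (jump_map H z u) <= Lg * X z.
  by move=> [[_ Dr] _] vu; rewrite /X state_x_jump; exact: g_lip.
have LK : Lg * K2 * expR k <= delta * M.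
  have -> : delta * M = Lg * K2 * expR k + delta.
    by rewrite /M mulrDr mulr1 [delta * (_ / delta)]mulrC divfK // gt_eqF // delta_gt0.
  by rewrite lerDl ltW // delta_gt0.
have [B [mB B0 iB hB]] := @decay_majorant R d Omega P m mu v v_iid _ H y0 y y_sol X W clock
  k Kc K2 Lg c (86 / 100) delta rho M (fun z => enorm_ge0 _) cJ ctm XG O Kn Kn_compact OE th
  jump_mean jl (sqrtr_ge0 _) K2_ge1 Lg_ge0 ltac:(lra) contraction delta_gt0 M_ge1 LK
  ltac:(rewrite /rho; lra) ltac:(rewrite /rho /delta; lra) ltac:(rewrite /rho /delta; lra)
  clock_time (fun om j t1 t2 => @flow_bound om j t1 t2 y0d).
exists B; split=> //; apply: le_trans iB _; rewrite lee_fin /X /majorant_constant; lra.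
Qed.

End SystemDecay.

(** * Points near a time horizon, and the tube around the attractor *)

Section Recurrence.
Context {R : realType}.

(** Flows move [t + j] continuously and a jump raises it by 1, so it cannot skip a closed interval
    of length 1. *)
Lemma htd_window (E : set (R * nat)) (theta t : R) j : hybrid_time_domain E -> E (0, 0%N) ->
  0 <= theta -> E (t, j) -> theta <= t + j%:R ->
  exists t' j', E (t', j') /\ theta - 1 <= t' + j'%:R <= theta.
Proof.
move=> hE E0 theta0; elim: j t => [|j IH] t Et.
  rewrite addr0 => tt; exists theta, 0%N; rewrite addr0 lexx andbT; split; last by lra.
  exact: (htd_convex hE E0 Et).
move=> tt; have [s [st Es Es1 _]] := htd_pred hE Et.
have [h1|h1] := leP theta (s + j%:R); first exact: IH h1.
have [h2|h2] := leP (s + j.+1%:R) theta.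
  exists (theta - j.+1%:R), j.+1; rewrite subrK lexx andbT; split; last by lra.
  by apply: (htd_convex hE Es1 Et); lra.
exists s, j; split => //; move: h2; rewrite -natr1 => h2; apply/andP; split; lra.
Qed.

Lemma hit_closed_graph {d : measure_display} {Omega : measurableType d} N
    (Y : Omega -> set (R * R * 'rV[R]_N)) (A : set (R * R * 'rV[R]_N)) :
  (forall om, closed (Y om)) -> set_measurable measurable Y -> closed A ->
  measurable [set om | Y om `&` A !=set0].
Proof.
move=> cY mY cA.
pose box i := ((`[- i%:R, i%:R] `*` `[- i%:R, i%:R] : set (R * R)%type) `*` @rV_ball R N i).
apply: (@hit_bigcup R _ _ _ Y A (fun i => box i `&` A)) => //.
  move=> i; apply: compact_closedI => //; apply: compact_setX; last exact: rV_ball_compact.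
  by apply: compact_setX; exact: segment_compact.
apply/seteqP; split=> [[[s t] z] Aq|q [i _ []]] //.
exists (Num.truncn (`|s| + `|t| + `|z|)).+1 => //; split => //=.
have /ltW h := truncnS_gt (`|s| + `|t| + `|z|).
have ns := normr_ge0 s; have nt := normr_ge0 t; have nz := normr_ge0 z.
rewrite /box /rV_ball /= !in_itv /= -!ler_norml.
by split; [split|]; apply: le_trans h; lra.
Qed.

Section NearSet.
Variables n p : nat.
Variables (C D : set 'rV[R]_p).
Let K := C `|` D.
Hypothesis cK : closed K.

Definition near_attractor (phi : R) : set 'rV[R]_(n + p + 1) :=
  [set z | [/\ enorm (state_x z) < phi, K (state_r z) & 0 <= state_tau z]].

(** Closed sets exhausting the tube, which is open in the state domain; they are empty as long as
    the radius is negative. *)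
Definition near_attractor_core (phi : R) (i : nat) : set 'rV[R]_(n + p + 1) :=
  [set z | [/\ enorm (state_x z) <= phi - i.+1%:R^-1, K (state_r z) & 0 <= state_tau z]].

Lemma closed_near_attractor_core phi i : closed (near_attractor_core phi i).
Proof.
rewrite (_ : near_attractor_core phi i =
  [set z | enorm (state_x z) <= phi - i.+1%:R^-1] `&`
  (@state_r R n p @^-1` K `&` [set z | 0 <= state_tau z])).
  apply: closedI.
    apply: (closed_preimage (f := fun z => enorm (state_x z)) _ (@closed_le R _)).
    exact: continuous_compf (@continuous_state_x R n p) (@continuous_enorm R n).
  apply: closedI.
    exact: closed_preimage (@continuous_state_r R n p) cK.
  exact: (closed_preimage (@continuous_state_tau R n p) (@closed_ge R 0)).
by apply/seteqP; split=> z /=; [move=> [? ? ?]|move=> [? [? ?]]].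
Qed.

Lemma near_attractor_bigcup phi : near_attractor phi = \bigcup_i near_attractor_core phi i.
Proof.
apply/seteqP; split=> z; last first.
  move=> [i _ [xi Kr t0]]; split => //; apply: le_lt_trans xi _.
  by rewrite gtrBl invr_gt0.
move=> [x_phi Kr t0]; pose e := (phi - enorm (state_x z))^-1.
have e0 : 0 < phi - enorm (state_x z) by rewrite subr_gt0.
exists (Num.truncn e) => //; split => //.
rewrite lerBrDr -lerBrDl -[leRHS]invrK lef_pV2 ?posrE ?invr_gt0 //.
exact/ltW/truncnS_gt.
Qed.

Lemma near_attractor_compact_bigcup phi : exists Kn : nat -> set 'rV[R]_(n + p + 1),
  (forall i, compact (Kn i)) /\ near_attractor phi = \bigcup_i Kn i.
Proof.
exists (fun i => @rV_ball R _ i `&` near_attractor_core phi i); split.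
  by move=> i; apply: compact_closedI; [exact: rV_ball_compact|exact: closed_near_attractor_core].
rewrite near_attractor_bigcup; apply/seteqP; split=> z [i _]; last by move=> [_ zi]; exists i.
move=> [xi Kr t0]; pose j := maxn i (Num.truncn `|z|).+1.
exists j => //; split; last first.
  split => //; apply: le_trans xi _; rewrite lerB // lef_pV2 ?posrE ?ltr0n // ler_nat ltnS.
  exact: leq_maxl.
rewrite /rV_ball /=; apply: (@le_trans _ _ ((Num.truncn `|z|).+1)%:R); first exact/ltW/truncnS_gt.
by rewrite ler_nat leq_maxr.
Qed.

Lemma attractor_nbhd phi (z : 'rV[R]_(n + p + 1)) : K (state_r z) -> 0 <= state_tau z ->
  stack (set_sum (attractor C D) (oball phi)) nonneg1 z <-> enorm (state_x z) < phi.
Proof.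
move=> Kr t0; split.
  move=> [[a [a0 _] [b bphi zab]] _].
  have -> : state_x z = lsubmx b by rewrite /state_x -zab linearD /= a0 add0r.
  by apply: le_lt_trans bphi; rewrite -{2}(hsubmxK b) enorm_row_mxl.
move=> xphi; split=> //=.
exists (row_mx 0 (state_r z)); first by split; rewrite /= ?row_mxKl ?row_mxKr.
exists (row_mx (state_x z) 0); first by rewrite /oball /= enorm_row_mx0.
by rewrite add_row_mx add0r addr0 hsubmxK.
Qed.

End NearSet.
End Recurrence.

(** * Recurrence by Markov's inequality *)

Section UniformRecurrence.
Context {R : realType} {d : measure_display} {Omega : measurableType d}.
Variables (P : probability Omega R) (N m : nat) (v : nat -> Omega -> 'rV[R]_m).
Variables (H : SHDS R N m) (X : 'rV[R]_N -> R) (phi k Cst : R).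
Variables (O : set 'rV[R]_N) (S : nat -> set 'rV[R]_N).
Let domH := flow_set H `|` jump_set H.
Hypotheses (phi_gt0 : 0 < phi) (k_gt0 : 0 < k) (Cst_ge0 : 0 <= Cst).
Hypothesis X_le : forall z, 0 <= X z <= enorm z.
Hypothesis S_closed : forall i, closed (S i).
Hypothesis OS : O `&` domH = \bigcup_i S i.
Hypothesis far : forall z, domH z -> ~ O z -> phi <= X z.
Hypothesis in_domain : forall y0 y om t j, random_solution v H y0 y -> domH y0 ->
  arc_dom (y om) (t, j) -> domH (y om t j).
Hypothesis outside : forall y0 y om t j, random_solution v H y0 y -> ~ domH y0 ->
  arc_dom (y om) (t, j) -> (t, j) = (0, 0%N).
Hypothesis majorant : forall y0 y th, random_solution v H y0 y -> domH y0 ->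
  exists B : Omega -> \bar R,
  [/\ measurable_fun setT B, forall om, (0 <= B om)%E,
     (\int[P]_om B om <= (Cst * X y0)%:E)%E
   & forall om t j, arc_dom (y om) (t, j) -> ((t + j%:R)%:E <= th)%E ->
     (forall t' j', arc_dom (y om) (t', j') -> ((t' + j'%:R)%:E <= th)%E -> ~ (O `&` domH) (y om t' j')) ->
     ((X (y om t j) * expR (k * (t + j%:R)))%:E <= B om)%E].

Let event theta (y : Omega -> @hybrid_arc R N) := [set om | graph (y om) `<=` Gamma_lt theta `*` setT \/
  graph (y om) `&` (Gamma_le theta `*` (O `&` domH)) !=set0].

Let late theta (y : Omega -> @hybrid_arc R N) :=
  [set om | graph (y om) `&` [set q | theta <= q.1.1 + q.1.2] !=set0].

Let hits theta (y : Omega -> @hybrid_arc R N) :=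
  [set om | graph (y om) `&` (Gamma_le theta `*` (O `&` domH)) !=set0].

Let eventE theta y : event theta y = ~` (late theta y `\` hits theta y).
Proof.
rewrite setDE setCI setCK; apply/seteqP; split=> om /= [h|h]; [left|by right|left|by right].
  move=> [[[s t] z] [/h [st _] /=]]; apply/negP; rewrite -ltNge; exact: st.
move=> [[s t] z] gq; split => //; rewrite /Gamma_lt /= ltNge; apply/negP => st.
by apply: h; exists (s, t, z).
Qed.

Let continuous_sum : continuous (fun q : R * R * 'rV[R]_N => q.1.1 + q.1.2).
Proof.
have c1 : continuous (fun q : R * R * 'rV[R]_N => q.1).
  by apply: continuous_fstf; exact: continuous_idf.
by apply: continuous_addf; [exact: continuous_fstf|exact: continuous_sndf].
Qed.

Let measurable_late theta y0 y : random_solution v H y0 y -> measurable (late theta y).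
Proof.
move=> [[cy my] _ _]; apply: hit_closed_graph => //.
exact: (closed_preimage continuous_sum (@closed_ge R theta)).
Qed.

Let measurable_hits theta y0 y : random_solution v H y0 y -> measurable (hits theta y).
Proof.
move=> [[cy my] _ _].
rewrite (_ : hits theta y = \bigcup_i [set om | graph (y om) `&`
   [set q | q.1.1 + q.1.2 <= theta /\ S i q.2] !=set0]).
  apply: bigcupT_measurable => i; apply: hit_closed_graph => //.
  rewrite (_ : mkset _ = [set q : R * R * 'rV[R]_N | q.1.1 + q.1.2 <= theta] `&` (fun q => q.2) @^-1` S i) //.
  apply: closedI; first exact: (closed_preimage continuous_sum (@closed_le R theta)).
  by apply: closed_preimage => //; apply: continuous_sndf; exact: continuous_idf.
rewrite /hits OS; apply/seteqP; split=> om /=.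
  by move=> [q [gq [st [i _ Sq]]]]; exists i => //; exists q.
by move=> [i _ [q [gq [st Sq]]]]; exists q; split => //; split => //; exists i.
Qed.

Lemma recurrence_of_majorant (rho r : R) : 0 < rho -> 0 < r -> exists2 theta : R, 0 <= theta &
  forall y0 y, cball r y0 -> random_solution v H y0 y ->
  ((1 - rho)%:E <= P (event theta y))%E.
Proof.
(* A path that outlasts [theta] without a hit has a point with [t + j >= theta - 1] and [X >= phi],
   so its majorant is at least [phi * expR (k * (theta - 1))], that is [phi * expR Q]. Since [Cst *
   r = phi * Q * rho <= phi * expR Q * rho], Markov's inequality gives such paths a probability of
   at most [rho]. *)
move=> rho0 r0; pose Q := Cst * r / (phi * rho).
have Q0 : 0 <= Q by rewrite divr_ge0 ?mulr_ge0 // ltW.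
pose theta := 1 + Q / k.
have theta1 : 1 <= theta by rewrite lerDl divr_ge0 // ltW.
exists theta; first exact: le_trans theta1.
move=> y0 y ry0 ysol; have yinit om : arc_dom (y om) (0, 0%N) by case: ysol => _ _ /(_ om)[[]].
have mlate := @measurable_late theta y0 y ysol; have mhits := @measurable_hits theta y0 y ysol.
have mbad : measurable (late theta y `\` hits theta y) by exact: measurableD.
rewrite eventE probability_setC // EFinB; apply: leeB => //.
have [y0d|y0d] := pselect (domH y0); last first.
  (* From outside the domain the arc consists of its initial point, and [theta >= 1] excludes it
     from the late event. *)
  rewrite (_ : _ `\` _ = set0) ?measure0 ?lee_fin ?ltW //.
  apply/seteqP; split=> // om [[[[s t] z] [[j [dj /= jE _]] /= st]] _].
  have [s0 j0] := outside ysol y0d dj; move: st; rewrite jE s0 j0 addr0; apply/negP.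
  by rewrite -ltNge (lt_le_trans ltr01).
have [B [mB B0 iB hB]] := majorant theta%:E ysol y0d.
pose a := phi * expR (k * (theta - 1)).
have a0 : 0 < a by rewrite mulr_gt0 ?expR_gt0.
have sub : late theta y `\` hits theta y `<=` setT `&` [set om | (a%:E <= `|B om|)%E].
  move=> om [[[[s t] z] [[j [dj /= jE _]] /= st]] nhit]; split => //=.
  rewrite jE in st.
  have nO t' j' : arc_dom (y om) (t', j') -> ((t' + j'%:R)%:E <= theta%:E)%E ->
      ~ (O `&` domH) (y om t' j').
    move=> dj' tj' Oy; apply: nhit; exists (t', j'%:R, y om t' j'); split; first by exists j'.
    by split => //=; rewrite /Gamma_le /= -lee_fin.
  have [t' [j' [dj' /andP[h1 h2]]]] := htd_window (arc_domP (y om)) (yinit om)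
    (le_trans ler01 theta1) dj st.
  have h2' : ((t' + j'%:R)%:E <= theta%:E)%E by rewrite lee_fin.
  have yd := in_domain ysol y0d dj'.
  rewrite gee0_abs //; apply: le_trans (hB om t' j' dj' h2' nO); rewrite lee_fin.
  apply: ler_pM; [exact: ltW|exact: expR_ge0| |].
    by apply: far => // Oy; apply: (nO _ _ dj' h2').
  by rewrite ler_expR ler_pM2l.
have mk := le_integral_abse P measurableT mB a0.
have mset : measurable (setT `&` [set om | (a%:E <= `|B om|)%E]).
  by apply: emeasurable_fun_c_infty => //; exact: measurableT_comp.
have Pbad : (a%:E * P (late theta y `\` hits theta y) <= (a * rho)%:E)%E.
  apply: (@le_trans _ _ (a%:E * P (setT `&` [set om | (a%:E <= `|B om|)%E]))%E).
    by apply: lee_wpmul2l; [rewrite lee_fin ltW|apply: le_measure; rewrite ?inE].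
  apply: (le_trans mk); under eq_integral do rewrite gee0_abs //.
  apply: (le_trans iB); rewrite lee_fin.
  apply: (@le_trans _ _ (Cst * r)).
    apply: ler_wpM2l => //; have /andP[_ h1] := X_le y0; exact: le_trans h1 ry0.
  have -> : Cst * r = phi * Q * rho by rewrite /Q; field; rewrite !gt_eqF.
  rewrite ler_pM2r // /a ler_pM2l // /theta addrAC subrr add0r mulrC divfK ?gt_eqF //.
  by have := expR_ge1Dx Q; lra.
by rewrite -(@lee_pmul2l _ a%:E) ?lte_fin // -EFinM.
Qed.

End UniformRecurrence.

(** * Absence of finite escape times *)

Section NoEscape.
Context {R : realType}.
Variables n p m : nat.

Lemma is_derive_sqr_enorm k (x : R -> 'rV[R]_k) (t : R) x' : is_derive t (1 : R) x x' ->
  is_derive t (1 : R) (fun t => enorm (x t) ^+ 2) (2 * dotv (x t) x').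
Proof.
move=> /is_derive_coord dx.
have dxx i : is_derive t (1 : R) (fun s => x s 0 i * x s 0 i) (2 * (x t 0 i * x' 0 i)).
  have d := dx i; apply: (is_derive_eq (is_deriveM d d)).
  by rewrite /= -[_ *: _]/(x t 0 i * x' 0 i); ring.
have := is_derive_sum dxx.
rewrite (_ : \sum_(i < k) (fun s => x s 0 i * x s 0 i) = fun s => enorm (x s) ^+ 2); last first.
  by apply/funext => s; rewrite sqr_enorm fct_sumE.
by move=> d; apply: (is_derive_eq d); rewrite -mulr_sumr.
Qed.

Variables (C D : set 'rV[R]_p) (f : 'rV[R]_n -> 'rV[R]_p -> R -> R -> 'rV[R]_n).
Variables (w : 'rV[R]_p -> 'rV[R]_p) (g : 'rV[R]_n -> 'rV[R]_p -> 'rV[R]_m -> 'rV[R]_n).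
Variables (h : 'rV[R]_p -> 'rV[R]_m -> 'rV[R]_p) (eps : R).
Let T4 : normedModType R := ('rV[R]_n * 'rV[R]_p * R * R)%type.
Variables (U : set T4) (F : T4 -> 'rV[R]_n).
Hypothesis C1F : Ck_open 1 U F.
Hypothesis U_nonneg : forall x r (s e : R), 0 <= s -> 0 <= e -> U (x, r, s, e).
Hypothesis fF : forall x r (s e : R), 0 <= s -> 0 <= e -> f x r s e = F (x, r, s, e).
Hypotheses (cC : closed C) (cw : continuous w) (eps_gt0 : 0 < eps).
Variables (Lx Rm : R).
Hypothesis Lx_ge0 : 0 <= Lx.
Hypothesis F_lip : forall x r tau, C r -> 0 <= tau -> enorm (F (x, r, tau, eps)) <= Lx * enorm x.
Hypothesis C_bounded : forall r, C r -> enorm r <= Rm.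
Let H := two_time_scale_SHDS C D f w g h eps.

(** Gronwall: by the linear growth of the field, the squared norm times [expR (- (2 * Lx) * t)] is
    nonincreasing. *)
Lemma flow_growth (y : R -> 'rV[R]_(n + p + 1)) (a b s t : R) : a < b ->
  abs_continuous a b y -> flows_ae H `[a, b] y -> a < s -> s <= t -> t < b ->
  enorm (state_x (y t)) ^+ 2 <= enorm (state_x (y s)) ^+ 2 * expR (2 * Lx * (t - s)).
Proof.
move=> ab acy fy as_ st tb.
have [x [xd [r [tau [_ rC tau0 xdE [dpath pathE]]]]]] :=
  flow_path C1F U_nonneg fF cC cw eps_gt0 ab acy fy.
have [<- _ _] := pathE t (ltW (lt_le_trans as_ st)) (ltW tb).
have [<- _ _] := pathE s (ltW as_) (ltW (le_lt_trans st tb)).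
pose q u := enorm (x u) ^+ 2 * expR (- (2 * Lx) * u).
have dq u : s <= u -> u <= t -> is_derive u (1 : R) q
    ((2 * dotv (x u) (xd u) - 2 * Lx * enorm (x u) ^+ 2) * expR (- (2 * Lx) * u)).
  move=> su ut; have [dx _ _] := dpath u (lt_le_trans as_ su) (le_lt_trans ut tb).
  have dk : is_derive u (1 : R) (fun u => - (2 * Lx) * u) (- (2 * Lx)).
    suff : is_derive u (1 : R) (- (2 * Lx) \*: (id : R -> R^o)) (- (2 * Lx) *: (1 : R)).
      by rewrite [_ *: _]mulr1.
    exact: is_deriveZ.
  have d2 := @is_derive1_comp _ expR (fun u => - (2 * Lx) * u) u _ _ (is_derive_expR _) dk.
  have dm := is_deriveM (is_derive_sqr_enorm dx) d2; apply: (is_derive_eq dm).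
  rewrite /= [X in X + _]/GRing.scale /= [X in _ + X]/GRing.scale /=; ring.
have : q t <= q s.
  apply: (is_derive_nonincreasing st dq) => u su ut; apply: mulr_le0_ge0; last exact: expR_ge0.
  have h1 := F_lip (x u) (rC u) (tau0 u); rewrite -xdE in h1.
  have h2 := dotv_le (x u) (xd u); have h3 := ler_wpM2l (enorm_ge0 (x u)) h1.
  lra.
rewrite /q => hq.
rewrite -(ler_pM2r (expR_gt0 (- (2 * Lx) * t))); apply: le_trans hq _.
rewrite -[leRHS]mulrA; apply: ler_wpM2l; first exact: exprn_ge0 (enorm_ge0 _).
by rewrite -expRD le_eqVlt; apply/orP; left; apply/eqP; congr expR; ring.
Qed.

Lemma no_escape : no_finite_escape_time H.
Proof.
move=> [T [y [T0 lac fl esc]]].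
(* The growth bound starts strictly inside the flow interval. On [[T / 2, T[] the x-part is then
   bounded by it, the r-part by compactness of [C], and [tau] grows linearly. *)
pose s := T / 2.
have s0 : 0 < s by rewrite divr_gt0.
have sT : s < T by rewrite /s; lra.
pose B := enorm (state_x (y s)) * expR (Lx * T) + Rm + (state_tau (y s) + T / eps).
have bound t : s <= t -> t < T -> enorm (y t) <= B.
  move=> st tT; pose b := (t + T) / 2.
  have tb : t < b by rewrite /b; lra.
  have bT : b < T by rewrite /b; lra.
  have b0 : 0 < b by rewrite (lt_trans s0) // (le_lt_trans st).
  have sub : `[0, b]%classic `<=` (`[0, T[%classic : set R).
    by move=> u; rewrite /= !in_itv /= => /andP[-> ub] /=; exact: le_lt_trans bT.
  have acy : abs_continuous 0 b y by apply: lac => //; exact: ltW.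
  have fy : flows_ae H `[0, b] y.
    apply: filterS fl; first exact: (ae_filter_ringOfSetsType lebesgue_measure).
    by move=> u hu /sub /hu.
  have hx := flow_growth b0 acy fy s0 st tb.
  have htau := flow_tau C1F U_nonneg fF cC cw eps_gt0 b0 acy fy (ltW s0) st (ltW tb).
  have [x [xd [r [tau [_ rC tau0 _ [_ pathE]]]]]] :=
    flow_path C1F U_nonneg fF cC cw eps_gt0 b0 acy fy.
  have [_ rE tE] := pathE t (ltW (lt_le_trans s0 st)) (ltW tb).
  rewrite -[y t]hsubmxK; apply: le_trans (enorm_row_mx_le _ _) _; apply: lerD.
    rewrite -[lsubmx (y t)]hsubmxK; apply: le_trans (enorm_row_mx_le _ _) _; apply: lerD.
      rewrite -/(state_x (y t)).
      rewrite -(@ler_pXn2r _ 2) ?nnegrE ?enorm_ge0 ?mulr_ge0 ?enorm_ge0 ?expR_ge0 //.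
      apply: (le_trans hx); rewrite exprMn; apply: ler_wpM2l; first exact: exprn_ge0 (enorm_ge0 _).
      rewrite expr2 -expRD ler_expR.
      have : 2 * Lx * (t - s) <= 2 * Lx * T by apply: ler_wpM2l; [exact: mulr_ge0|lra].
      lra.
    by rewrite -/(state_r (y t)) -rE; exact: C_bounded.
  rewrite -[leRHS]mul1r; apply: enorm_coord_le => i; rewrite ord1.
  rewrite -/(state_tau (y t)) ger0_norm; last by rewrite -tE.
  have : (t - s) / eps <= T / eps by rewrite ler_pM2r ?invr_gt0 //; lra.
  lra.
have /cvgryPgt/(_ B) escB := esc.
have [t [Bt st tT]] : exists t, [/\ B < enorm (y t), s < t & t < T].
  near (T^'-) => t; exists t; split; near: t; first exact: escB.
    exact: nbhs_left_gt.
  exact: nbhs_left_lt.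
by have := bound t (ltW st) tT; apply/negP; rewrite -ltNge.
Unshelve. all: by end_near. Qed.

End NoEscape.

(** * Elementary facts for the choice of constants *)

Section Constants.
Context {R : realType}.

Lemma compact_continuous_bound k (C : set 'rV[R]_k) (phi : 'rV[R]_k -> R) :
  compact C -> continuous phi -> exists2 M, 0 <= M & forall r, C r -> phi r <= M.
Proof.
move=> cC cphi.
have [M [_ HM]] := compact_bounded (continuous_compact (continuous_subspaceT cphi) cC).
exists (`|M| + 1) => [|r Cr]; first exact: addr_ge0.
apply: le_trans (ler_norm _) _; apply: HM; last by exists r.
by apply: le_lt_trans (ler_norm M) _; rewrite ltrDl.
Qed.

Lemma mul_small (e S B : R) : 0 <= S -> 0 < B -> 0 < e -> e <= B / (S + 1) -> e * S <= B.
Proof.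
move=> S0 B0 e0; rewrite ler_pdivlMr ?ltr_wpDl // mulrDr mulr1.
by apply: le_trans; rewrite lerDl ltW.
Qed.

(** The Lipschitz assumption in [eps] concerns positive values, while the average is defined by the
    field at 0; the closed inequality passes to the limit. *)
Lemma lipschitz_at_0 k (q : R -> 'rV[R]_k) (e B : R) : 0 < e ->
  (forall s, 0 <= s -> s <= e -> {for s, continuous q}) ->
  (forall s, 0 < s -> s < e -> enorm (q e - q s) <= B * `|e - s|) ->
  enorm (q e - q 0) <= B * e.
Proof.
move=> e0 cq qB.
pose h s := B * (e - s) - enorm (q e - q s).
have ch : {within `[0, e], continuous h}.
  apply: within_continuousB.
    apply: continuous_subspaceT; apply: continuous_mulf; first exact: continuous_cstf.
    by apply: continuous_subf; [exact: continuous_cstf|exact: continuous_idf].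
  apply: continuous_in_subspaceT => s; rewrite inE /= in_itv /= => /andP[s0 se].
  apply: (continuous_comp (f := fun s => q e - q s)); last exact: continuous_enorm.
  by apply: cvgB; [exact: cvg_cst|exact: cq].
have := closed_oo_cc e0 (@closed_ge R 0) ch _ (lexx 0) (ltW e0).
rewrite /h /= subr0 subr_ge0; apply => s s0 se.
by rewrite /= subr_ge0; have := qB s s0 se; rewrite ger0_norm // subr_ge0 ltW.
Qed.

Lemma closed_attractor n p (C D : set 'rV[R]_p) : closed C -> closed D ->
  closed (@attractor R n p C D).
Proof.
move=> cC cD; apply: closed_stack; last exact: closedU.
by apply: compact_closed; [exact: norm_hausdorff|exact: compact_set1].
Qed.

Lemma dist_attractor_state n p (C D : set 'rV[R]_p) (z : 'rV[R]_(n + p + 1)) :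
  (C `|` D) (state_r z) -> 0 <= state_tau z ->
  dist (stack (attractor C D) nonneg1) z = enorm (state_x z).
Proof.
move=> Kr t0; rewrite -[z in LHS]hsubmxK dist_stack_nonneg //.
by rewrite -[lsubmx z]hsubmxK dist_row_mx0.
Qed.

End Constants.

(** * Choice of the constants, recurrence of the tube and mean stability *)

Theorem theorem1 (R : realType) (n p m : nat)
  (C D : set 'rV[R]_p)
  (f : 'rV[R]_n -> 'rV[R]_p -> R -> R -> 'rV[R]_n)
  (w : 'rV[R]_p -> 'rV[R]_p)
  (g : 'rV[R]_n -> 'rV[R]_p -> 'rV[R]_m -> 'rV[R]_n)
  (h : 'rV[R]_p -> 'rV[R]_m -> 'rV[R]_p)
  (d : measure_display) (Omega : measurableType d) (P : probability Omega R)
  (mu : probability (borelType 'rV[R]_m) R)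
  (v : nat -> Omega -> 'rV[R]_m)
  (v_iid : iid P mu v)
  (eps_s : R) (eps_s_gt0 : 0 < eps_s)
  (fave : 'rV[R]_n -> 'rV[R]_p -> 'rV[R]_n)
  (A1 : regularity C D f w g h (values v) eps_s)
  (A2 : averaging C D f fave)
  (A3 : lyapunov C D w g h fave mu) :
  exists (eps_star : R) (phi : R -> R),
    [/\ 0 < eps_star, class_K phi &
     forall eps : R, 0 < eps < eps_star ->
       UGR P v (two_time_scale_SHDS C D f w g h eps)
           (stack (set_sum (attractor C D) (oball (phi eps))) nonneg1) /\
       (frozen_r_flow C f w eps_s ->
        UGES_M P v (two_time_scale_SHDS C D f w g h eps)
               (stack (attractor C D) nonneg1))].
Proof.
have [[[U [F [oU SU C1F fF']]] [cw cg ch] [cptC cptD]] [[f0 g0 [Lx Lx0 f_lip]]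
  [[Le Le0 f_eps] [Lg Lg0 g_lip] jump_K _]]] := A1.
have [C1G [gamma [[_ gamma_ge0 [Mg gamma_le] _ gamma_cvg] dev_avg]] [Lave Lave0 fave_lip]] := A2.
have [V [c1 [c2 [c3 [c4 [c5 [[UV [_ SV smoothV]]
  [c1_gt0 c2_gt0 c3_gt0 c4_gt0 c5_gt0] V_b V_fl [V_jump lambda]]]]]]]] := A3.
pose K := C `|` D.
have U_nonneg x r (s e : R) : 0 <= s -> 0 <= e -> U (x, r, s, e) by move=> s0 e0; apply: SU.
have fF x r (s e : R) : 0 <= s -> 0 <= e -> f x r s e = F (x, r, s, e).
  by move=> s0 e0; rewrite -fF'.
have cC : closed C by apply: compact_closed => //; exact: norm_hausdorff.
have cD : closed D by apply: compact_closed => //; exact: norm_hausdorff.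
have cK : closed K by exact: closedU.
have [Wm Wm0 w_le] : exists2 M, 0 <= M & forall r, C r -> enorm (w r) <= M.
  apply: (compact_continuous_bound (phi := fun r => enorm (w r)) cptC).
  exact: continuous_compf cw (@continuous_enorm R p).
have [Rm Rm0 C_le] := compact_continuous_bound cptC (@continuous_enorm R p).
have Mg0 : 0 <= Mg by apply: le_trans (gamma_le 0 (lexx 0)); exact: gamma_ge0.
have gamma_ge0' s : 0 < s -> 0 <= gamma s by move=> /ltW; exact: gamma_ge0.
have gamma_le' s : 0 < s -> gamma s <= Mg by move=> /ltW; exact: gamma_le.
have gamma_small e : 0 < e -> exists2 T, 0 < T & gamma T <= e.
  move=> e0; have /cvgrPdist_le/(_ _ e0) ge := gamma_cvg.
  near (pinfty_nbhs R) => T; exists T; first by near: T; exact: nbhs_pinfty_gt.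
  have : `|0 - gamma T| <= e by near: T.
  by rewrite sub0r normrN; apply: le_trans; exact: ler_norm.
have V_diff x r : K r -> differentiable V (row_mx x r).
  move=> Kr; have [dV _] := smoothV 1%N; apply: dV; apply: SV; split => //=.
  by rewrite row_mxKr.
have dist_x (x : 'rV[R]_n) r : K r -> dist (attractor C D) (row_mx x r) = enorm x.
  by move=> Kr; exact: dist_row_mx0.
have KV (x : 'rV[R]_n) r : K r -> stack setT K (row_mx x r).
  by move=> Kr; split => //=; rewrite row_mxKr.
have V_ge x r : K r -> c1 * enorm x ^+ 2 <= V (row_mx x r).
  by move=> Kr; have [_ + _ _] := V_b _ (KV x r Kr); rewrite dist_x.
have V_le x r : K r -> V (row_mx x r) <= c2 * enorm x ^+ 2.
  by move=> Kr; have [_ _ + _] := V_b _ (KV x r Kr); rewrite dist_x.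
have V_grad x r : K r -> enorm (gradient V (row_mx x r)) <= c3 * enorm x.
  by move=> Kr; have [_ _ _] := V_b _ (KV x r Kr); rewrite dist_x.
have V_flow x r : C r ->
    dotv (gradient V (row_mx x r)) (row_mx (fave x r) (w r)) <= - c4 * V (row_mx x r).
  move=> Cr; have := V_fl (row_mx x r); rewrite /Fave row_mxKl row_mxKr; apply.
  by split => //=; rewrite row_mxKr.
have g_bound x r u : D r -> values v u -> enorm (g x r u) <= Lg * enorm x.
  move=> Dr vu; have := g_lip r x 0 u (or_intror Dr) vu.
  by rewrite g0 ?subr0 //; right.
have F_lip e : 0 < e -> e < eps_s -> forall x r tau, K r -> 0 <= tau ->
    enorm (F (x, r, tau, e)) <= Lx * enorm x.
  move=> e0 es x r tau Kr t0.
  have e0s : 0 <= e < eps_s by rewrite (ltW e0).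
  have := f_lip r x 0 tau e Kr t0 e0s; rewrite f0 // !subr0.
  by rewrite fF // ltW.
have F_eps e : 0 < e -> e < eps_s -> forall x r tau, K r -> 0 <= tau ->
    enorm (F (x, r, tau, e) - F (x, r, tau, 0)) <= Le * enorm x * e.
  move=> e0 es x r tau Kr t0.
  apply: (lipschitz_at_0 (q := fun s => F (x, r, tau, s)) e0) => [s s0 se|s s0 se].
    have [dF _] := C1F.
    apply: (continuous_comp (f := fun s : R => (x, r, tau, s))).
      by apply: (continuous_pairf _ (@continuous_idf _)); exact: continuous_cstf.
    by apply: differentiable_continuous; apply: dF; exact: U_nonneg.
  have se' : 0 < s < eps_s by rewrite s0 (lt_trans se).
  have ee' : 0 < e < eps_s by rewrite e0.
  by have := f_eps r x tau e s Kr t0 ee' se'; rewrite !fF // ltW.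
(* The largest drift error that [averaged_rate] tolerates. One half of it goes to the errors
   proportional to [e], one quarter to the window mean, which fixes [L], and one quarter to the
   drift caused by [r], which fixes [K1]. *)
pose eta := c1 * c4 / (4 * c3).
have eta0 : 0 < eta by rewrite divr_gt0 // mulr_gt0.
have n1 : 0 < n%:R + 1 :> R by rewrite ltr_wpDl.
have [L L0 gammaL] : exists2 L, 0 < L & gamma L <= eta / 4 / (n%:R + 1).
  by apply: gamma_small; apply: divr_gt0 => //; exact: divr_gt0.
(* The added 1 makes the slope of the radius positive even if the quotient vanishes. *)
pose K1 := n%:R * (L * (Mg * (p%:R * Wm))) / (eta / 4) + 1.
have K1_ge : 0 <= n%:R * (L * (Mg * (p%:R * Wm))) by rewrite !mulr_ge0 // ltW.
have eta4 : 0 < eta / 4 by rewrite divr_gt0.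
have K1_gt0 : 0 < K1 by rewrite ltr_wpDl // divr_ge0 // ltW.
pose a1 := n%:R * (L * Mg).
pose S1 := n%:R * (L * (Mg * (n%:R * Lx))) + Le + Lave * a1.
have a10 : 0 <= a1 by rewrite !mulr_ge0 // ltW.
have S10 : 0 <= S1.
  by rewrite /S1 addr_ge0 ?addr_ge0 // !mulr_ge0 // ltW.
(* [V] is to decay at rate [2 * k], which must not exceed [c4 / 2]; the other bound keeps [expR k]
   below 11/10. *)
pose k := Num.min (c4 / 4) 11^-1.
have k_gt0 : 0 < k by rewrite lt_min divr_gt0 //= invr_gt0.
have k_le : k <= 11^-1 by rewrite ge_min lexx orbT.
have k_c4 : 2 * (2 * k) <= c4.
  have : k <= c4 / 4 by rewrite ge_min lexx.
  lra.
(* [S1] collects the drift errors per unit of [e], and [a1] is the relative size of the correction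
   per unit of [e]. The three bounds keep the drift below [eta] and the change of variable within
   the range of [lyapunov_perturb]; the summands 1 avoid a zero denominator. *)
pose b1 := eta / 2 / (S1 + 1); pose b2 := 250^-1 / (a1 + 1); pose b3 := c1 / (12 * c3) / (a1 + 1).
have b10 : 0 < b1 by apply: divr_gt0; [exact: divr_gt0|rewrite ltr_wpDl].
have b20 : 0 < b2 by apply: divr_gt0; [rewrite invr_gt0|rewrite ltr_wpDl].
have b30 : 0 < b3.
  by apply: divr_gt0; [apply: divr_gt0 => //; exact: mulr_gt0|rewrite ltr_wpDl].
exists (Num.min (Num.min eps_s b1) (Num.min b2 b3)), (fun e => K1 * e); split.
- by rewrite !lt_min eps_s_gt0 b10 b20 b30.
- split; last by rewrite mulr0.
    by apply: continuous_subspaceT; apply: continuous_mulf; [exact: continuous_cstf|exact: continuous_idf].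
  by move=> s t _ st; rewrite ltr_pM2l.
move=> e /andP[e0]; rewrite !lt_min => /andP[/andP[es eb1] /andP[eb2 eb3]].
pose alpha := e * a1.
have alpha_le : alpha <= 250^-1 by apply: mul_small (ltW eb2) => //; rewrite invr_gt0.
have alpha_c : 12 * c3 * alpha <= c1.
  have : alpha <= c1 / (12 * c3) by apply: mul_small (ltW eb3) => //; rewrite divr_gt0 // mulr_gt0.
  by rewrite ler_pdivlMr ?mulr_gt0 // mulrC.
have eta_le : 4 * c3 * eta <= c1 * c4.
  by rewrite /eta mulrC divfK // mulf_neq0 // gt_eqF.
have K1_large : n%:R * (L * (Mg * (p%:R * Wm))) <= eta / 4 * K1.
  by rewrite /K1 mulrDr mulr1 [eta / 4 * (_ / _)]mulrC divfK ?gt_eqF // lerDl ltW.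
have eta_split : n%:R * (e * (L * (Mg * (n%:R * Lx))) + gamma L) + Le * e + Lave * alpha + eta / 4 <= eta.
  have h1 : e * S1 <= eta / 2 by apply: mul_small (ltW eb1) => //; rewrite divr_gt0.
  have h2 : n%:R * gamma L <= eta / 4.
    apply: (@le_trans _ _ (n%:R * (eta / 4 / (n%:R + 1)))); first exact: ler_wpM2l.
    rewrite mulrA ler_pdivrMr ?ltr_wpDl // mulrC ler_pM2l //; lra.
  have -> : n%:R * (e * (L * (Mg * (n%:R * Lx))) + gamma L) + Le * e + Lave * alpha + eta / 4 =
    e * S1 + n%:R * gamma L + eta / 4 by rewrite /S1 /alpha; ring.
  lra.
have decay := flow_decay (g := g) (h := h) C1F C1G U_nonneg fF cC cw dev_avg gamma_small
  Lave0 Mg0 L0 gamma_ge0' gamma_le' w_le fave_lip c1_gt0 c3_gt0 c4_gt0 V_diff V_ge V_grad V_flow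
  e0 (F_lip e e0 es) (F_eps e e0 es) (lexx (gamma L)) (erefl alpha) alpha_le alpha_c (ltW eta0)
  eta_le (ltW eta4) K1_large eta_split.
pose H := two_time_scale_SHDS C D f w g h e; pose phi := K1 * e.
have phi0 : 0 < phi by exact: mulr_gt0.
pose Cst := majorant_constant c1 c2 k Lg.
have Cst0 : 0 < Cst by apply: majorant_constant_gt0; exact: ltW.
have domE (z : 'rV[R]_(n + p + 1)) : (flow_set H `|` jump_set H) z <-> K (state_r z) /\ 0 <= state_tau z.
  exact: domHP.
have inD y0 y om t j (ysol : random_solution v H y0 y) (y0d : (flow_set H `|` jump_set H) y0) :
    arc_dom (y om) (t, j) -> (flow_set H `|` jump_set H) (y om t j).
  move=> dt.
  exact: (solution_in_domain C1F U_nonneg fF cC cw e0 jump_K ysol dt (or_introl y0d)).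
split.
  have nearE : stack (set_sum (attractor C D) (oball phi)) nonneg1 `&` (flow_set H `|` jump_set H) =
      near_attractor C D phi.
    apply/seteqP; split=> z.
      by move=> [zn /domE[Kr t0]]; split => //; exact: (attractor_nbhd phi Kr t0).1.
    move=> [xphi Kr t0]; split; first exact: (attractor_nbhd phi Kr t0).2.
    exact/domE.
  split.
  - exists [set z | enorm (state_x z) < phi].
      apply: (open_preimage (f := fun z => enorm (state_x z)) _ (@open_lt R phi)).
      exact: continuous_compf (@continuous_state_x R n p) (@continuous_enorm R n).
    apply/seteqP; split=> z [zn zd]; split => //; have [Kr t0] := (domE z).1 zd.
      exact: (attractor_nbhd phi Kr t0).1.
    exact: (attractor_nbhd phi Kr t0).2.
  - apply: (no_escape C1F U_nonneg fF cC cw e0 Lx0 _ C_le) => x r tau Cr.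
    by apply: F_lip => //; left.
  move=> rho r rho0 r0.
  have [theta th0 hth] : exists2 theta : R, 0 <= theta &
      forall y0 y, cball r y0 -> random_solution v H y0 y ->
      ((1 - rho)%:E <= P [set om | graph (y om) `<=` Gamma_lt theta `*` setT \/
        graph (y om) `&` (Gamma_le theta `*` (stack (set_sum (attractor C D) (oball phi)) nonneg1 `&`
          (flow_set H `|` jump_set H))) !=set0])%E.
    apply: (recurrence_of_majorant (X := fun z => enorm (state_x z)) (phi := phi) (k := k)
      (Cst := Cst) (S := near_attractor_core C D phi)) => //.
    - exact: ltW.
    - move=> z; rewrite enorm_ge0 /=; apply: (@le_trans _ _ (enorm (lsubmx z))).
        by rewrite -[lsubmx z in leRHS]hsubmxK; exact: enorm_row_mxl.
      by rewrite -[z in leRHS]hsubmxK; exact: enorm_row_mxl.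
    - by move=> i; exact: closed_near_attractor_core.
    - by rewrite nearE near_attractor_bigcup.
    - move=> z /domE[Kr t0] nz; rewrite leNgt; apply/negP => xphi; apply: nz.
      exact: (attractor_nbhd phi Kr t0).2.
    - move=> y0 y om t j ysol y0d dt.
      exact: (start_outside_domain C1F U_nonneg fF cC cw e0 ysol y0d dt).
    move=> y0 y th ysol y0d; rewrite nearE.
    have [Kn [Kn_compact KnE]] := near_attractor_compact_bigcup n cK phi.
    apply: (system_majorant v_iid C1F U_nonneg fF cC cD cw e0 cg ch jump_K ysol c1_gt0 c2_gt0 c5_gt0
      V_ge V_le V_jump lambda (ltW Lg0) g_bound k_le Kn_compact KnE _ th y0d).
    (* A flow that avoids the tube satisfies the lower bound [K1 * e] on the norm of its x-component
       throughout, so the drift in [r] is absorbed. *)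
    move=> z a b ab acz fz nO; apply: (decay z a b (2 * k) ab acz fz k_c4); right=> t at_ tb.
    have [x [xd [rr [tau [_ rC tau0 _ [_ pathE]]]]]] := flow_path C1F U_nonneg fF cC cw e0 ab acz fz.
    have [_ rE tE] := pathE t at_ tb.
    rewrite leNgt; apply/negP => xphi; apply: (nO t at_ tb); split => //.
      by rewrite -rE; left.
    by rewrite -tE.
  by exists theta => [|y0 y ry0 [ysol _]]; [exact: th0|exact: (hth y0 y ry0 ysol)].
move=> frozen; split; first by apply: closed_stack; [exact: closed_attractor|exact: closed_nonneg1].
exists Cst, k; split => // y0 y y0d ysol T J [_ _ TJ _].
(* With an empty target and no horizon the majorant bounds a path at all of its hybrid times at
   once, in particular at the random one. *)
have [B [mB B0 iB hB]] : exists B : Omega -> \bar R,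
  [/\ measurable_fun setT B, forall om, (0 <= B om)%E,
     (\int[P]_om B om <= (Cst * enorm (state_x y0))%:E)%E
   & forall om t j, arc_dom (y om) (t, j) -> ((t + j%:R)%:E <= +oo)%E ->
     (forall t' j', arc_dom (y om) (t', j') -> ((t' + j'%:R)%:E <= +oo)%E -> ~ set0 (y om t' j')) ->
     ((enorm (state_x (y om t j)) * expR (k * (t + j%:R)))%:E <= B om)%E].
  apply: (system_majorant (Kn := fun=> set0) v_iid C1F U_nonneg fF cC cD cw e0 cg ch jump_K ysol
      c1_gt0 c2_gt0 c5_gt0 V_ge V_le V_jump lambda (ltW Lg0) g_bound k_le _ _ _ _ y0d).
  - by move=> i; exact: compact0.
  - by rewrite bigcup0.
  (* The orthogonality condition is applied at [eps = 0], where the deviation is defined; no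
     distance from the attractor is then required. *)
  move=> z a b ab acz fz _; apply: (decay z a b (2 * k) ab acz fz k_c4); left=> x r s Cr s0.
  by apply: frozen => //; rewrite lexx ltW.
have distE (z : 'rV[R]_(n + p + 1)) : (flow_set H `|` jump_set H) z ->
    dist (stack (attractor C D) nonneg1) z = enorm (state_x z).
  by move=> /domE[Kr t0]; exact: dist_attractor_state.
rewrite unlock (distE _ y0d); apply: le_trans iB; apply: ge0_integral_mono => om.
  by rewrite lee_fin distE ?mulr_ge0 ?enorm_ge0 ?expR_ge0 //; exact: inD ysol y0d (TJ om).
rewrite distE; last exact: inD ysol y0d (TJ om).
by apply: hB; [exact: TJ|exact: leey|move=> ? ? ? ? []].
Unshelve. all: by end_near. Qed.
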